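(* Let $f$ be any real-valued function square integrable on $[-\pi,0)$ and on $(0,\pi]$. Then $f$ can be expanded into the Fourier series of the normalized eigenfunctions $(\varphi_n)$ of the problem described in the context in the sense of mean-square convergence, namely $$\lim_{n\to\infty}\Big\{\frac{\Delta_{34}}{p_1}\int_{-\pi}^{0}\Big(f(x)-\sum_{k=0}^{n}c_k(f)\varphi_k(x)\Big)^2dx+\frac{\Delta_{12}}{p_2}\int_{0}^{\pi}\Big(f(x)-\sum_{k=0}^{n}c_k(f)\varphi_k(x)\Big)^2dx\Big\}=0,$$ where $$c_k(f)=\frac{\Delta_{34}}{p_1}\int_{-\pi}^{0}f(\xi)\varphi_k(\xi)\,d\xi+\frac{\Delta_{12}}{p_2}\int_{0}^{\pi}f(\xi)\varphi_k(\xi)\,d\xi .$$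
   Context: Problem. Let $p(x)=p_1>0$ for $x\in[-\pi,0)$ and $p(x)=p_2>0$ for $x\in(0,\pi]$ ($p_1,p_2$ constants). Let $q$ be a real-valued function, continuous on each of $[-\pi,0)$ and $(0,\pi]$, with finite one-sided limits $q(0-)$, $q(0+)$. Let $\alpha,\beta\in\mathbb{R}$ and let $\beta^{\pm}_{ij}$ ($i=1,2$, $j=0,1$) be real numbers. For a complex parameter $\lambda$ consider the equation $$-p(x)y''(x)+q(x)y(x)=\lambda y(x)\quad\text{on } [-\pi,0)\cup(0,\pi],$$ with boundary conditions $\cos\alpha\, y(-\pi)+\sin\alpha\, y'(-\pi)=0$ and $\cos\beta\, y(\pi)+\sin\beta\, y'(\pi)=0$, and transmission conditions $$\beta^{-}_{i1}y'(0-)+\beta^{-}_{i0}y(0-)+\beta^{+}_{i1}y'(0+)+\beta^{+}_{i0}y(0+)=0,\qquad i=1,2.$$ Here $0\pm$ denote one-sided limits at $0$. An eigenvalue is a $\lambda\in\mathbb{C}$ for which this problem has a nontrivial solution (an eigenfunction). Let $T=\begin{pmatrix}\beta^{+}_{10}&\beta^{+}_{11}&\beta^{-}_{10}&\beta^{-}_{11}\\ \beta^{+}_{20}&\beta^{+}_{21}&\beta^{-}_{20}&\beta^{-}_{21}\end{pmatrix}$ and, for $1\le i<j\le4$, let $\Delta_{ij}$ be the determinant of the $2\times 2$ matrix formed by the $i$-th and $j$-th columns of $T$. Standing assumptions: $\Delta_{12}>0$, $\Delta_{34}>0$, and $\lambda=0$ is not an eigenvalue. Eigenfunctions. $\phi_1(\cdot,\lambda)$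 is the solution of the equation on $[-\pi,0)$ with $u(-\pi)=\sin\alpha$, $u'(-\pi)=-\cos\alpha$; $\phi_2(\cdot,\lambda)$ is the solution on $(0,\pi]$ with $u(0+)=\frac{1}{\Delta_{12}}\big(\Delta_{23}\phi_1(0-,\lambda)+\Delta_{24}\phi_1'(0-,\lambda)\big)$, $u'(0+)=-\frac{1}{\Delta_{12}}\big(\Delta_{13}\phi_1(0-,\lambda)+\Delta_{14}\phi_1'(0-,\lambda)\big)$. The problem has countably infinitely many eigenvalues; $\lambda_0,\lambda_1,\lambda_2,\dots$ is an enumeration of all of them (each listed once). The function $\phi_n(x)$, equal to $\phi_1(x,\lambda_n)$ on $[-\pi,0)$ and to $\phi_2(x,\lambda_n)$ on $(0,\pi]$, is an eigenfunction for $\lambda_n$, and the normalized eigenfunctions are $$\varphi_n(x)=\Big(\tfrac{\Delta_{34}}{p_1}\int_{-\pi}^{0}\phi_n^2(\xi)\,d\xi+\tfrac{\Delta_{12}}{p_2}\int_{0}^{\pi}\phi_n^2(\xi)\,d\xi\Big)^{-1/2}\phi_n(x).$$ *)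

(* Defs.v *)
From HB Require Import structures.
From mathcomp Require Import all_boot all_order all_algebra.
From mathcomp Require Import all_classical all_reals all_analysis.
From mathcomp Require Import complex.

Set Implicit Arguments.
Unset Strict Implicit.
Unset Printing Implicit Defensive.

Import Order.TTheory GRing.Theory Num.Theory.
Import numFieldNormedType.Exports.

Local Open Scope classical_set_scope.
Local Open Scope ring_scope.
Local Open Scope complex_scope.

(* [bv_bminus i j] is beta^-_{i+1,j} and [bv_bplus i j] is beta^+_{i+1,j}. *)
Record bvtp (R : realType) := Bvtp {
  bv_p1 : R;
  bv_p2 : R;
  bv_q : R -> R;
  bv_alpha : R;
  bv_beta : R;
  bv_bminus : 'M[R]_2;
  bv_bplus : 'M[R]_2 }.

Section Definitions.
Context {R : realType}.

Definition Jminus : set R := `[- pi, 0[.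
Definition Jplus : set R := `]0, pi].

Definition piecewise (T : Type) (a b : R -> T) (x : R) : T :=
  if x < 0 then a x else b x.

(* Derivative relative to D, hence one-sided at an end point of D. R[i]^o is
   R[i] with the topology of its modulus. *)
Definition deriv_on (D : set R) (u : R -> R[i]) (x : R) (l : R[i]) : Prop :=
  (u t - u x) / (t - x)%:C @[t --> within D x^'] --> (l : R[i]^o).

Definition left_lim0 (u : R -> R[i]) (l : R[i]) : Prop :=
  u t @[t --> (0 : R)^'-] --> (l : R[i]^o).
Definition right_lim0 (u : R -> R[i]) (l : R[i]) : Prop :=
  u t @[t --> (0 : R)^'+] --> (l : R[i]^o).

(* The integrals below are taken for the completed measure, so that
   measurability is Lebesgue (not only Borel) measurability. *)
Definition square_integrable_on (D : set R) (f : R -> R) : Prop :=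
  measurable_fun (D : set (caratheodory_type (wlength (@idfun R))^*%mu)) f /\
  (@completed_lebesgue_measure R).-integrable D (fun x => ((f x) ^+ 2)%:E).

Definition Cintegral (D : set R) (f : R -> R[i]) : R[i] :=
  (\int[@completed_lebesgue_measure R]_(x in D) complex.Re (f x)) +i*
  (\int[@completed_lebesgue_measure R]_(x in D) complex.Im (f x)).

Variable P : bvtp R.

Definition pcoef : R -> R := piecewise (fun=> bv_p1 P) (fun=> bv_p2 P).

Definition solution_on (D : set R) (lam : R[i]) (u du : R -> R[i]) : Prop :=
  forall x, D x -> deriv_on D u x (du x) /\
    exists2 d2u : R[i], deriv_on D du x d2u &
      - (pcoef x)%:C * d2u + (bv_q P x)%:C * u x = lam * u x.

Definition transmission (um dum up dup : R[i]) : Prop :=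
  forall i : 'I_2, (bv_bminus P i 1)%:C * dum + (bv_bminus P i 0)%:C * um +
                   (bv_bplus P i 1)%:C * dup + (bv_bplus P i 0)%:C * up = 0.

Definition bv_eigenfunction (lam : R[i]) (u : R -> R[i]) : Prop :=
  exists du : R -> R[i],
  [/\ solution_on Jminus lam u du /\ solution_on Jplus lam u du,
      (cos (bv_alpha P))%:C * u (- pi) + (sin (bv_alpha P))%:C * du (- pi) = 0,
      (cos (bv_beta P))%:C * u pi + (sin (bv_beta P))%:C * du pi = 0,
      exists um dum up dup : R[i],
        [/\ left_lim0 u um, left_lim0 du dum,
            right_lim0 u up, right_lim0 du dup &
            transmission um dum up dup] &
      exists2 x, (Jminus `|` Jplus) x & u x != 0].

Definition bv_eigenvalue : set R[i] :=
  [set lam | exists u : R -> R[i], bv_eigenfunction lam u].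

Definition Tmx : 'M[R]_(2, 4) := row_mx (bv_bplus P) (bv_bminus P).

(* The indices i, j are 1-based. *)
Definition Delta (i j : nat) : R :=
  \det (colsub (fun k : 'I_2 => inord (if k == 0 then i else j).-1) Tmx).

Definition is_phi1 (lam : R[i]) (u du : R -> R[i]) : Prop :=
  [/\ solution_on Jminus lam u du,
      u (- pi) = (sin (bv_alpha P))%:C & du (- pi) = - (cos (bv_alpha P))%:C].

Definition is_phi2 (lam : R[i]) (u1 du1 u2 du2 : R -> R[i]) : Prop :=
  solution_on Jplus lam u2 du2 /\
  exists a b : R[i],
    [/\ left_lim0 u1 a, left_lim0 du1 b,
        right_lim0 u2
          ((Delta 1 2)^-1%:C * ((Delta 2 3)%:C * a + (Delta 2 4)%:C * b)) &
        right_lim0 du2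
          (- (Delta 1 2)^-1%:C * ((Delta 1 3)%:C * a + (Delta 1 4)%:C * b))].

Definition wintegral (f : R -> R[i]) : R[i] :=
  (Delta 3 4 / bv_p1 P)%:C * Cintegral Jminus f +
  (Delta 1 2 / bv_p2 P)%:C * Cintegral Jplus f.

(* Eigenfunctions are R[i]-valued a priori, but the squares here and in the
   theorem are plain squares, not squared moduli. *)
Definition wnormalize (phi : R -> R[i]) (x : R) : R[i] :=
  (sqrtC (wintegral (fun t => phi t ^+ 2)))^-1 * phi x.

Definition fourier_coef (f : R -> R) (phi : R -> R[i]) : R[i] :=
  wintegral (fun t => (f t)%:C * phi t).

End Definitions.

(* Main.v *)
Require Import Defs.
From HB Require Import structures.
From mathcomp Require Import all_boot all_order all_algebra.
From mathcomp Require Import all_classical all_reals all_analysis.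
From mathcomp Require Import complex.
From mathcomp Require Import measurable_realfun ring lra.

(* Since 0 is not an eigenvalue, the operator L u = - p u'' + q u with the given
   boundary and transmission conditions has an everywhere defined inverse on the
   piecewise continuous functions, and the Plucker relation between the Delta_ij
   makes L symmetric for the weighted inner product.  For real mu, Gronwall's
   inequality gives |u| <= K |L u - mu u| for all u if mu is not an eigenvalue,
   and for all u orthogonal to the eigenfunction if it is.  On the orthogonal
   complement of the first n eigenfunctions Schwarz's iteration u, L^-1 u,
   L^-2 u, .. then shows |L u| >= Lam |u| if all the other eigenvalues have
   modulus at least Lam: otherwise the iterates would be approximate eigenvectors
   for a parameter of modulus less than Lam at which these bounds hold.  As the
   sum of the 1 / lam_k ^ 2 converges, Lam can be taken arbitrarily large with
   growing n, so the expansion of every u in the domain of L converges to u in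
   mean square, and the domain is dense: it contains the piecewise C^2 functions
   that vanish to first order at -pi, 0 and pi. *)

Set Implicit Arguments.
Unset Strict Implicit.
Unset Printing Implicit Defensive.

Import Order.TTheory GRing.Theory Num.Theory.
Import numFieldNormedType.Exports.

Local Open Scope classical_set_scope.
Local Open Scope ring_scope.
Local Open Scope complex_scope.

(** * Calculus on the real line *)

Section Calculus.
Context {R : realType}.
Implicit Types (F G f g u v : R -> R) (a b c x y : R).

(** The pointwise bound |u(x)|^2 <= M |L u|^2, stronger than a bound in mean square, does the work
    of compactness: at fixed x it makes the sum of the 1 / lam_k^2 finite, and integrated it keeps
    the ratios in Schwarz's iteration bounded. All bounds come from one initial value problem: a
    solution started at -pi is carried across 0 by the transmission conditions, and a real mu is an
    eigenvalue exactly if the second boundary form vanishes on the solution phi that satisfies the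
    first condition. What shapes the proof is the form of the data: solutions are complex-valued,
    live on half-open intervals, and have only limits at 0. They are split into real and imaginary
    parts, and each half is extended to a C^2 function on the whole line. Symmetry forces the
    eigenvalues to be real, and from there on all functions are real with derivatives defined
    everywhere. Integrals of continuous pieces are differences of antiderivatives; finer measure
    theory enters with the density of the domain, since f is measurable only for the completed
    Lebesgue measure. *)

Definition has_deriv F f := forall x, is_derive x (1 : R) F (f x).

Lemma has_derivD F G f g : has_deriv F f -> has_deriv G g ->
  has_deriv (fun x => F x + G x) (fun x => f x + g x).
Proof. by move=> dF dG x; exact: is_deriveD. Qed.

Lemma has_derivB F G f g : has_deriv F f -> has_deriv G g ->
  has_deriv (fun x => F x - G x) (fun x => f x - g x).
Proof. by move=> dF dG x; exact: is_deriveB. Qed.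

Lemma has_derivM F G f g : has_deriv F f -> has_deriv G g ->
  has_deriv (fun x => F x * G x) (fun x => f x * G x + F x * g x).
Proof.
move=> dF dG x; apply: is_derive_eq; first exact: is_deriveM.
by rewrite /GRing.scale /= addrC [G x * _]mulrC.
Qed.

Lemma has_derivZ c F f : has_deriv F f -> has_deriv (fun x => c * F x) (fun x => c * f x).
Proof. by move=> dF x; exact: is_deriveZ. Qed.

Lemma has_deriv_cst c : has_deriv (fun=> c) (fun=> 0).
Proof. by move=> x; exact: is_derive_cst. Qed.

Lemma has_deriv_id : has_deriv id (fun=> 1).
Proof. by move=> x; exact: is_derive_id. Qed.

Lemma eq_has_deriv F f g : has_deriv F f -> f =1 g -> has_deriv F g.
Proof. by move=> dF fg x; rewrite -fg. Qed.

Lemma has_deriv_expR c : has_deriv (fun x => expR (c * x)) (fun x => c * expR (c * x)).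
Proof.
move=> x; have := is_derive1_comp (is_derive_expR _) (has_derivZ c has_deriv_id x).
by rewrite mulr1 mulrC.
Qed.

Lemma is_derive_continuous x F d : is_derive x (1 : R) F d ->
  {for x, continuous F}.
Proof.
by move=> [dF _]; apply: differentiable_continuous; exact/derivable1_diffP.
Qed.

Lemma has_deriv_continuous F f : has_deriv F f -> continuous F.
Proof. by move=> dF x; exact: is_derive_continuous (dF x). Qed.

Lemma continuous_funD f g : continuous f -> continuous g -> continuous (fun x => f x + g x).
Proof. by move=> cf cg x; apply: cvgD; [exact: cf|exact: cg]. Qed.

Lemma continuous_funB f g : continuous f -> continuous g -> continuous (fun x => f x - g x).
Proof. by move=> cf cg x; apply: cvgB; [exact: cf|exact: cg]. Qed.

Lemma continuous_funM f g : continuous f -> continuous g -> continuous (fun x => f x * g x).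
Proof. by move=> cf cg x; apply: cvgM; [exact: cf|exact: cg]. Qed.

Lemma continuous_funZ c f : continuous f -> continuous (fun x => c * f x).
Proof. by move=> cf; apply: continuous_funM => // x; exact: cvg_cst. Qed.

Lemma has_deriv_ge0_le a b F f : has_deriv F f -> a <= b ->
  (forall x, a <= x <= b -> 0 <= f x) -> F a <= F b.
Proof.
move=> dF ab f0.
have [c /[!in_itv]/= cab Fab] := MVT_segment ab (fun x _ => dF x)
  (continuous_subspaceT (has_deriv_continuous dF)).
by rewrite -subr_ge0 Fab mulr_ge0 ?f0 ?subr_ge0.
Qed.

Lemma has_deriv_le_le a b F G f g : has_deriv F f -> has_deriv G g -> a <= b ->
  (forall x, a <= x <= b -> f x <= g x) -> F b - F a <= G b - G a.
Proof.
move=> dF dG ab fg.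
have := has_deriv_ge0_le (has_derivB dG dF) ab.
have /[swap]/[apply] : forall x, a <= x <= b -> 0 <= g x - f x.
  by move=> x /fg; rewrite subr_ge0.
lra.
Qed.

Lemma has_deriv_eq_eq a b F G f g : has_deriv F f -> has_deriv G g -> a <= b ->
  (forall x, a <= x <= b -> f x = g x) -> F b - F a = G b - G a.
Proof.
move=> dF dG ab fg; apply/eqP; rewrite eq_le.
by rewrite (has_deriv_le_le dF dG) ?(has_deriv_le_le dG dF)// => x /fg->.
Qed.

Lemma continuous_itv_integrable a b f : continuous f ->
  lebesgue_measure.-integrable `[a, b] (EFin \o f).
Proof.
move=> cf; apply: continuous_compact_integrable; first exact: segment_compact.
exact: continuous_subspaceT.
Qed.

(** An integral from a fixed base point is an antiderivative only to the right of that point. The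
    base is therefore taken below both [a] and [y]; additivity makes the value independent of it
    ([FG]), and around each [x] one base can be kept fixed. *)
Lemma antiderivative f a c : continuous f -> exists2 F, has_deriv F f & F a = c.
Proof.
move=> cf.
pose G b y : R := \int[lebesgue_measure]_(t in `[b, y]) f t.
have GB b b' y : b < b' -> b' <= y -> G b y = G b b' + G b' y.
  move=> bb b'y; have := @Rintegral_itvB _ f (BLeft b) (BRight y) b'.
  rewrite (@Rintegral_itv_obnd_cbnd _ b'); last first.
    apply: integrableS (continuous_itv_integrable b' y cf) => //.
    by move=> z /=; rewrite !in_itv/= => /andP[/ltW-> ->].
  rewrite /G => /(_ (continuous_itv_integrable _ _ cf)) <-.
  - by rewrite addrC subrK.
  - by rewrite bnd_simp ltW.
  - by rewrite bnd_simp.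
pose F y := G (Num.min a y - 1) y - G (Num.min a y - 1) a + c.
have FG b y : b < a -> b < y -> F y = G b y - G b a + c.
  move=> ba by_; rewrite /F; set m := Num.min _ _ - 1.
  have ma : m < a by rewrite /m ltrBlDr gt_min ltrDl ltr01.
  have my : m < y by rewrite /m ltrBlDr gt_min ltrDl ltr01 orbT.
  case: (ltgtP m b) => [mb|bm|-> //].
    by rewrite (GB m b y mb (ltW by_)) (GB m b a mb (ltW ba)); ring.
  by rewrite (GB b m y bm (ltW my)) (GB b m a bm (ltW ma)); ring.
exists F; last by rewrite /F subrr add0r.
move=> x.
pose b := Num.min a x - 1.
have ba : b < a by rewrite /b ltrBlDr gt_min ltrDl ltr01.
have bx : b < x by rewrite /b ltrBlDr gt_min ltrDl ltr01 orbT.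
apply: (@near_eq_is_derive _ _ _ (fun y => G b y - G b a + c)).
- near=> y; rewrite (FG b)//; near: y.
  exact: lt_nbhsr.
- have [dG G'] := @continuous_FTC1_closed _ f b x (x + 1) ltac:(lra)
    (continuous_itv_integrable _ _ cf) bx (cf x).
  have dGx : is_derive x (1 : R) (G b) (f x).
    by apply: DeriveDef; [exact: dG|rewrite -derive1E].
  have := is_deriveD (is_deriveD dGx (is_derive_cst (- G b a) x 1))
    (is_derive_cst c x 1).
  by rewrite !addr0.
Unshelve. all: by end_near. Qed.

Definition C2 u du ddu := [/\ has_deriv u du, has_deriv du ddu & continuous ddu].

End Calculus.

(** * Linear second order equations *)

Section LinearODE.
Context {R : realType}.
Implicit Types (F G f g c u v : R -> R) (a b x y : R).

Lemma continuous_itv_bounded a b f : continuous f ->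
  exists2 A : R, 0 < A & forall x, a <= x <= b -> `|f x| <= A.
Proof.
move=> cf; have [ab|ba] := leP a b; last first.
  by exists 1 => // x /andP[ax xb]; have := le_lt_trans (le_trans ax xb) ba; rewrite ltxx.
have cnf : continuous (fun x => `|f x|).
  by move=> x; apply: cvg_norm; exact: cf.
have [m mab fm] := EVT_max ab (continuous_subspaceT cnf).
exists (`|f m| + 1); first by rewrite ltr_wpDl.
by move=> x xab; rewrite (le_trans (fm x _))// ?in_itv//= lerDl.
Qed.

(* Differentiating [exp (- (2 + A) (x - a)) (u^2 + u'^2) - H]. *)
Lemma gronwall a b A u du ddu c h H : C2 u du ddu ->
  (forall x, a <= x <= b -> `|c x| <= A) ->
  (forall x, a <= x <= b -> ddu x = c x * u x + h x) ->
  has_deriv H (fun x => h x ^+ 2) ->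
  forall x, a <= x <= b -> u x ^+ 2 + du x ^+ 2 <=
    expR ((2 + A) * (x - a)) * (u a ^+ 2 + du a ^+ 2 + (H x - H a)).
Proof.
move=> [du1 du2 _] cA ueq dH x /andP[ax xb].
have A0 : 0 <= A by rewrite (le_trans _ (cA a _))// lexx (le_trans ax xb).
pose B := 2 + A.
pose E y := u y * u y + du y * du y.
have dE : has_deriv E (fun y => (du y * u y + u y * du y) +
    (ddu y * du y + du y * ddu y)) by exact: has_derivD (has_derivM du1 du1) (has_derivM du2 du2).
have dw : has_deriv (fun y => expR (B * a) * expR (- B * y))
  (fun y => expR (B * a) * (- B * expR (- B * y))).
  exact/has_derivZ/has_deriv_expR.
have dPhi := has_derivM dw dE.
have wE y : expR (B * a) * expR (- B * y) = expR (- (B * (y - a))).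
  by rewrite -expRD; congr expR; ring.
have := has_deriv_le_le dPhi dH ax.
have /[swap]/[apply] : forall y, a <= y <= x ->
    expR (B * a) * (- B * expR (- B * y)) * E y +
    expR (B * a) * expR (- B * y) * (du y * u y + u y * du y +
      (ddu y * du y + du y * ddu y)) <= h y ^+ 2.
  move=> y /andP[ay yx]; have yab : a <= y <= b by rewrite ay (le_trans yx xb).
  set w := expR (B * a) * expR (- B * y).
  have w01 : 0 <= w <= 1.
    rewrite /w wE expR_ge0/= -[leRHS]expR0 ler_expR oppr_le0 mulr_ge0 ?subr_ge0//.
    by rewrite /B; lra.
  have -> : expR (B * a) * (- B * expR (- B * y)) = - B * w by rewrite /w; ring.
  rewrite ueq//; have := cA y yab; rewrite ler_norml => cAy.
  (* The derivative of [E] is [2 u u' (1 + c) + 2 u' h]. The two halves of this sum are at most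
     [(1 + A) E] and [u'^2 + h^2], whence the rate [2 + A]. *)
  have h1 : u y * du y * (1 + c y) *+ 2 <= (1 + A) * (u y ^+ 2 + du y ^+ 2).
    have h1p : 0 <= (u y + du y) ^+ 2 by exact: sqr_ge0.
    have h1m : 0 <= (u y - du y) ^+ 2 by exact: sqr_ge0.
    have [s0|s0] := leP 0 (u y * du y).
      have : u y * du y * (1 + c y) <= u y * du y * (1 + A).
        by apply: ler_wpM2l => //; lra.
      nra.
    have : - (u y * du y) * - (1 + c y) <= - (u y * du y) * (1 + A).
      by apply: ler_wpM2l; lra.
    nra.
  have h2 : du y * h y *+ 2 <= du y ^+ 2 + h y ^+ 2.
    have := sqr_ge0 (du y - h y); nra.
  have h3 : 2 * (du y * u y) + 2 * du y * (c y * u y + h y) - B * E y <= h y ^+ 2.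
    rewrite /E /B; have := sqr_ge0 (u y); nra.
  have := sqr_ge0 (h y); case/andP: w01 => w0 w1.
  have : w * (2 * (du y * u y) + 2 * du y * (c y * u y + h y) - B * E y) <= w * h y ^+ 2.
    exact: ler_wpM2l.
  have : w * h y ^+ 2 <= h y ^+ 2 by rewrite ler_piMl// sqr_ge0.
  nra.
rewrite /= !wE subrr mulr0 oppr0 expR0 mul1r => Phi.
have : expR (- (B * (x - a))) * E x <= E a + (H x - H a) by lra.
rewrite -(ler_pM2l (expR_gt0 (B * (x - a)))) mulrA -expRD subrr expR0 mul1r.
by rewrite /E -!expr2.
Qed.

(** [lo n x] and [hi n x] bound nested intervals around [f n x], whose half-width [2 K / 2^n] is the
    whole remaining geometric tail. The limit is the supremum of their left ends, and it is
    continuous as a uniform limit. *)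
Lemma geometric_uniform_limit (f : nat -> R -> R) K :
  (forall n, continuous (f n)) ->
  (forall n x, `|f n.+1 x - f n x| <= K * 2^-1 ^+ n) ->
  exists2 g, continuous g & forall n x, `|g x - f n x| <= K * 2^-1 ^+ n *+ 2.
Proof.
move=> cf fK.
pose lo n x := f n x - K * 2^-1 ^+ n *+ 2.
pose hi n x := f n x + K * 2^-1 ^+ n *+ 2.
have loS n x : lo n x <= lo n.+1 x.
  by have := fK n x; rewrite ler_norml /lo exprS; lra.
have hiS n x : hi n.+1 x <= hi n x.
  by have := fK n x; rewrite ler_norml /hi exprS; lra.
have K0 n : 0 <= K * 2^-1 ^+ n by rewrite (le_trans _ (fK n 0)).
have lohi n m x : lo n x <= hi m x.
  apply: (@le_trans _ _ (lo (maxn n m) x)).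
    by apply: (@homo_leq _ (lo^~ x) (fun a b => a <= b)) (leq_maxl _ _) => //;
      exact: le_trans.
  apply: (@le_trans _ _ (hi (maxn n m) x)).
    by rewrite /lo /hi; have := K0 (maxn n m); lra.
  apply: (@homo_leq _ (hi^~ x) (fun a b => b <= a)) (leq_maxr _ _) => //.
  by move=> ? ? ? /[swap]; exact: le_trans.
pose g x := sup (range (lo^~ x)).
have lo_sup x : has_sup (range (lo^~ x)).
  by split; [exists (lo 0 x), 0%N|exists (hi 0 x) => _ [n _ <-]].
have gf n x : `|g x - f n x| <= K * 2^-1 ^+ n *+ 2.
  have : lo n x <= g x by apply: ub_le_sup; [exact: (lo_sup x).2|exists n].
  have : g x <= hi n x by apply: ge_sup; [exact: (lo_sup x).1|move=> _ [m _ <-]].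
  by rewrite ler_norml /lo /hi; lra.
exists g => // x; apply/cvgrPdist_lt => e e0.
have [n Kn] : exists n, K * 2^-1 ^+ n *+ 2 < e / 3.
  have : (fun n => K * 2^-1 ^+ n) @ \oo --> (0 : R).
    by apply: cvg_geometric; rewrite ger0_norm ?invf_lt1// ltr1n.
  move/cvgrPdist_lt => /(_ (e / 6) ltac:(lra))[N _ /(_ N (leqnn _))].
  by rewrite sub0r normrN ger0_norm// => ?; exists N; lra.
have /cvgrPdist_lt/(_ (e / 3) ltac:(lra)) := cf n x.
apply: filterS => y; rewrite !ltr_norml.
have := gf n x; have := gf n y; rewrite !ler_norml; lra.
Qed.

(** For [a <= b], the retraction of the line onto [[a, b]]. Composition with it makes estimates on
    [[a, b]] global; applied to the values of a function it truncates them. *)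
Definition clamp a b x := Num.max a (Num.min b x).

Lemma clamp_itv a b x : a <= b -> a <= clamp a b x <= b.
Proof. by move=> ab; rewrite /clamp le_max lexx ge_max ab ge_min lexx. Qed.

Lemma clampE a b x : a <= x <= b -> clamp a b x = x.
Proof. by move=> /andP[ax xb]; rewrite /clamp min_r// max_r. Qed.

Lemma continuous_clamp a b : continuous (clamp a b).
Proof.
move=> x; apply: (@continuous_max _ _ (fun=> a) (Num.min b)); first exact: cvg_cst.
by apply: (@continuous_min _ _ (fun=> b) id) => //; exact: cvg_cst.
Qed.

End LinearODE.

(** * Existence for the initial value problem, by successive approximation *)

Section Picard.
Context {R : realType}.
Implicit Types (F G f g c u v : R -> R) (a b x y : R).

(* Junk value [f] when [f] is not continuous. *)
Definition primitive a y0 f : R -> R :=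
  match pselect (continuous f) with
  | left cf => sval (cid2 (antiderivative a y0 cf))
  | right _ => f
  end.

Lemma primitiveP a y0 f : continuous f ->
  has_deriv (primitive a y0 f) f /\ primitive a y0 f a = y0.
Proof.
by rewrite /primitive; case: pselect => // cf _; case: cid2.
Qed.

(* Successive approximations for the system [y' = z, z' = c y + g]. *)
Fixpoint picard_iter a y0 z0 c g n : (R -> R) * (R -> R) :=
  if n is n'.+1 then
    let yz := picard_iter a y0 z0 c g n' in
    (primitive a y0 yz.2, primitive a z0 (fun x => c x * yz.1 x + g x))
  else (fun=> 0, fun=> 0).

Lemma continuous_lin c g (y : R -> R) : continuous c -> continuous g -> continuous y ->
  continuous (fun x => c x * y x + g x).
Proof. by move=> cc cg cy x; apply: cvgD; [apply: cvgM; [exact: cc|exact: cy]|exact: cg]. Qed.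

(** The iterates are controlled on [[a, b]] only. Their limits are made global with [clamp], and the
    solution is rebuilt by integrating twice, so that it is twice differentiable on the whole line;
    on [[a, b]] it coincides with the limits. *)
Lemma linear_ode_exists a b c g y0 z0 : a <= b ->
  continuous c -> continuous g ->
  exists u du ddu : R -> R, [/\ C2 u du ddu,
    forall x, a <= x <= b -> ddu x = c x * u x + g x, u a = y0 & du a = z0].
Proof.
move=> ab cc cg.
pose Y n := (picard_iter a y0 z0 c g n).1.
pose Z n := (picard_iter a y0 z0 c g n).2.
have cYZ n : continuous (Y n) /\ continuous (Z n).
  elim: n => [|n [cY cZ]]; first by split => x; exact: cvg_cst.
  split; first exact: has_deriv_continuous (primitiveP a y0 cZ).1.
  exact: has_deriv_continuous (primitiveP a z0 (continuous_lin cc cg cY)).1.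
have [cY cZ] : (forall n, continuous (Y n)) /\ (forall n, continuous (Z n)).
  by split => n; have [] := cYZ n.
have [dY Ya] : (forall n, has_deriv (Y n.+1) (Z n)) /\ (forall n, Y n.+1 a = y0).
  by split => n; have [] := primitiveP a y0 (cZ n).
have [dZ Za] : (forall n, has_deriv (Z n.+1) (fun x => c x * Y n x + g x)) /\
    (forall n, Z n.+1 a = z0).
  by split => n; have [] := primitiveP a z0 (continuous_lin cc cg (cY n)).
have [A A0 cA] := continuous_itv_bounded a b cc.
have [M1 M10 M1P] := continuous_itv_bounded a b (cY 1%N).
have [M2 M20 M2P] := continuous_itv_bounded a b (cZ 1%N).
(* With the rate [L = 2 C] the weight [w n.+1] has the derivative [C * w n]: each integration gains
   a factor 1/2, however long the interval is. *)
pose C := 1 + A; pose M := M1 + M2; pose L := 2 * C.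
have C1 : 1 <= C by rewrite /C; lra.
have M0 : 0 < M by rewrite /M; lra.
have L0 : 0 < L by rewrite /L; lra.
have expE x : expR (L * (x - a)) = expR (- (L * a)) * expR (L * x).
  by rewrite -expRD; congr expR; ring.
pose w n x := (M * 2^-1 ^+ n) * expR (L * (x - a)).
have dw n : has_deriv (w n.+1) (fun x => C * w n x).
  have -> : w n.+1 = (fun x => (M * 2^-1 ^+ n.+1 * expR (- (L * a))) * expR (L * x)).
    by apply/funext => x; rewrite /w expE mulrA.
  apply: (eq_has_deriv (has_derivZ _ (has_deriv_expR L))) => x.
  by rewrite /w expE exprS /L; field.
have w_ge0 n x : 0 <= w n x.
  by rewrite /w !mulr_ge0 ?expR_ge0// ?exprn_ge0// ltW.
have step F f n : has_deriv F f -> F a = 0 ->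
    (forall x, a <= x <= b -> `|f x| <= C * w n x) ->
    forall x, a <= x <= b -> `|F x| <= w n.+1 x.
  move=> dF Fa fw x /andP[ax xb].
  have fw' y : a <= y <= x -> `|f y| <= C * w n y.
    by move=> /andP[ay yx]; apply: fw; rewrite ay (le_trans yx xb).
  have := has_deriv_le_le dF (dw n) ax.
  have /[swap]/[apply] : forall y, a <= y <= x -> f y <= C * w n y.
    by move=> y /fw'; rewrite ler_norml => /andP[].
  have := has_deriv_le_le (has_derivZ (-1) (dw n)) dF ax.
  have /[swap]/[apply] : forall y, a <= y <= x -> -1 * (C * w n y) <= f y.
    by move=> y /fw'; rewrite ler_norml mulN1r => /andP[].
  rewrite Fa ler_norml; have := w_ge0 n.+1 a; lra.
(* The iteration starts from zero, so the first differences are [Y 1] and [Z 1], which [M]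
   bounds. *)
have diff n : (forall x, a <= x <= b -> `|Y n.+1 x - Y n x| <= w n x) /\
              (forall x, a <= x <= b -> `|Z n.+1 x - Z n x| <= w n x).
  elim: n => [|n [IHY IHZ]].
    have w0 x : a <= x <= b -> M <= w 0 x.
      move=> /andP[ax _]; rewrite /w expr0 mulr1 ler_peMr ?(ltW M0)//.
      by rewrite -expR0 ler_expR mulr_ge0 ?(ltW L0)// subr_ge0.
    split => x xab; rewrite subr0; apply: (le_trans _ (w0 x xab)).
      by rewrite (le_trans (M1P x xab))// /M; lra.
    by rewrite (le_trans (M2P x xab))// /M; lra.
  split.
    apply: (step _ _ _ (has_derivB (dY n.+1) (dY n))); first by rewrite !Ya subrr.
    by move=> x xab; rewrite (le_trans (IHZ x xab))// ler_peMl.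
  apply: (step _ _ _ (has_derivB (dZ n.+1) (dZ n))); first by rewrite !Za subrr.
  move=> x xab; rewrite [X in `|X|](_ : _ = c x * (Y n.+1 x - Y n x)); last by ring.
  rewrite normrM ler_pM//; first by rewrite (le_trans (cA x xab))// /C lerDr.
  exact: IHY.
pose K := M * expR (L * (b - a)).
have wK n x : a <= x <= b -> w n x <= K * 2^-1 ^+ n.
  move=> /andP[ax xb]; rewrite /w /K [leRHS]mulrAC ler_wpM2l//.
    by rewrite mulr_ge0 ?(ltW M0)// exprn_ge0.
  by rewrite ler_expR ler_wpM2l ?(ltW L0)// lerB.
have cclamp (f : R -> R) : continuous f -> continuous (f \o clamp a b).
  by move=> cf x; apply: continuous_comp; [exact: continuous_clamp|exact: cf].
have [Yl cYl YlP] := @geometric_uniform_limit _ (fun n => Y n \o clamp a b) K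
  (fun n => cclamp _ (cY n))
  (fun n x => le_trans ((diff n).1 _ (clamp_itv x ab)) (wK n _ (clamp_itv x ab))).
have [Zl cZl ZlP] := @geometric_uniform_limit _ (fun n => Z n \o clamp a b) K
  (fun n => cclamp _ (cZ n))
  (fun n x => le_trans ((diff n).2 _ (clamp_itv x ab)) (wK n _ (clamp_itv x ab))).
have null (r D : R) : (forall n, `|r| <= D * 2^-1 ^+ n) -> r = 0.
  move=> rD; apply/eqP; rewrite -normr_le0.
  have Dcvg : (fun n => D * 2^-1 ^+ n) @ \oo --> (0 : R).
    by apply: cvg_geometric; rewrite ger0_norm ?invf_lt1// ltr1n.
  by apply: (ler_cvg_to (cvg_cst `|r|) Dcvg); exact: nearW.
have ba0 : 0 <= b - a by rewrite subr_ge0.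
(* If the [gg n] converge uniformly to the derivative of [F], then [F] is the limit [V] of their
   antiderivatives [G n.+1]: the difference is at most a fixed multiple of [2^-n] for every [n]. *)
have agree F f (G : nat -> R -> R) (gg : nat -> R -> R) D (V : R -> R) :
    has_deriv F f -> (forall n, has_deriv (G n.+1) (gg n)) ->
    (forall n, F a = G n.+1 a) ->
    (forall n x, a <= x <= b -> `|f x - gg n x| <= D * 2^-1 ^+ n) ->
    (forall n x, a <= x <= b -> `|V x - G n x| <= K * 2^-1 ^+ n *+ 2) ->
    forall x, a <= x <= b -> F x = V x.
  move=> dF dG FGa fg VG x /[dup] xab /andP[ax xb].
  apply/eqP; rewrite -subr_eq0; apply/eqP.
  apply: (null _ (D * (b - a) + K)) => n.
  have fg' y : a <= y <= x -> `|f y - gg n y| <= D * 2^-1 ^+ n.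
    by move=> /andP[ay yx]; apply: fg; rewrite ay (le_trans yx xb).
  have := has_deriv_le_le (has_derivB dF (dG n)) (has_derivZ (D * 2^-1 ^+ n) has_deriv_id) ax.
  have /[swap]/[apply] : forall y, a <= y <= x -> f y - gg n y <= D * 2^-1 ^+ n * 1.
    by move=> y /fg'; rewrite mulr1 ler_norml => /andP[].
  have := has_deriv_le_le (has_derivZ (- (D * 2^-1 ^+ n)) has_deriv_id) (has_derivB dF (dG n)) ax.
  have /[swap]/[apply] : forall y, a <= y <= x -> - (D * 2^-1 ^+ n) * 1 <= f y - gg n y.
    by move=> y /fg'; rewrite mulr1 ler_norml => /andP[].
  have D0 : 0 <= D * 2^-1 ^+ n by rewrite (le_trans _ (fg n x xab)).
  have : D * 2^-1 ^+ n * (x - a) <= D * 2^-1 ^+ n * (b - a) by rewrite ler_wpM2l// lerB.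
  have := VG n.+1 x xab; rewrite exprS -(FGa n) /= !ler_norml; lra.
have [du1 dua] := primitiveP a z0 (continuous_lin cc cg cYl).
set du := primitive _ _ _ in du1 dua.
have [u1 ua] := primitiveP a y0 (has_deriv_continuous du1).
set u := primitive _ _ _ in u1 ua.
have YlP' n x : a <= x <= b -> `|Yl x - Y n x| <= K * 2^-1 ^+ n *+ 2.
  by move=> xab; have := YlP n x; rewrite /= clampE.
have ZlP' n x : a <= x <= b -> `|Zl x - Z n x| <= K * 2^-1 ^+ n *+ 2.
  by move=> xab; have := ZlP n x; rewrite /= clampE.
have duE : forall x, a <= x <= b -> du x = Zl x.
  apply: (agree _ _ Z (fun n x => c x * Y n x + g x) (A * K *+ 2) _ du1 dZ) => [n|n x xab|//].
    by rewrite Za dua.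
  rewrite [X in `|X|](_ : _ = c x * (Yl x - Y n x)); last by ring.
  rewrite normrM (_ : _ * _ ^+ n = A * (K * 2^-1 ^+ n *+ 2)); last by ring.
  by rewrite ler_pM ?cA ?YlP'.
have uE : forall x, a <= x <= b -> u x = Yl x.
  apply: (agree _ _ Y Z (K *+ 2) _ u1 dY) => [n|n x xab|//].
    by rewrite Ya ua.
  by rewrite duE// mulrnAl ZlP'.
exists u, du, (fun x => c x * Yl x + g x); split => //.
  by split => //; exact: continuous_lin.
by move=> x xab; rewrite uE.
Qed.

End Picard.

(** * Semi-inner products and Schwarz's iteration *)

Section Schwarz.
Context {R : realType}.
Implicit Types (f g h u v : R -> R) (S E : set (R -> R)).

(** Linearity and positivity are restricted to [S], because integrals have default values outside
    it, and definiteness is left out, because functions may differ on null sets. The combination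
    [f + c * g] is the only linear operation throughout. *)
Record semi_inner S (ip : (R -> R) -> (R -> R) -> R) : Prop := SemiInner {
  si0 : S (fun=> 0);
  siD : forall f g c, S f -> S g -> S (fun t => f t + c * g t);
  siC : forall f g, ip f g = ip g f;
  siDl : forall f g h c, S f -> S g -> S h ->
    ip (fun t => f t + c * g t) h = ip f h + c * ip g h;
  si_ge0 : forall f, S f -> 0 <= ip f f }.

Lemma semi_innerS S E ip : semi_inner S ip -> E `<=` S -> E (fun=> 0) ->
  (forall f g c, E f -> E g -> E (fun t => f t + c * g t)) -> semi_inner E ip.
Proof.
move=> [_ _ C Dl ge0] ES E0 ED; split => // [f g h c Ef Eg Eh|f Ef].
- by rewrite Dl//; exact: ES.
- by rewrite ge0//; exact: ES.
Qed.

Section Inner.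
Context S ip (si : semi_inner S ip).

Lemma siDr f g h c : S f -> S g -> S h ->
  ip h (fun t => f t + c * g t) = ip h f + c * ip h g.
Proof. by move=> Sf Sg Sh; rewrite (siC si) (siDl si)// ![ip _ h](siC si). Qed.

Lemma ip_sqD f g c : S f -> S g ->
  ip (fun t => f t + c * g t) (fun t => f t + c * g t) =
  ip f f + 2 * c * ip f g + c ^+ 2 * ip g g.
Proof.
move=> Sf Sg; rewrite (siDl si)//; last exact: siD si _ _ _ Sf Sg.
by rewrite !siDr// (siC si g f); ring.
Qed.

Lemma cauchy_schwarz f g : S f -> S g -> ip f g ^+ 2 <= ip f f * ip g g.
Proof.
move=> Sf Sg.
have q c : 0 <= ip f f + 2 * c * ip f g + c ^+ 2 * ip g g.
  by rewrite -ip_sqD//; apply/(si_ge0 si)/(siD si).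
have [g0|gn0] := eqVneq (ip g g) 0.
  have [-> |fg0] := eqVneq (ip f g) 0; first by rewrite g0 expr0n/= mulr0.
  (* If [ip g g = 0], the polynomial is affine in [c], and this argument gives it the value -1. *)
  have := q (- (ip f f + 1) / (2 * ip f g)); rewrite g0 !mulr0 addr0.
  rewrite (_ : 2 * _ * _ = - (ip f f + 1)); last by field.
  lra.
have g_gt0 : 0 < ip g g by rewrite lt_neqAle eq_sym gn0 (si_ge0 si).
have := q (- ip f g / ip g g).
rewrite (_ : _ + _ + _ = (ip f f * ip g g - ip f g ^+ 2) / ip g g); last by field.
by rewrite pmulr_lge0 ?invr_gt0// subr_ge0.
Qed.

Lemma si_sum (e : nat -> R -> R) (d : nat -> R) n : (forall k, S (e k)) ->
  S (fun t => \sum_(0 <= k < n) d k * e k t).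
Proof.
move=> Se; elim: n => [|n IH].
  by rewrite [X in S X](_ : _ = fun=> 0); [exact: si0 si|apply/funext => t; rewrite big_geq].
rewrite [X in S X](_ : _ = fun t => (\sum_(0 <= k < n) d k * e k t) + d n * e n t).
  exact: (siD si).
by apply/funext => t; rewrite big_nat_recr.
Qed.

Lemma ip0l h : S h -> ip (fun=> 0) h = 0.
Proof.
move=> Sh; have S0 := si0 si; have := siDl si 1 S0 S0 Sh.
rewrite (_ : (fun t => 0 + 1 * 0) = (fun=> 0 : R)); last first.
  by apply/funext => t; rewrite mulr0 addr0.
by rewrite mul1r -[LHS]addr0 => /addrI.
Qed.

Lemma ipZr f h c : S f -> S h -> ip h (fun t => c * f t) = c * ip h f.
Proof.
move=> Sf Sh; have := siDr c (si0 si) Sf Sh.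
rewrite (siC si h (fun=> 0)) ip0l// add0r => <-.
by congr (ip h _); apply/funext => t; rewrite add0r.
Qed.

Lemma ip_suml (e : nat -> R -> R) (d : nat -> R) n h :
  (forall k, S (e k)) -> S h ->
  ip (fun t => \sum_(0 <= k < n) d k * e k t) h = \sum_(0 <= k < n) d k * ip (e k) h.
Proof.
move=> Se Sh; elim: n => [|n IH].
  rewrite big_geq// -[RHS](ip0l Sh); congr (ip _ _).
  by apply/funext => t; rewrite big_geq.
rewrite big_nat_recr//= -IH -(siDl si)//; last exact: si_sum.
by congr (ip _ _); apply/funext => t; rewrite big_nat_recr.
Qed.

End Inner.

(* Schwarz's iteration [u, L^-1 u, L^-2 u, ..]: the ratios of the squared norms
   increase to some [s], and the iterates are approximate eigenvectors of L^2
   for [1 / s], which is impossible if [L - c] and [L + c] are bounded below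
   for [c ^+ 2 = 1 / s]. *)
Lemma schwarz_iteration E ip (L : (R -> R) -> (R -> R) -> Prop) M Lam :
  semi_inner E ip ->
  (forall f, E f -> exists2 u, E u & L u f) ->
  (forall u v f g c, L u f -> L v g ->
     L (fun t => u t + c * v t) (fun t => f t + c * g t)) ->
  (forall u v f g, L u f -> L v g -> ip u g = ip f v) ->
  (forall u f, E u -> E f -> L u f -> ip u u <= M * ip f f) ->
  0 < Lam ->
  (forall c, `|c| < Lam -> exists2 K, 0 <= K & forall u f, E u -> E f -> L u f ->
     ip u u <= K * ip (fun t => f t + c * u t) (fun t => f t + c * u t)) ->
  forall u f, E u -> E f -> L u f -> Lam ^+ 2 * ip u u <= ip f f.
Proof.
move=> si Lex Llin Lsym LM Lam0 gap u f Eu Ef Luf; rewrite leNgt; apply/negP => contra.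
have /choice[K KP] : forall g, exists v, E g -> E v /\ L v g.
  move=> g; have [Eg|nEg] := pselect (E g); last by exists g.
  by have [v Ev Lvg] := Lex g Eg; exists v.
(* The sequence starts at [f], so that [s 0] is [ip u u / ip f f], which exceeds [1 / Lam^2] by
   [contra]. *)
pose U n := if n is k.+1 then iter k K u else f.
have EU n : E (U n) by case: n => //=; elim => [//|n /KP[]].
have LU n : L (U n.+1) (U n) by case: n => [//|n]; exact: (KP _ (EU n.+1)).2.
pose N n := ip (U n) (U n).
(* Symmetry turns [N n.+1] into the product of [U n] and [U n.+2]. By Cauchy-Schwarz the squared
   norms are then log-convex, so their ratios increase. *)
have NE n : N n.+1 = ip (U n) (U n.+2) by exact: Lsym (LU n) (LU n.+1).
have NN n : N n.+1 ^+ 2 <= N n * N n.+2 by rewrite NE; exact: cauchy_schwarz si _ _ _ _.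
have N_ge0 n : 0 <= N n by exact: si_ge0 si _ (EU n).
have N1 : 0 < N 1.
  by rewrite -(pmulr_rgt0 _ (exprn_gt0 2 Lam0)); exact: le_lt_trans (N_ge0 0) contra.
have N_gt0 n : 0 < N n.
  have N2 k : 0 < N k.+1.
    elim: k => // k IH; rewrite lt_neqAle N_ge0 andbT eq_sym; apply/eqP => N0.
    by have := NN k; rewrite N0 mulr0; have := exprn_gt0 2 IH; lra.
  case: n => // ; rewrite lt_neqAle N_ge0 andbT eq_sym; apply/eqP => N0.
  by have := NN 0; rewrite N0 mul0r; have := exprn_gt0 2 N1; lra.
pose s n := N n.+1 / N n.
have s_gt0 n : 0 < s n by rewrite divr_gt0.
have s_nd n : s n <= s n.+1.
  by rewrite /s ler_pdivrMr// mulrAC ler_pdivlMr// -expr2 [leRHS]mulrC NN.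
have sM n : s n <= M.
  by rewrite ler_pdivrMr//; exact: LM.
have has_sup_s : has_sup (range s) by split; [exists (s 0), 0|exists M => _ [n _ <-]].
pose sl := sup (range s).
have s_le n : s n <= sl by apply: ub_le_sup; [exact: has_sup_s.2|exists n].
have s0_le n : s 0 <= s n.
  by apply: (@homo_leq _ s (fun a b => a <= b)) => //; exact: le_trans.
have sl_gt0 : 0 < sl by exact: lt_le_trans (s_gt0 0) (s_le 0).
pose c := (Num.sqrt sl)^-1.
have c2 : c ^+ 2 = sl^-1 by rewrite exprVn sqr_sqrtr// ltW.
have c_lt : `|c| < Lam.
  rewrite -(@ltr_pXn2r _ 2)// ?nnegrE ?(ltW Lam0)// real_normK ?num_real// c2.
  rewrite invf_plt ?posrE ?exprn_gt0//; apply: lt_le_trans (s_le 0).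
  by rewrite /s ltr_pdivlMr// mulrC ltr_pdivrMr ?exprn_gt0// mulrC.
have Nc_lt : `|- c| < Lam by rewrite normrN.
have [K1 K10 gap1] := gap _ c_lt; have [K2 K20 gap2] := gap _ Nc_lt.
(* Here [y] is [(L + c) U n.+2] and [z - c y] is [(L - c) y = U n - c^2 U n.+2], so the bounds for
   [L + c] and [L - c] compose. *)
have key n : N n.+2 <= K1 * K2 * (N n - 2 * c ^+ 2 * N n.+1 + c ^+ 2 ^+ 2 * N n.+2).
  pose y t := U n.+1 t + c * U n.+2 t.
  pose z t := U n t + c * U n.+1 t.
  have Ey : E y by exact: siD si _ _ _ (EU _) (EU _).
  have Ez : E z by exact: siD si _ _ _ (EU _) (EU _).
  have Lyz : L y z by exact: Llin.
  have N2 : N n.+2 <= K1 * ip y y by exact: gap1.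
  have := gap2 _ _ Ey Ez Lyz.
  rewrite (_ : (fun t => z t + - c * y t) = (fun t => U n t + (- c ^+ 2) * U n.+2 t)); last first.
    by apply/funext => t; rewrite /z /y; ring.
  rewrite (ip_sqD si _ (EU n) (EU n.+2)) -NE => y_le.
  apply: (le_trans N2); rewrite -mulrA ler_wpM2l//.
  apply: (le_trans y_le); rewrite ler_wpM2l// /N; lra.
(* After division by [N n] the left side of [key] stays above [s 0 ^+ 2], while [s n.+1 <= sl]
   leaves on the right a multiple of [1 - s n / sl], which becomes arbitrarily small. *)
have key2 n : s 0 ^+ 2 <= K1 * K2 * (1 - s n / sl).
  have sN m : N m.+1 = s m * N m by rewrite /s divfK// gt_eqF.
  have := key n; rewrite !sN c2.
  rewrite (_ : _ - _ + _ = (1 - 2 * (s n / sl) + (s n / sl) * (s n.+1 / sl)) * N n); last first.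
    by field; rewrite gt_eqF.
  rewrite mulrA [leRHS]mulrA ler_pM2r// => h.
  have a1 : s 0 ^+ 2 <= s n.+1 * s n by rewrite expr2 ler_pM// ltW.
  apply: (le_trans a1); apply: (le_trans h); rewrite ler_wpM2l ?mulr_ge0//.
  have : s n / sl * (s n.+1 / sl) <= s n / sl.
    rewrite ler_piMr ?divr_ge0 ?(ltW sl_gt0) ?(ltW (s_gt0 _))//.
    by rewrite ler_pdivrMr// mul1r.
  lra.
pose KK := K1 * K2.
have KK_ge0 : 0 <= KK by rewrite mulr_ge0.
have KK1 : 0 < KK + 1 by rewrite ltr_wpDl.
(* This distance to the supremum contradicts [key2]; the [+ 1] covers [KK = 0]. *)
have eta_gt0 : 0 < sl * s 0 ^+ 2 / (KK + 1).
  by apply: divr_gt0 => //; apply: mulr_gt0 => //; exact: exprn_gt0.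
have [_ [n _ <-] sn] := sup_adherent eta_gt0 has_sup_s.
have : 1 - s n / sl <= s 0 ^+ 2 / (KK + 1).
  rewrite lerBlDr -lerBlDl ler_pdivlMr// mulrBl mul1r.
  by rewrite (_ : _ / _ * sl = sl * s 0 ^+ 2 / (KK + 1)); [exact: ltW|ring].
move=> /(ler_wpM2l KK_ge0) h; have := le_trans (key2 n) h.
rewrite mulrA ler_pdivlMr// mulrDr mulr1 [s 0 ^+ 2 * KK]mulrC.
by have := exprn_gt0 2 (s_gt0 0); lra.
Qed.

End Schwarz.

(** * The abstract eigenfunction expansion *)

Section Expansion.
(** In the application [S] holds the square integrable functions and [C] the piecewise continuous
    ones, which contain the domain and the range of [L]; [J] is the union of the two intervals and
    [W] its total weight. *)
Context {R : realType} {S C : set (R -> R)} {ip : (R -> R) -> (R -> R) -> R}.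
Context {L : (R -> R) -> (R -> R) -> Prop} {J : set R} {W M : R}.
Context {e : nat -> R -> R} {lam : nat -> R}.
Implicit Types (f g h u v : R -> R).
Hypothesis si_S : semi_inner S ip.
Hypothesis si_C : semi_inner C ip.
Hypothesis CS : C `<=` S.
Hypothesis L_C : forall u f, L u f -> C u /\ C f.
Hypothesis L_exists : forall f, C f -> exists u, L u f.
Hypothesis L_lin : forall u v f g c, L u f -> L v g ->
  L (fun t => u t + c * v t) (fun t => f t + c * g t).
Hypothesis L_sym : forall u v f g, L u f -> L v g -> ip u g = ip f v.
Hypothesis L_bound : forall u f, L u f -> forall x, J x -> u x ^+ 2 <= M * ip f f.
Hypothesis M_ge0 : 0 <= M.
Hypothesis ip_le : forall u B, C u -> (forall x, J x -> u x ^+ 2 <= B) -> ip u u <= B * W.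
(** Integration over [J] of a pointwise bound, with the normalization of the [e k] built in. *)
Hypothesis mass : forall n (b : nat -> R) (B : R),
  (forall x, J x -> \sum_(0 <= k < n) b k * e k x ^+ 2 <= B) ->
  \sum_(0 <= k < n) b k <= B * W.
Hypothesis L_e : forall k, L (e k) (fun t => lam k * e k t).
Hypothesis lam_neq0 : forall k, lam k != 0.
Hypothesis e_orth : forall j k, ip (e j) (e k) = (j == k)%:R.
(** If [mu] is none of the [lam k], the orthogonality condition is void and the bound holds for all
    [u]. *)
Hypothesis gap : forall mu, exists2 K : R, 0 <= K & forall u f, L u f ->
  (forall k, lam k = mu -> ip u (e k) = 0) ->
  ip u u <= K * ip (fun t => f t + - mu * u t) (fun t => f t + - mu * u t).
Hypothesis dense : forall f (r : R), S f -> 0 < r ->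
  exists u g, L u g /\ ip (fun t => f t + -1 * u t) (fun t => f t + -1 * u t) < r.

Let C_e k : C (e k). Proof. exact: (L_C (L_e k)).1. Qed.
Let S_e k : S (e k). Proof. exact: CS. Qed.

Let L0 : L (fun=> 0) (fun=> 0).
Proof.
have := L_lin (-1) (L_e 0) (L_e 0).
by congr L; apply/funext => t; rewrite mulN1r subrr.
Qed.

Let L_sum (b : nat -> R) n : L (fun t => \sum_(0 <= k < n) b k * e k t)
  (fun t => \sum_(0 <= k < n) b k * lam k * e k t).
Proof.
elim: n => [|n IH].
  by have := L0; congr L; apply/funext => t; rewrite big_geq.
have := L_lin (b n) IH (L_e n).
by congr L; apply/funext => t; rewrite big_nat_recr// mulrA.
Qed.

Let ip_sum_e (b : nat -> R) n j :
  ip (fun t => \sum_(0 <= k < n) b k * e k t) (e j) = if (j < n)%N then b j else 0.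
Proof.
rewrite (ip_suml si_S)//.
under eq_bigr do rewrite e_orth.
case: ltnP => jn; last first.
  rewrite big_nat big1// => k /andP[_ kn].
  by rewrite ltn_eqF ?mulr0// (leq_trans kn).
rewrite (bigD1_seq j) ?mem_index_iota ?iota_uniq//= eqxx mulr1 big1 ?addr0// => k kj.
by rewrite (negbTE kj) mulr0.
Qed.

Let ip_sum_sum (b d : nat -> R) n :
  ip (fun t => \sum_(0 <= k < n) b k * e k t) (fun t => \sum_(0 <= k < n) d k * e k t) =
  \sum_(0 <= k < n) b k * d k.
Proof.
rewrite (ip_suml si_S)//; last exact: si_sum si_S _ _ _ S_e.
rewrite !big_nat; apply: eq_bigr => k /andP[_ kn].
by rewrite (siC si_S) ip_sum_e kn.
Qed.

(* Bessel's inequality for the Green kernel at [x]: [L_bound] at [x], applied to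
   the sum of the [e_k(x) / lam_k ^+ 2 *: e_k], bounds the sum of the
   [e_k(x) ^+ 2 / lam_k ^+ 2], which is then integrated in [x]. *)
Lemma bessel_inverse_squares n : \sum_(0 <= k < n) (lam k ^+ 2)^-1 <= M * W.
Proof.
apply: mass => x Jx.
set Q := \sum_(0 <= k < n) _.
have := L_bound (L_sum (fun k => e k x / lam k ^+ 2) n) Jx.
rewrite (_ : \sum_(0 <= k < n) _ = Q); last first.
  by apply: eq_bigr => k _; rewrite expr2; ring.
rewrite (_ : (fun t => _) = fun t => \sum_(0 <= k < n) (e k x / lam k) * e k t); last first.
  by apply/funext => t; apply: eq_bigr => k _; congr (_ * _); field.
rewrite ip_sum_sum (_ : \sum_(0 <= k < n) _ = Q); last first.
  by apply: eq_bigr => k _; field.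
have Q0 : 0 <= Q by apply: sumr_ge0 => k _; rewrite mulr_ge0 ?invr_ge0 ?sqr_ge0.
have [Q00|Qn0] := eqVneq Q 0; first by rewrite Q00.
by rewrite expr2 ler_pM2r// lt_neqAle eq_sym Qn0.
Qed.

(** The series of the [1 / lam k ^ 2] has bounded partial sums, so its terms tend to 0. *)
Let lam_large Lam : 0 < Lam -> exists N, forall k, (N <= k)%N -> Lam <= `|lam k|.
Proof.
move=> Lam0; pose a k := (lam k ^+ 2)^-1.
have a_ge0 k : 0 <= a k by rewrite invr_ge0 sqr_ge0.
have : a @ \oo --> (0 : R).
  apply: cvg_series_cvg_0; apply: nondecreasing_is_cvgn.
    by apply/nondecreasing_seqP => n; rewrite /series/= big_nat_recr//= lerDl.
  by exists (M * W) => _ [n _ <-]; exact: bessel_inverse_squares.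
move/cvgrPdist_lt => /(_ ((Lam ^+ 2)^-1) ltac:(rewrite invr_gt0 exprn_gt0//)) [N _ NP].
have Lam2 : 0 < Lam ^+ 2 by exact: exprn_gt0.
have lam2 k : 0 < lam k ^+ 2 by rewrite exprn_even_gt0/=.
exists N => k /NP; rewrite /= sub0r normrN ger0_norm// /a ltf_pV2 ?posrE//.
rewrite -[lam k ^+ 2]real_normK ?num_real// => h.
by apply: ltW; rewrite -(@ltr_pXn2r _ 2)// nnegrE ltW.
Qed.

Let E n : set (R -> R) := [set f | C f /\ forall j, (j < n)%N -> ip f (e j) = 0].

Let siE n : semi_inner (E n) ip.
Proof.
apply: (semi_innerS si_C) => [f []//||f g c [Cf fe] [Cg ge]].
  by split; [exact: si0 si_C|move=> j _; exact: ip0l si_C _ _].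
split; first exact: siD si_C _ _ _ Cf Cg.
by move=> j jn; rewrite (siDl si_C)// fe// ge// mulr0 addr0.
Qed.

(** Symmetry against [e k] gives [lam k * ip u (e k) = ip f (e k)]. Hence the inverse of [L]
    preserves [E n], and the iteration can run inside it. *)
Let L_orth u f k : L u f -> ip f (e k) = 0 -> ip u (e k) = 0.
Proof.
move=> Luf fe; have := L_sym Luf (L_e k); rewrite fe.
have [Cu _] := L_C Luf.
rewrite (ipZr si_C)//.
by move/eqP; rewrite mulf_eq0 (negbTE (lam_neq0 k)) => /eqP.
Qed.

(** Schwarz's iteration on [E n]. An eigenvalue equal to [- c] with [|c| < Lam] has an index below
    [n], so elements of [E n] are orthogonal to its eigenfunction and [gap] applies to them. *)
Lemma orthogonal_complement_bound n Lam u f : 0 < Lam ->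
  (forall k, (n <= k)%N -> Lam <= `|lam k|) -> E n f -> L u f ->
  Lam ^+ 2 * ip u u <= ip f f.
Proof.
move=> Lam0 Lam_le Ef Luf.
have EL v g : E n g -> L v g -> E n v.
  move=> [Cg ge] Lvg; split; first exact: (L_C Lvg).1.
  by move=> j jn; apply: L_orth Lvg _; exact: ge.
apply: (@schwarz_iteration _ (E n) ip L (M * W) Lam) => //.
- by move=> g Eg; have [v Lvg] := L_exists Eg.1; exists v => //; exact: EL Lvg.
- move=> v g _ _ Lvg; rewrite mulrAC; apply: ip_le; first exact: (L_C Lvg).1.
  exact: L_bound.
- move=> c cLam; have [K K0 KP] := gap (- c); exists K => // v g [_ ve] _ Lvg.
  have := KP v g Lvg; rewrite opprK; apply => k lamk.
  apply: ve; rewrite ltnNge; apply/negP => /Lam_le.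
  by rewrite lamk normrN leNgt cLam.
- exact: EL Luf.
Qed.

Let residue f n t := f t - \sum_(0 <= k < n) ip f (e k) * e k t.

Let residueE f n : residue f n = fun t => f t + -1 * \sum_(0 <= k < n) ip f (e k) * e k t.
Proof. by apply/funext => t; rewrite mulN1r. Qed.

(** Pythagoras: among all combinations of the first [n] eigenfunctions the Fourier sum is nearest to
    [f]. Zero coefficients give Bessel's inequality, and the coefficients of another function a
    comparison with its Fourier sum. *)
Let ip_residue f n (d : nat -> R) : S f ->
  ip (fun t => f t + -1 * \sum_(0 <= k < n) d k * e k t)
     (fun t => f t + -1 * \sum_(0 <= k < n) d k * e k t) =
  ip (residue f n) (residue f n) + \sum_(0 <= k < n) (d k - ip f (e k)) ^+ 2.
Proof.
move=> Sf; have Ss b : S (fun t => \sum_(0 <= k < n) b k * e k t) by exact: si_sum si_S _ _ _ S_e.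
have fs b : ip f (fun t => \sum_(0 <= k < n) b k * e k t) =
    \sum_(0 <= k < n) b k * ip f (e k).
  by rewrite (siC si_S) (ip_suml si_S)//; apply: eq_bigr => k _; rewrite (siC si_S).
rewrite residueE !(ip_sqD si_S)// !ip_sum_sum !fs.
rewrite -!addrA; congr (_ + _); rewrite !mulr_sumr -!big_split/=.
by apply: eq_bigr => k _; ring.
Qed.

(** [L] maps the residue of [u] to the residue of [g], since the coefficients of [g] are
    [lam k * ip u (e k)]. The latter lies in [E n] and is no larger than [g], so the former has
    squared norm at most [ip g g / Lam^2]. *)
Let range_expansion u g : L u g -> ip (residue u n) (residue u n) @[n --> \oo] --> (0 : R).
Proof.
move=> Lug; have [Cu Cg] := L_C Lug; have [Su Sg] : S u /\ S g by split; exact: CS.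
have Lr n : L (residue u n) (residue g n).
  rewrite !residueE.
  rewrite (_ : (fun t => g t + _) = fun t => g t + -1 * \sum_(0 <= k < n) ip u (e k) * lam k * e k t).
    exact: L_lin.
  apply/funext => t; congr (_ + -1 * _); apply: eq_bigr => k _; congr (_ * _).
  by rewrite -(L_sym Lug (L_e k)) (ipZr si_C)// mulrC.
have Er n : E n (residue g n).
  split; first exact: (L_C (Lr n)).2.
  move=> j jn; rewrite residueE (siDl si_S)//; last exact: si_sum si_S _ _ _ S_e.
  by rewrite ip_sum_e jn mulN1r subrr.
have r_ge0 h n : S h -> 0 <= ip (residue h n) (residue h n).
  move=> Sh; rewrite residueE; apply/(si_ge0 si_S)/(siD si_S) => //.
  exact: si_sum si_S _ _ _ S_e.
have g_le n : ip (residue g n) (residue g n) <= ip g g.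
  have := ip_residue n (fun=> 0) Sg.
  rewrite (_ : (fun t => _) = g); last first.
    by apply/funext => t; rewrite big1 ?mulr0 ?addr0// => k _; rewrite mul0r.
  by move=> ->; rewrite lerDl sumr_ge0// => k _; exact: sqr_ge0.
apply/cvgrPdist_lt => r r0.
(* This makes [ip g g / Lam^2] smaller than [r]; the [+ 1] keeps [Lam] positive when [g] has norm
   0. *)
pose Lam := Num.sqrt ((ip g g + 1) / r).
have gg1 : 0 < (ip g g + 1) / r by rewrite divr_gt0// ltr_wpDl// (si_ge0 si_S).
have Lam0 : 0 < Lam by rewrite sqrtr_gt0.
have [N NP] := lam_large Lam0.
exists N => // n /= Nn; rewrite sub0r normrN ger0_norm ?r_ge0//.
have := orthogonal_complement_bound Lam0 (fun k nk => NP k (leq_trans Nn nk)) (Er n) (Lr n).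
rewrite sqr_sqrtr ?(ltW gg1)// => h.
have := le_lt_trans (le_trans h (g_le n)) (ltr_pwDr ltr01 (lexx (ip g g))).
by rewrite mulrAC -ltr_pdivlMr ?invr_gt0// invrK -[ltRHS]mulr1 mulrAC -mulrA ltr_pM2l ?ltr_wpDl ?(si_ge0 si_S)// mul1r.
Qed.

(** The Fourier sum of [f] is at least as near to [f] as that of an approximant [u] from the domain,
    and the latter differs from [f] by [f - u] plus the residue of [u]. Both have squared norm below
    [r / 4], which suffices by [|a + b|^2 <= 2 |a|^2 + 2 |b|^2]. *)
Lemma eigenfunction_expansion f : S f ->
  ip (fun t => f t - \sum_(0 <= k < n) ip f (e k) * e k t)
     (fun t => f t - \sum_(0 <= k < n) ip f (e k) * e k t) @[n --> \oo] --> (0 : R).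
Proof.
move=> Sf; apply/cvgrPdist_lt => r r0.
have [u [g [Lug fu]]] := dense Sf (divr_gt0 r0 (ltr0n _ 4)).
have Su : S u by exact/CS/(L_C Lug).1.
have /cvgrPdist_lt/(_ (r / 4) (divr_gt0 r0 (ltr0n _ 4))) := range_expansion Lug.
apply: filterS => n; rewrite !sub0r !normrN => un.
have Ss b : S (fun t => \sum_(0 <= k < n) b k * e k t) by exact: si_sum si_S _ _ _ S_e.
have Sr h : S h -> S (residue h n) by move=> Sh; rewrite residueE; exact: siD si_S _ _ _ Sh (Ss _).
rewrite ger0_norm; last exact/(si_ge0 si_S)/Sr.
have [F Sfu FE] : exists2 F, S F & F = fun t => f t + -1 * u t.
  by exists (fun t => f t + -1 * u t) => //; exact: siD si_S _ _ _ Sf Su.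
have := ip_residue n (fun k => ip u (e k)) Sf.
rewrite -FE in fu.
rewrite (_ : (fun t => f t + _) = fun t => F t + 1 * residue u n t); last first.
  rewrite FE.
  by apply/funext => t; rewrite /residue; ring.
have := si_ge0 si_S (siD si_S (-1) Sfu (Sr _ Su)).
rewrite !(ip_sqD si_S _ Sfu (Sr _ Su)).
have : 0 <= \sum_(0 <= k < n) (ip u (e k) - ip f (e k)) ^+ 2.
  by apply: sumr_ge0 => k _; exact: sqr_ge0.
move: un; rewrite ger0_norm; last exact/(si_ge0 si_S)/Sr.
rewrite -/(residue f n); lra.
Qed.

End Expansion.

(** * Density of smooth functions in the square integrable functions *)

Section SquareIntegrable.
Context d (T : measurableType d) (R : realType) (mu : {measure set T -> \bar R}).
Context (D : set T) (mD : measurable D).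
Implicit Types f g h : T -> R.

Definition sq_integrable f :=
  measurable_fun D f /\ mu.-integrable D (fun x => (f x ^+ 2)%:E).

Lemma sq_integrableM f g : sq_integrable f -> sq_integrable g ->
  mu.-integrable D (EFin \o (fun x => f x * g x)).
Proof.
move=> [mf f2] [mg g2].
have := integrableD mD f2 g2; apply: le_integrable => //.
  by apply/measurable_EFinP; exact: measurable_funM.
move=> x Dx /=; rewrite !lee_fin [leRHS]ger0_norm ?addr_ge0 ?sqr_ge0// normrM.
rewrite -(real_normK (num_real (f x))) -(real_normK (num_real (g x))).
have := sqr_ge0 (`|f x| - `|g x|); have := sqr_ge0 (`|f x|); have := sqr_ge0 (`|g x|).
by rewrite sqrrB; nra.
Qed.

Lemma sq_integrableD f g c : sq_integrable f -> sq_integrable g ->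
  sq_integrable (fun x => f x + c * g x).
Proof.
move=> Lf Lg; have [[mf f2] [mg g2]] := (Lf, Lg); split.
  by apply: measurable_funD => //; exact: measurable_funM.
have -> : (fun x => ((f x + c * g x) ^+ 2)%:E) =
   ((fun x => (f x ^+ 2)%:E) \+ (fun x => (2 * c)%:E * (f x * g x)%:E) \+
    (fun x => (c ^+ 2)%:E * (g x ^+ 2)%:E))%E.
  by apply/funext => x /=; rewrite -!EFinM -!EFinD; congr EFin; ring.
apply: integrableD => //; last exact: integrableZl.
by apply: integrableD => //; apply: integrableZl => //; exact: sq_integrableM.
Qed.

Lemma bounded_sq_integrable f B : (mu D < +oo)%E -> measurable_fun D f ->
  (forall x, D x -> `|f x| <= B) -> sq_integrable f.
Proof.
move=> Doo mf fB; split => //.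
apply: (@measurable_bounded_integrable _ _ _ _ (fun x => f x ^+ 2)) => //.
  exact: measurable_funX.
exists (B ^+ 2); split; first exact: num_real.
move=> M BM x Dx /=; rewrite normrX (le_trans _ (ltW BM))//.
by rewrite ler_pXn2r ?nnegrE ?fB// (le_trans _ (fB _ Dx)).
Qed.

Lemma Rintegral_sqD f g h c : sq_integrable f -> sq_integrable g -> sq_integrable h ->
  \int[mu]_(x in D) ((f x + c * g x) * h x) =
  \int[mu]_(x in D) (f x * h x) + c * \int[mu]_(x in D) (g x * h x).
Proof.
move=> Lf Lg Lh; have fh := sq_integrableM Lf Lh; have gh := sq_integrableM Lg Lh.
rewrite -RintegralZl// -RintegralD//; last first.
  by have := integrableZl mD c gh; apply: eq_integrable.
by apply: eq_Rintegral => x _; ring.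
Qed.

(** Dominated convergence for the squared differences, with the majorant [B^2]. *)
Lemma sq_dominated (F : nat -> T -> R) f B :
  (forall n, measurable_fun D (F n)) -> measurable_fun D f -> sq_integrable B ->
  (forall x, D x -> F n x @[n --> \oo] --> f x) ->
  (forall n x, D x -> `|f x - F n x| <= B x) ->
  forall r : R, 0 < r -> exists n,
    \int[mu]_(x in D) ((f x + -1 * F n x) * (f x + -1 * F n x)) < r.
Proof.
move=> mF mf [mB B2] Ff FB r r0.
pose h n x := (((f x + -1 * F n x) ^+ 2)%:E : \bar R).
have mh n : measurable_fun D (h n).
  apply/measurable_EFinP; apply: measurable_funX.
  by apply: measurable_funD => //; apply: measurable_funM.
have h0 : {ae mu, forall x, D x -> h ^~ x @ \oo --> (cst 0%E : T -> \bar R) x}.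
  apply: aeW => x Dx; apply: cvg_EFin; first exact: nearW.
  rewrite (_ : fine \o h^~ x = fun n => (f x - F n x) * (f x - F n x)); last first.
    by apply/funext => n /=; rewrite mulN1r expr2.
  rewrite -[X in _ --> X](mulr0 0); apply: cvgM.
    by rewrite -(subrr (f x)); apply: cvgB; [exact: cvg_cst|exact: Ff].
  by rewrite -(subrr (f x)); apply: cvgB; [exact: cvg_cst|exact: Ff].
have h_le n x : D x -> (`|h n x| <= (B x ^+ 2)%:E)%E.
  move=> Dx; rewrite /h /= lee_fin ger0_norm ?sqr_ge0// mulN1r.
  rewrite -real_normK ?num_real// ler_pXn2r ?nnegrE ?FB//.
  by rewrite (le_trans _ (FB 0%N _ Dx)).
have [_ _] := dominated_convergence mD mh (measurable_cst _) h0 B2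
  (aeW _ (fun x n Dx => h_le n x Dx)).
rewrite integral_cst//= mul0e => /fine_cvgP[_ /cvgrPdist_lt/(_ r r0)].
case=> N _ /(_ N (leqnn N)); rewrite /= sub0r normrN => hr; exists N.
apply: le_lt_trans hr; apply: le_trans (ler_norm _).
by rewrite /Rintegral; under eq_integral do rewrite -expr2.
Qed.

Lemma Rintegral_ae_eq f g (N : set T) : measurable_fun D f -> measurable_fun D g ->
  measurable N -> mu N = 0%E -> (forall x, D x -> ~ N x -> f x = g x) ->
  \int[mu]_(x in D) f x = \int[mu]_(x in D) g x.
Proof.
move=> mf mg mN N0 fg; congr fine; apply: ae_eq_integral => //.
- exact/measurable_EFinP.
- exact/measurable_EFinP.
- exists N; split => // x /=; apply: contra_notP => nNx Dx.
  by rewrite /= fg.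
Qed.

Lemma bounded_integrable f B : (mu D < +oo)%E -> measurable_fun D f ->
  (forall x, D x -> `|f x| <= B) -> mu.-integrable D (EFin \o f).
Proof.
move=> Doo mf fB; apply: measurable_bounded_integrable => //.
exists B; split; first exact: num_real.
by move=> M BM x Dx /=; rewrite (le_trans (fB x Dx))// ltW.
Qed.

Import HBNNSimple.

(** The simple functions increase to [f] from below, so the error is dominated by [f] itself. *)
Lemma sq_simple_approx f : sq_integrable f -> (forall x, 0 <= f x) ->
  forall r : R, 0 < r -> exists h : {nnsfun T >-> R},
    \int[mu]_(x in D) ((f x + -1 * h x) * (f x + -1 * h x)) < r.
Proof.
move=> [mf f2] f0 r r0.
have mEf : measurable_fun D (EFin \o f) by exact/measurable_EFinP.
have f0' x : D x -> (0 <= (EFin \o f) x)%E by move=> _; rewrite lee_fin.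
pose h := nnsfun_approx mD mEf.
have mh n : measurable_fun D (h n) by exact: measurable_funTS.
have hf x : D x -> h n x @[n --> \oo] --> f x.
  move=> Dx; under eq_fun do rewrite nnsfun_approxE.
  exact: (cvg_approx f0' Dx (ltry _)).
have h_le n x : D x -> `|f x - h n x| <= f x.
  move=> Dx; have := le_approx n f0' Dx.
  rewrite -(nnsfun_approxE mD mEf) lee_fin -/h => hfx.
  by rewrite ger0_norm ?subr_ge0// gerBl.
by have [n hn] := sq_dominated mh mf (conj mf f2) hf h_le r0; exists (h n).
Qed.

End SquareIntegrable.

(** * Integration for the completed Lebesgue measure *)

Section CompletedLebesgue.
Context {R : realType}.
Notation cR := (caratheodory_type (wlength (@idfun R))^*%mu).
Notation mu := (@completed_lebesgue_measure R).
Implicit Types (f F : R -> R) (D : set R) (a b : R).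

(** The identity seen as a map from the completed space to the Borel space: Lebesgue measure is the
    image of the completed measure under it, which transfers integrals of Borel functions. *)
Let idc : cR -> measurableTypeR R := @id R.

Let measurable_idc : measurable_fun setT idc.
Proof. by move=> _ Y mY; rewrite setTI preimage_id; exact: sub_caratheodory. Qed.

Lemma completed_measurable D : measurable D -> measurable (D : set cR).
Proof. exact: sub_caratheodory. Qed.

Lemma completed_measurable_fun D f : measurable D -> measurable_fun D f ->
  measurable_fun (D : set cR) f.
Proof. by move=> mD mf _ Y mY; apply: completed_measurable; exact: mf. Qed.

Lemma completed_continuous_measurable D f : measurable D -> continuous f ->
  measurable_fun (D : set cR) f.
Proof.
by move=> mD cf; apply: completed_measurable_fun => //; apply: measurable_funTS;
  exact: continuous_measurable_fun.
Qed.

Lemma completed_integral D (f : R -> \bar R) : measurable D ->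
  measurable_fun (setT : set R) f -> mu.-integrable D f ->
  (\int[mu]_(x in D) f x = \int[lebesgue_measure]_(x in D) f x)%E.
Proof.
move=> mD mf fi.
exact/esym/(@integral_pushforward _ _ _ _ _ idc measurable_idc mu D f).
Qed.

Lemma completed_bounded_fin D a b : measurable D -> D `<=` `[a, b] ->
  (mu D < +oo)%E.
Proof.
move=> mD Dab; change (mu D) with (@lebesgue_measure R D).
apply: (@le_lt_trans _ _ (@lebesgue_measure R `[a, b])).
  by apply: le_measure; rewrite ?inE.
by rewrite lebesgue_measure_itv; case: ifP; rewrite ?ltry.
Qed.

Lemma continuous_sq_integrable D a b f : measurable D -> D `<=` `[a, b] ->
  continuous f -> sq_integrable mu (D : set cR) f.
Proof.
move=> mD Dab cf; have [B B0 fB] := continuous_itv_bounded a b cf.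
apply: (@bounded_sq_integrable _ _ _ _ _ _ _ B).
- exact: completed_measurable.
- exact: completed_bounded_fin mD Dab.
- exact: completed_continuous_measurable.
- by move=> x /Dab /=; rewrite in_itv; exact: fB.
Qed.

Lemma continuous_completed_integrable D a b f : measurable D -> D `<=` `[a, b] ->
  continuous f -> mu.-integrable (D : set cR) (EFin \o f).
Proof.
move=> mD Dab cf; rewrite [X in EFin \o X](_ : _ = fun x => f x * 1); last first.
  by apply/funext => x; rewrite mulr1.
apply: sq_integrableM; first exact: completed_measurable.
- exact: continuous_sq_integrable Dab cf.
- by apply: continuous_sq_integrable mD Dab _ => x; exact: cvg_cst.
Qed.

Lemma completed_Rintegral D a b f B : measurable D -> D `<=` `[a, b] ->
  measurable_fun (setT : set R) f -> (forall x, `|f x| <= B) ->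
  \int[mu]_(x in D) f x = \int[lebesgue_measure]_(x in D) f x.
Proof.
move=> mD Dab mf fB; congr fine; apply: completed_integral => //.
  exact/measurable_EFinP.
apply: (@bounded_integrable _ _ _ _ _ _ _ B) => //.
- exact: completed_measurable.
- exact: completed_bounded_fin mD Dab.
- by apply: completed_measurable_fun => //; exact: measurable_funTS.
Qed.

(** The end points form a null set, so all three kinds of interval reduce to [[a, b]]. *)
Lemma completed_FTC (i : interval R) a b f F : a < b ->
  [\/ i = `[a, b[%R, i = `]a, b]%R | i = `]a, b[%R] -> continuous f -> has_deriv F f ->
  \int[mu]_(x in [set` i]) f x = F b - F a.
Proof.
move=> ab iE cf dF.
have iab : [set` i] `<=` `[a, b].
  by case: iE => -> x /=; rewrite !in_itv/= => /andP[h1 h2]; rewrite ?h1 ?h2 ltW// ltW.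
have fi : lebesgue_measure.-integrable [set` i] (EFin \o f).
  exact: integrableS (continuous_itv_integrable a b cf).
have -> : \int[mu]_(x in [set` i]) f x = \int[lebesgue_measure]_(x in [set` i]) f x.
  rewrite /Rintegral completed_integral//.
    by apply/measurable_EFinP; exact: continuous_measurable_fun.
  exact: continuous_completed_integrable iab cf.
have -> : \int[lebesgue_measure]_(x in [set` i]) f x =
    \int[lebesgue_measure]_(x in `[a, b]) f x.
  case: iE fi => -> fi; first exact: Rintegral_itv_bndo_bndc.
    exact: Rintegral_itv_obnd_cbnd.
  rewrite Rintegral_itv_bndo_bndc// Rintegral_itv_obnd_cbnd//.
  apply: integrableS (continuous_itv_integrable a b cf) => //.
  exact: subset_itv_oc_cc.
rewrite /Rintegral (continuous_FTC2 ab (continuous_subspaceT cf) (F := F))//.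
- split => [x _||]; first by have [] := dF x.
  + by apply: cvg_at_right_filter; exact: (has_deriv_continuous dF).
  + by apply: cvg_at_left_filter; exact: (has_deriv_continuous dF).
- by move=> x _; rewrite derive1E; have [] := dF x.
Qed.

End CompletedLebesgue.

(** * Closure in mean square *)

Section Adherence.
Context {R : realType} {S : set (R -> R)} {ip : (R -> R) -> (R -> R) -> R}.
Context (si : semi_inner S ip).
Implicit Types (f g h : R -> R) (P Q : set (R -> R)).

(** The closure of [P] for the seminorm of [ip]; the difference is written [f + -1 * g] to match the
    linear operation of [semi_inner]. *)
Definition adherent P f := forall r : R, 0 < r -> exists2 g, P g &
  ip (fun t => f t + -1 * g t) (fun t => f t + -1 * g t) < r.

Lemma adherent_self P f : S f -> P f -> adherent P f.
Proof.
move=> Sf Pf r r0; exists f => //.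
rewrite (_ : (fun t => _) = fun=> 0); last by apply/funext => t; rewrite mulN1r subrr.
by rewrite (ip0l si)//; exact: si0 si.
Qed.

Let sqD2 f g c : S f -> S g ->
  ip (fun t => f t + c * g t) (fun t => f t + c * g t) <= 2 * ip f f + 2 * c ^+ 2 * ip g g.
Proof.
move=> Sf Sg; have := si_ge0 si (siD si (- c) Sf Sg).
by rewrite !(ip_sqD si)//; lra.
Qed.

Lemma adherentD P f g c : P `<=` S ->
  (forall f g c, P f -> P g -> P (fun t => f t + c * g t)) ->
  S f -> S g -> adherent P f -> adherent P g -> adherent P (fun t => f t + c * g t).
Proof.
move=> PS PD Sf Sg Af Ag r r0.
have c0 : 0 < c ^+ 2 + 1 by rewrite ltr_wpDl ?sqr_ge0.
have [f1 Pf1 fr] := Af (r / 4) ltac:(lra).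
have [g1 Pg1 gr] := Ag (r / 4 / (c ^+ 2 + 1)) ltac:(rewrite divr_gt0//; lra).
exists (fun t => f1 t + c * g1 t); first exact: PD.
pose F t := f t + -1 * f1 t; pose G t := g t + -1 * g1 t.
have SF : S F by exact: siD si _ _ _ Sf (PS _ Pf1).
have SG : S G by exact: siD si _ _ _ Sg (PS _ Pg1).
rewrite (_ : (fun t => _) = fun t => F t + c * G t); last first.
  by apply/funext => t; rewrite /F /G; ring.
apply: (le_lt_trans (sqD2 _ SF SG)).
move: gr; rewrite ltr_pdivlMr// -/G => gr.
have : c ^+ 2 * ip G G <= ip G G * (c ^+ 2 + 1).
  by rewrite mulrC ler_wpM2l ?(si_ge0 si)// lerDl.
by move: fr; rewrite -/F; lra.
Qed.

Lemma adherent_trans P Q f : P `<=` S -> (forall g, Q g -> S g /\ adherent P g) ->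
  S f -> adherent Q f -> adherent P f.
Proof.
move=> PS QP Sf Qf r r0.
have [g /QP[Sg Pg] fg] := Qf (r / 4) ltac:(lra).
have [h Ph gh] := Pg (r / 4) ltac:(lra); exists h => //.
pose F t := f t + -1 * g t; pose G t := g t + -1 * h t.
have SF : S F by exact: siD si _ _ _ Sf Sg.
have SG : S G by exact: siD si _ _ _ Sg (PS _ Ph).
rewrite (_ : (fun t => _) = fun t => F t + 1 * G t); last first.
  by apply/funext => t; rewrite /F /G; ring.
apply: (le_lt_trans (sqD2 _ SF SG)).
by move: fg gh; rewrite -/F -/G; lra.
Qed.

End Adherence.

(** * Reduction of density to indicator functions *)

Section L2.
Context {R : realType}.
Notation cR := (caratheodory_type (wlength (@idfun R))^*%mu).
Notation mu := (@completed_lebesgue_measure R).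
Implicit Types (f g h : R -> R).

Definition ip_on (D : set R) f g : R := \int[mu]_(x in D) (f x * g x).

Lemma sq_semi_inner (D : set cR) : measurable D ->
  semi_inner (sq_integrable mu D) (ip_on D).
Proof.
move=> mD; split.
- split; first exact: measurable_cst.
  by rewrite (_ : (fun x : cR => _) = cst 0%E);
    [exact: integrable0|apply/funext => x; rewrite expr0n].
- by move=> f g c; exact: sq_integrableD.
- by move=> f g; apply: eq_Rintegral => x _; rewrite mulrC.
- by move=> f g h c; exact: Rintegral_sqD.
- by move=> f _; apply: Rintegral_ge0 => x _; rewrite -expr2 sqr_ge0.
Qed.

Section Simple.
Context (D : set cR) (mD : measurable D).
Import HBNNSimple.

(** The closure of [P] is a subspace: once it contains the indicators, it contains the simple
    functions, then their limits, the non-negative functions, and then all differences of these. *)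
Lemma simple_dense (P : set (R -> R)) : P `<=` sq_integrable mu D ->
  (forall f g c, P f -> P g -> P (fun t => f t + c * g t)) ->
  (forall A : set cR, measurable A -> sq_integrable mu D \1_A) ->
  (forall A : set cR, measurable A -> adherent (ip := ip_on D) P \1_A) ->
  forall f, sq_integrable mu D f -> adherent (ip := ip_on D) P f.
Proof.
move=> PS PD indS indP.
have si := sq_semi_inner mD.
have P0 : P (fun=> 0).
  have [g Pg _] := indP setT measurableT 1 ltr01.
  have := PD _ _ (-1) Pg Pg.
  by congr P; apply/funext => t; rewrite mulN1r subrr.
have simple (g : {nnsfun cR >-> R}) :
    sq_integrable mu D (g : R -> R) /\ adherent (ip := ip_on D) P (g : R -> R).
  have [N [y gE]] : exists N (y : nat -> R),
      forall x, g x = \sum_(0 <= i < N) y i * \1_(g @^-1` [set y i]) x.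
    by eexists; exists (nth 0 (finmap.enum_fset (fset_set (range g)))) => x; rewrite big_mkord; exact: fimfunEord.
  have -> : (g : R -> R) = fun x => \sum_(0 <= i < N) y i * \1_(g @^-1` [set y i]) x.
    exact/funext.
  elim: N {gE} => [|n [IHS IHP]].
    rewrite (_ : (fun x => _) = fun=> 0); last by apply/funext => x; rewrite big_geq.
    by split; [exact: si0 si|by apply: (adherent_self si) => //; exact: si0 si].
  rewrite (_ : (fun x => _) = fun x => (\sum_(0 <= i < n) y i * \1_(g @^-1` [set y i]) x)
    + y n * \1_(g @^-1` [set y n]) x); last first.
    by apply/funext => x; rewrite big_nat_recr.
  have mg : measurable (g @^-1` [set y n]) by exact: measurable_sfunP.
  by split; [exact/(siD si)/indS|apply: (adherentD si) => //; [exact: indS|exact: indP]].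
have pos f : sq_integrable mu D f -> (forall x, 0 <= f x) -> adherent (ip := ip_on D) P f.
  move=> [mf f2] f0.
  apply: (@adherent_trans _ _ _ si P (fun g => exists h : {nnsfun cR >-> R}, g = h)) => //.
    by move=> _ [h ->]; exact: simple.
  move=> r r0.
  by have [h hr] := sq_simple_approx mD (conj mf f2) f0 r0; exists h => //; exists h.
move=> f Sf; have [mf f2] := Sf.
have absf_sq : sq_integrable mu D (fun x => `|f x|).
  split; first exact: measurableT_comp.
  by under eq_fun do rewrite real_normK ?num_real//.
have part_sq c : sq_integrable mu D (fun x => `|f x| + c * f x) by exact: siD si _ _ _ absf_sq Sf.
(* [f] is half the difference of the non-negative functions [|f| + f] and [|f| - f]. *)
rewrite (_ : f = fun x => (0 + 2^-1 * (`|f x| + 1 * f x)) + - 2^-1 * (`|f x| + -1 * f x)); last first.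
  by apply/funext => x; field.
have S0 := si0 si.
have A0 : adherent (ip := ip_on D) P (fun=> 0) by exact: adherent_self si _ _ S0 P0.
have p1 x : 0 <= `|f x| + 1 * f x by rewrite mul1r -lerBlDr sub0r -normrN ler_norm.
have pN x : 0 <= `|f x| + -1 * f x by rewrite mulN1r subr_ge0 ler_norm.
have A1 := adherentD si 2^-1 PS PD S0 (part_sq 1) A0 (pos _ (part_sq 1) p1).
have S1 := siD si 2^-1 S0 (part_sq 1).
exact: (adherentD si (- 2^-1) PS PD S1 (part_sq (-1)) A1 (pos _ (part_sq (-1)) pN)).
Qed.

End Simple.
End L2.

(** * Cut-off and smoothing of continuous functions *)

Section Density.
Context {R : realType}.
Notation cR := (caratheodory_type (wlength (@idfun R))^*%mu).
Notation mu := (@completed_lebesgue_measure R).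
Implicit Types (f g k u : R -> R) (D : set R) (a b x y : R).

Lemma has_deriv_shift F f h : has_deriv F f ->
  has_deriv (fun x => F (x + h)) (fun x => f (x + h)).
Proof.
move=> dF x; have dS := is_deriveD (is_derive_id x (1 : R)) (is_derive_cst h x (1 : R)).
by have := @is_derive1_comp _ F (id + cst h) x _ _ (dF (x + h)) dS; rewrite addr0 mulr1.
Qed.

Definition C2_vanishing a b : set (R -> R) := [set u | exists du ddu,
  [/\ C2 u du ddu, u a = 0, du a = 0, u b = 0 & du b = 0]].

(* Averaging [k] twice over forward steps of length [h]. *)
Lemma double_average k h : continuous k -> 0 < h -> exists u du ddu,
  [/\ C2 u du ddu,
      forall x m M, (forall y, x <= y <= x + h + h -> m <= k y <= M) -> m <= u x <= M &
      forall x, (forall y, x <= y <= x + h + h -> k y = 0) -> u x = 0 /\ du x = 0].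
Proof.
move=> ck h0.
(* The double average is the second forward difference of a second antiderivative, divided by [h^2];
   its derivatives are the same differences of [K1] and of [k]. *)
have [K1 dK1 _] := antiderivative 0 0 ck.
have [K2 dK2 _] := antiderivative 0 0 (has_deriv_continuous dK1).
pose c := (h ^+ 2)^-1.
have c0 : 0 < c by rewrite invr_gt0 exprn_gt0.
have hh x : x <= x + h by rewrite lerDl ltW.
have dd F f : has_deriv F f ->
    has_deriv (fun x => c * (F (x + h + h) - F (x + h) - (F (x + h) - F x)))
              (fun x => c * (f (x + h + h) - f (x + h) - (f (x + h) - f x))).
  move=> dF; apply: has_derivZ; apply: has_derivB; apply: has_derivB => //.
  - exact: (has_deriv_shift h (has_deriv_shift h dF)).
  - exact: has_deriv_shift.
  - exact: has_deriv_shift.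
have first x m M : (forall y, x <= y <= x + h -> m <= k y <= M) ->
    m * h <= K1 (x + h) - K1 x <= M * h.
  move=> kmM; have lo := has_deriv_le_le (has_derivZ m has_deriv_id) dK1 (hh x).
  have hi := has_deriv_le_le dK1 (has_derivZ M has_deriv_id) (hh x).
  have {lo} : m * (x + h) - m * x <= K1 (x + h) - K1 x.
    by apply: lo => y /kmM /andP[]; rewrite mulr1.
  have {hi} : K1 (x + h) - K1 x <= M * (x + h) - M * x.
    by apply: hi => y /kmM /andP[]; rewrite mulr1.
  lra.
have bnd x m M : (forall y, x <= y <= x + h + h -> m <= k y <= M) ->
    m <= c * (K2 (x + h + h) - K2 (x + h) - (K2 (x + h) - K2 x)) <= M.
  move=> kmM.
  have dPhi := has_derivB (has_deriv_shift h dK2) dK2.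
  have lo := has_deriv_le_le (has_derivZ (m * h) has_deriv_id) dPhi (hh x).
  have hi := has_deriv_le_le dPhi (has_derivZ (M * h) has_deriv_id) (hh x).
  have step y : x <= y <= x + h -> m * h <= K1 (y + h) - K1 y <= M * h.
    move=> /andP[xy yxh]; apply: first => z /andP[yz zyh]; apply: kmM.
    by rewrite (le_trans xy yz) (le_trans zyh)// lerD2r.
  have {lo} : m * h * (x + h) - m * h * x <= (K2 (x + h + h) - K2 (x + h)) - (K2 (x + h) - K2 x).
    by apply: lo => y /step /andP[]; rewrite mulr1.
  have {hi} : (K2 (x + h + h) - K2 (x + h)) - (K2 (x + h) - K2 x) <= M * h * (x + h) - M * h * x.
    by apply: hi => y /step /andP[]; rewrite mulr1.
  have h2 := exprn_gt0 2 h0.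
  rewrite [c * _]mulrC ler_pdivlMr// ler_pdivrMr// expr2 => hi lo.
  by apply/andP; split; lra.
exists (fun x => c * (K2 (x + h + h) - K2 (x + h) - (K2 (x + h) - K2 x))),
  (fun x => c * (K1 (x + h + h) - K1 (x + h) - (K1 (x + h) - K1 x))),
  (fun x => c * (k (x + h + h) - k (x + h) - (k (x + h) - k x))).
have ckh (k' : R -> R) : continuous k' -> continuous (fun x => k' (x + h)).
  move=> ck' x; apply: (@continuous_comp _ _ _ (fun x => x + h) k'); last exact: ck'.
  by apply: cvgD; [exact: cvg_id|exact: cvg_cst].
split.
- split; [exact: dd|exact: dd|apply: continuous_funZ].
  apply: continuous_funB; apply: continuous_funB => //; last exact: ckh.
    exact: (ckh (fun x => k (x + h)) (ckh _ ck)).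
  exact: ckh.
- exact: bnd.
- move=> x k0; split.
    have := bnd x 0 0; rewrite -eq_le => /(_ _)/eqP <- // y /k0 ->.
    by rewrite lexx.
  have z1 : 0 * h <= K1 (x + h + h) - K1 (x + h) <= 0 * h.
    by apply: first => y /andP[xy yx]; rewrite k0 ?lexx// (le_trans (hh x) xy).
  have z2 : 0 * h <= K1 (x + h) - K1 x <= 0 * h.
    by apply: first => y /andP[xy yx]; rewrite k0 ?lexx// xy (le_trans yx).
  by move: z1 z2; rewrite !mul0r -!eq_le => /eqP <- /eqP <-; rewrite subrr mulr0.
Qed.

(** The two shapes are those of [Jminus] and [Jplus]. *)
Definition half_open (i : interval R) a b := (i = `[a, b[%R) \/ (i = `]a, b]%R).

Lemma half_open_sub i a b : half_open i a b ->
  `]a, b[ `<=` [set` i] /\ [set` i] `<=` `[a, b].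
Proof.
by case=> ->; split => x /=; rewrite !in_itv/= => /andP[h1 h2]; apply/andP; split => //;
  exact: ltW.
Qed.

Lemma C2_vanishing_sub i a b : half_open i a b ->
  C2_vanishing a b `<=` sq_integrable mu [set` i].
Proof.
move=> iE u [du [ddu [[u1 _ _] _ _ _ _]]].
apply: (continuous_sq_integrable (a := a) (b := b)) => //; first exact: (half_open_sub iE).2.
exact: has_deriv_continuous u1.
Qed.

(** [g] is cut off near both ends and then averaged over forward steps. The results vanish to first
    order at [a] and [b], stay bounded by the bound of [g] and converge to [g] pointwise inside, so
    dominated convergence applies. *)
Lemma continuous_adherent i a b g : a < b -> half_open i a b -> continuous g ->
  adherent (ip := ip_on [set` i]) (C2_vanishing a b) g.
Proof.
move=> ab iE cg r r0.
pose d n : R := n.+1%:R^-1.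
have d0 n : 0 < d n by rewrite invr_gt0.
(* A trapezoid: 0 up to [a + d n] and from [b - d n] on, 1 between [a + 2 d n] and [b - 2 d n]. The
   average at [a] reads [[a, a + d n]], where [chi n] is still 0. *)
pose chi n x := clamp 0 1 ((d n)^-1 * (x - a) - 1) * clamp 0 1 ((d n)^-1 * (b - x) - 1).
have cid : continuous (id : R -> R) by move=> x; exact: cvg_id.
have ccst (c : R) : continuous (fun _ : R => c) by move=> x; exact: cvg_cst.
have cclamp (k : R -> R) : continuous k -> continuous (fun x => clamp 0 1 (k x)).
  by move=> ck x; apply: (@continuous_comp _ _ _ k); [exact: ck|exact: continuous_clamp].
have cchi n : continuous (chi n).
  apply: continuous_funM; apply: cclamp; apply: continuous_funB => //;
    apply: continuous_funZ; exact: continuous_funB.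
have chi01 n x : 0 <= chi n x <= 1.
  have c01 y := @clamp_itv R 0 1 y ler01.
  rewrite /chi; set A := clamp _ _ _; set B := clamp _ _ _.
  have /andP[A0 A1] : 0 <= A <= 1 by exact: c01.
  have /andP[B0 B1] : 0 <= B <= 1 by exact: c01.
  by rewrite mulr_ge0//= mulr_ile1.
have clamp0 y : y <= 0 -> clamp 0 1 y = 0.
  by move=> y0; rewrite /clamp max_l// ge_min y0 orbT.
have clamp1 y : 1 <= y -> clamp 0 1 y = 1.
  by move=> y1; rewrite /clamp min_l// max_r// ler01.
have chi0l n x : x <= a + d n -> chi n x = 0.
  move=> xa; rewrite /chi clamp0 ?mul0r// subr_le0 mulrC ler_pdivrMr// mul1r; lra.
have chi0r n x : b <= x -> chi n x = 0.
  move=> bx; rewrite /chi [X in _ * X]clamp0 ?mulr0// subr_le0 mulrC ler_pdivrMr// mul1r.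
  by have := d0 n; lra.
have chi1 n x : a + d n *+ 2 <= x -> x <= b - d n *+ 2 -> chi n x = 1.
  move=> xa xb; rewrite /chi !clamp1 ?mulr1// lerBrDr [_^-1 * _]mulrC ler_pdivlMr//; lra.
have [B B0 gB] := continuous_itv_bounded a b cg.
pose k n x := g x * chi n x.
have ck n : continuous (k n) by exact: continuous_funM.
have kB n x : - B <= k n x <= B.
  rewrite -ler_norml /k normrM.
  have [xab|] := boolP (a <= x <= b).
    rewrite -[leRHS]mulr1 ler_pM// ?gB// ger0_norm; by have /andP[] := chi01 n x.
  rewrite negb_and -!ltNge => /orP[xa|bx].
    by rewrite chi0l ?normr0 ?mulr0 ?(ltW B0)//; have := d0 n; lra.
  by rewrite chi0r ?normr0 ?mulr0 ?(ltW B0)// ltW.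
have hn0 n : 0 < d n / 2 by rewrite divr_gt0.
have /choice[u uP] : forall n, exists u, C2_vanishing a b u /\
    forall x m M, (forall y, x <= y <= x + d n -> m <= k n y <= M) -> m <= u x <= M.
  move=> n; have [u [du [ddu [C2u uavg u0]]]] := double_average (ck n) (hn0 n).
  have dE x : x + d n / 2 + d n / 2 = x + d n by field.
  exists u; split; last by move=> x m M kmM; apply: uavg; rewrite dE.
  have [ua dua] : u a = 0 /\ du a = 0.
    by apply: u0 => y; rewrite dE => /andP[_ ya]; rewrite /k chi0l ?mulr0.
  have [ub dub] : u b = 0 /\ du b = 0.
    by apply: u0 => y; rewrite dE => /andP[yb _]; rewrite /k chi0r ?mulr0.
  by exists du, ddu.
have cu n : continuous (u n).
  by have [[du [ddu [[u1 _ _] _ _ _ _]]] _] := uP n; exact: has_deriv_continuous u1.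
have subo : `]a, b[ `<=` `[a, b] by move=> x /=; rewrite !in_itv/= => /andP[/ltW -> /ltW ->].
have mo : measurable (`]a, b[%classic : set cR) by apply: completed_measurable; exact: measurable_itv.
have u_cvg x : `]a, b[%classic x -> u n x @[n --> \oo] --> g x.
  rewrite /= in_itv/= => /andP[ax xb]; apply/cvgrPdist_le => e e0.
  have /cvgrPdist_lt/(_ e e0)/nbhs_ballP[eta /= eta0 geta] := cg x.
  (* If [d n < m], then on [[x, x + d n]] the function [g] varies by less than [e] and [chi n] is 1:
     the left ramp takes [2 d n], the right ramp and the averaging window together [3 d n]. *)
  pose m : R := Num.min eta (Num.min ((x - a) / 2) ((b - x) / 4)).
  have m0 : 0 < m by rewrite /m !lt_min eta0/= !divr_gt0// subr_gt0.
  have := near_infty_natSinv_lt (PosNum m0).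
  apply: filterS => n /= dm; have {}dm : d n < m by [].
  move: dm; rewrite /m !lt_min => /and3P[deta da db].
  have := (uP n).2 x (g x - e) (g x + e).
  have /[swap]/[apply] : forall y, x <= y <= x + d n -> g x - e <= k n y <= g x + e.
    move=> y /andP[xy yx]; rewrite /k chi1 ?mulr1; [|lra|lra].
    have : ball x eta y by rewrite /ball/= distrC ger0_norm; lra.
    by move=> /geta; rewrite ltr_norml; lra.
  by rewrite ler_norml; lra.
have u_le n x : `]a, b[%classic x -> `|g x - u n x| <= (fun=> B *+ 2) x.
  rewrite /= in_itv/= => /andP[/ltW ax /ltW xb].
  have := (uP n).2 x (- B) B (fun y _ => kB n y).
  have := gB x; rewrite ax xb => /(_ isT).
  by rewrite !ler_norml; lra.
have mB : sq_integrable mu (`]a, b[%classic : set cR) (fun=> B *+ 2).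
  exact: (@continuous_sq_integrable _ _ a b).
have [n un] := sq_dominated mo (fun n => completed_continuous_measurable (measurable_itv _) (cu n))
  (completed_continuous_measurable (measurable_itv _) cg) mB u_cvg u_le r0.
exists (u n); first exact: (uP n).1.
(* Pointwise convergence was available on the open interval only. The integral over [i] has the same
   value, as both are differences of one antiderivative. *)
have cgu : continuous (fun t => (g t + -1 * u n t) * (g t + -1 * u n t)).
  by apply: continuous_funM; apply: continuous_funD => //; apply: continuous_funZ.
have [F dF _] := antiderivative 0 0 cgu.
rewrite /ip_on (completed_FTC ab _ cgu dF); last by case: iE => ->; constructor.
by rewrite (completed_FTC ab _ cgu dF) in un; last by constructor.
Qed.

End Density.

(** * Indicators of Lebesgue measurable sets *)

Section IndicatorDensity.
Context {R : realType}.
Notation cR := (caratheodory_type (wlength (@idfun R))^*%mu).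
Notation mu := (@completed_lebesgue_measure R).
Implicit Types (f g : R -> R) (a b : R).

(** A set of the completed sigma-algebra is a Borel set joined with a subset of a Borel null set. *)
Lemma completed_measurable_ae (A : set cR) : measurable A ->
  exists B N : set R, [/\ measurable B, measurable N, lebesgue_measure N = 0 &
    forall x, ~ N x -> A x <-> B x].
Proof.
rewrite -completed_caratheodory_measurable g_sigma_completed_algebra_genE.
move=> [B mB [N [N' [mN' N'0 NN']]] <-].
exists B, N'; split => // x nN'x; split; last by left.
by case=> // /NN'.
Qed.

Lemma indic_sq_integrable i a b (A : set cR) : half_open i a b -> measurable A ->
  sq_integrable mu [set` i] (\1_A : R -> R).
Proof.
move=> iE mA; have [_ iab] := half_open_sub iE.
apply: (@bounded_sq_integrable _ _ _ _ _ _ _ 1).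
- by apply: completed_measurable; exact: measurable_itv.
- exact: completed_bounded_fin (measurable_itv _) iab.
- exact: measurable_indic.
- by move=> x _; rewrite indicE; case: (x \in A); rewrite ?normr1 ?normr0.
Qed.

(** [A] is replaced by a Borel set [B] up to a null set, and [\1_B] is approximated in mean by a
    continuous function. Truncated to [[0, 1]], this function is at distance at most 1 from [\1_B]
    everywhere, so the squared error is below the absolute one. *)
Lemma indic_adherent i a b (A : set cR) : half_open i a b -> measurable A ->
  adherent (ip := ip_on [set` i]) [set g | continuous g] (\1_A : R -> R).
Proof.
move=> iE mA r r0; have [_ iab] := half_open_sub iE.
have [B [N [mB mN N0 AB]]] := completed_measurable_ae mA.
have mi : measurable ([set` i] : set (measurableTypeR R)) by exact: measurable_itv.
have ioo : (@lebesgue_measure R [set` i] < +oo)%E := completed_bounded_fin mi iab.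
have Bint : lebesgue_measure.-integrable [set` i] (EFin \o (\1_B : R -> R)).
  apply: (@bounded_integrable _ _ _ _ _ _ _ 1) => //.
  by move=> x _; rewrite indicE; case: (x \in B); rewrite ?normr1 ?normr0.
have [h [ch hint hcvg]] := approximation_continuous_integrable mi ioo Bint.
move: hcvg => /fine_cvgP[_ /cvgrPdist_lt/(_ r r0)][n _ /(_ n (leqnn n))].
rewrite /= sub0r normrN => hr.
pose g x := clamp 0 1 (h n x).
have cg : continuous g.
  move=> x; apply: (@continuous_comp _ _ _ (h n)); first exact: ch.
  exact: continuous_clamp.
exists g => //; apply: le_lt_trans hr; apply: le_trans (ler_norm _).
have bnd (C : set R) x : `|(\1_C x + -1 * g x : R)| <= 1.
  have := clamp_itv (h n x) (@ler01 R); rewrite -/(g x) indicE mulN1r.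
  by case: (x \in C) => /=; rewrite ler_norml => /andP[]; lra.
have mBg1 : measurable_fun setT (fun x : R => \1_B x + -1 * g x).
  apply: measurable_funD; first exact: measurable_indic.
  by apply: continuous_measurable_fun; exact: continuous_funZ.
have mBg : measurable_fun setT (fun x : R => (\1_B x + -1 * g x) * (\1_B x + -1 * g x)).
  exact: measurable_funM.
have bnd2 x : `|(\1_B x + -1 * g x) * (\1_B x + -1 * g x)| <= 1.
  by rewrite normrM mulr_ile1.
have mci := completed_measurable mi.
have mAg : measurable_fun ([set` i] : set cR)
    (fun x => (\1_A x + -1 * g x) * (\1_A x + -1 * g x)).
  have [mAg _] := sq_integrableD mci (-1) (indic_sq_integrable iE mA)
    (continuous_sq_integrable mi iab cg).
  exact: measurable_funM.
have AB' x : [set` i] x -> ~ N x -> (\1_A x + -1 * g x) * (\1_A x + -1 * g x) =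
    (\1_B x + -1 * g x) * (\1_B x + -1 * g x).
  move=> _ nNx; have [AB1 BA1] := AB x nNx.
  rewrite !indicE (_ : (x \in A) = (x \in B))//.
  by apply/idP/idP => /set_mem ?; apply/mem_set; [exact: AB1|exact: BA1].
have N0' : mu N = 0%E := N0.
rewrite /ip_on (Rintegral_ae_eq mci mAg (completed_measurable_fun mi (measurable_funTS mBg))
  (completed_measurable mN) N0' AB').
rewrite (completed_Rintegral mi iab mBg bnd2).
apply: le_Rintegral => //.
- by apply: (bounded_integrable mi ioo (measurable_funTS mBg)) => x _; exact: bnd2.
- have := integrableB mi Bint (hint n); move=> /integrable_abse.
  by apply: eq_integrable.
move=> x _.
have gh c : 0 <= c <= 1 -> `|c + -1 * g x| <= `|c - h n x|.
  move=> c01; rewrite /g /clamp mulN1r.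
  have [h1|h1] := leP 1 (h n x); last have [h0|h0] := leP 0 (h n x).
  - have := ler_norm (- (c - h n x)); rewrite normrN max_r// ler_norml.
    by have := normr_ge0 (c - h n x); lra.
  - by [].
  - rewrite ler_norml; have := ler_norm (c - h n x).
    by have := normr_ge0 (c - h n x); lra.
rewrite -[X in X <= _]ger0_norm -?expr2 ?sqr_ge0// normrX expr2.
apply: (@le_trans _ _ `|\1_B x + -1 * g x|).
  by rewrite ler_piMl.
by apply: gh; rewrite indicE; case: (x \in B); rewrite ?lexx ?ler01.
Qed.

Lemma sq_dense i a b f : a < b -> half_open i a b -> sq_integrable mu [set` i] f ->
  adherent (ip := ip_on [set` i]) (C2_vanishing a b) f.
Proof.
move=> ab iE Sf.
have mci : measurable ([set` i] : set cR) by apply: completed_measurable; exact: measurable_itv.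
have si := sq_semi_inner mci.
have cS g : continuous g -> sq_integrable mu [set` i] g.
  by move=> cg; exact: (continuous_sq_integrable (measurable_itv i) (half_open_sub iE).2).
apply: (adherent_trans si (C2_vanishing_sub iE) _ Sf (Q := [set g | continuous g])).
  by move=> g cg; split; [exact: cS|exact: continuous_adherent].
apply: simple_dense => //.
- by move=> g h c cg ch; apply: continuous_funD => //; exact: continuous_funZ.
- by move=> A mA; exact: (indic_sq_integrable iE mA).
- by move=> A mA; exact: (indic_adherent iE mA).
Qed.

End IndicatorDensity.

(** * Complex solutions and their extension to the closed intervals *)

Section ComplexLimits.
Context {R : realType}.
Local Notation ReC := (@complex.Re R).
Local Notation ImC := (@complex.Im R).

Lemma norm_le_normc (z : R[i]) : (`|ReC z|%:C <= `|z|) /\ (`|ImC z|%:C <= `|z|).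
Proof.
rewrite normc_def !lecR -!sqrtr_sqr; split; apply: ler_wsqrtr.
  by rewrite lerDl sqr_ge0.
by rewrite lerDr sqr_ge0.
Qed.

Lemma normc_le_norm (z : R[i]) : `|z| <= (`|ReC z| + `|ImC z|)%:C.
Proof.
rewrite {1}[z]complexE rmorphD/=; apply: le_trans (ler_normD _ _) _.
rewrite normrM (_ : `|'i%C : R[i]| = 1) ?mul1r; last first.
  by rewrite normc_def/= expr0n/= add0r expr1n sqrtr1.
by rewrite !normc_def/= !expr0n/= !addr0 !sqrtr_sqr.
Qed.

Lemma cvg_complexP T (F : set_system T) (FF : Filter F) (f : T -> R[i]) (l : R[i]) :
  f x @[x --> F] --> (l : R[i]^o) <->
  ReC (f x) @[x --> F] --> ReC l /\ ImC (f x) @[x --> F] --> ImC l.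
Proof.
split=> [fl|[fRe fIm]].
  split; apply/cvgrPdist_lt => e e0.
    move/(@cvgrPdist_lt _ R[i]^o) : fl => /(_ e%:C); rewrite ltcR => /(_ e0).
    apply: filterS => x /(le_lt_trans (norm_le_normc _).1).
    by rewrite ltcR; case: (f x) (l) => a b [c d].
  move/(@cvgrPdist_lt _ R[i]^o) : fl => /(_ e%:C); rewrite ltcR => /(_ e0).
  apply: filterS => x /(le_lt_trans (norm_le_normc _).2).
  by rewrite ltcR; case: (f x) (l) => a b [c d].
apply/(@cvgrPdist_lt _ R[i]^o) => -[e e']; rewrite ltcE /= => /andP[/eqP -> e0].
have e20 : 0 < e / 2 by rewrite divr_gt0.
move/cvgrPdist_lt : fRe => /(_ _ e20) fRe; move/cvgrPdist_lt : fIm => /(_ _ e20) fIm.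
apply: filterS2 fRe fIm => x; case: (f x) (l) => a b [c d] /= h1 h2.
apply: (le_lt_trans (normc_le_norm _)); rewrite /= ltcR.
by rewrite [ltRHS]splitr ltrD.
Qed.

Lemma divc_real (z : R[i]) (s : R) : z / s%:C = (ReC z / s) +i* (ImC z / s).
Proof.
by rewrite -fmorphV; case: z => a b; apply/eqP; rewrite eq_complex /= !mulr0 subr0 add0r !eqxx.
Qed.

Lemma deriv_on_ReIm (D : set R) (u : R -> R[i]) x (l : R[i]) : deriv_on D u x l ->
  ((ReC (u t) - ReC (u x)) / (t - x) @[t --> within D x^'] --> ReC l) /\
  ((ImC (u t) - ImC (u x)) / (t - x) @[t --> within D x^'] --> ImC l).
Proof.
move=> /cvg_complexP[h1 h2]; split.
  rewrite (_ : (fun t => _) = fun t => ReC ((u t - u x) / (t - x)%:C))//.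
  by apply/funext => t; rewrite divc_real; case: (u t) (u x) => a b [c d].
rewrite (_ : (fun t => _) = fun t => ImC ((u t - u x) / (t - x)%:C))//.
by apply/funext => t; rewrite divc_real; case: (u t) (u x) => a b [c d].
Qed.

Section OneSided.
Context {a b : R} {D : set R}.
Hypothesis abD : `]a, b[ `<=` D.

(** Derivatives and continuity are stated relative to [D]. This and the next two lemmas turn limits
    within [D] into one-sided or punctured limits, knowing only that [D] contains the open
    interval. *)
Lemma at_right_within : a < b -> forall (T : topologicalType) (f : R -> T) (l : T),
  f t @[t --> within D a^'] --> l -> f t @[t --> a^'+] --> l.
Proof.
move=> ab T f l; apply: cvg_trans; apply: cvg_app => A nA; have {}nA : \forall t \near a, t != a -> D t -> A t by [].
suff : \forall t \near a, a < t -> A t by [].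
near=> t => ta; have : t != a -> D t -> A t by near: t.
apply; first by rewrite gt_eqF.
by apply: abD; rewrite /= in_itv/= ta/=; near: t; exact: lt_nbhsl.
Unshelve. all: by end_near. Qed.

Lemma at_left_within : a < b -> forall (T : topologicalType) (f : R -> T) (l : T),
  f t @[t --> within D b^'] --> l -> f t @[t --> b^'-] --> l.
Proof.
move=> ab T f l; apply: cvg_trans; apply: cvg_app => A nA; have {}nA : \forall t \near b, t != b -> D t -> A t by [].
suff : \forall t \near b, t < b -> A t by [].
near=> t => ta; have : t != b -> D t -> A t by near: t.
apply; first by rewrite lt_eqF.
by apply: abD; rewrite /= in_itv/= ta/= andbT; near: t; exact: lt_nbhsr.
Unshelve. all: by end_near. Qed.

Lemma dnbhs_within x : a < x < b -> forall (T : topologicalType) (f : R -> T) (l : T),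
  f t @[t --> within D x^'] --> l -> f t @[t --> x^'] --> l.
Proof.
move=> /andP[ax xb] T f l; apply: cvg_trans; apply: cvg_app => A nA; have {}nA : \forall t \near x, t != x -> D t -> A t by [].
suff : \forall t \near x, t != x -> A t by [].
near=> t => tx; have : t != x -> D t -> A t by near: t.
apply => //; apply: abD; rewrite /= in_itv/=.
by apply/andP; split; near: t; [exact: lt_nbhsr|exact: lt_nbhsl].
Unshelve. all: by end_near. Qed.

End OneSided.

Lemma quotient_cvg_continuous (F : set_system R) (FF : Filter F) (f : R -> R) (x l : R) :
  (t - x) @[t --> F] --> (0 : R) -> (\forall t \near F, t != x) ->
  (f t - f x) / (t - x) @[t --> F] --> l -> f t @[t --> F] --> f x.
Proof.
move=> t0 tx fl.
have h : f x + (f t - f x) / (t - x) * (t - x) @[t --> F] --> f x + l * 0.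
  by apply: cvgD; [exact: cvg_cst|exact: cvgM].
rewrite mulr0 addr0 in h; apply: cvg_trans h; apply: near_eq_cvg.
by apply: filterS tx => t tx; rewrite divfK ?subr_eq0// addrC subrK.
Qed.

Lemma quotient_cvg_is_derive (f : R -> R) (x l : R) :
  (f t - f x) / (t - x) @[t --> x^'] --> l -> is_derive x (1 : R) f l.
Proof.
move=> fl; apply/is_derive1_caratheodory.
exists (fun t => if t == x then l else (f t - f x) / (t - x)); split => [t||].
- have [->|tx] := eqVneq t x; first by rewrite !subrr mulr0.
  by rewrite divfK// subr_eq0.
- apply/continuous_withinNx; rewrite eqxx; apply: cvg_trans fl.
  apply: near_eq_cvg; near=> t; rewrite ifF//; apply/negbTE.
  by near: t; exact: nbhs_dnbhs_neq.
- by rewrite eqxx.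
Unshelve. all: by end_near. Qed.

End ComplexLimits.

(** * Extension from an open interval to the whole line *)

Section Extension.
Context {R : realType}.
Implicit Types (f u v w : R -> R) (a b x y : R).

Lemma extend_continuous a b f la lb : a < b ->
  (forall x, a < x < b -> {for x, continuous f}) ->
  f x @[x --> a^'+] --> la -> f x @[x --> b^'-] --> lb ->
  exists g : R -> R, [/\ continuous g, forall x, a < x < b -> g x = f x, g a = la & g b = lb].
Proof.
move=> ab cf fa fb.
pose g x := if x <= a then la else if b <= x then lb else f x.
have gf x : a < x < b -> g x = f x by move=> /andP[ax xb]; rewrite /g leNgt ax leNgt xb.
have ga x : x <= a -> g x = la by rewrite /g => ->.
have gb x : b <= x -> g x = lb.
  by move=> bx; rewrite /g leNgt (lt_le_trans ab bx) bx.
exists g; split => //; last 2 first.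
- by rewrite ga.
- by rewrite gb.
move=> x; apply/left_right_continuousP; split.
- have [xa|ax] := leP x a; last have [bx|xb|bx] := ltgtP x b.
  + rewrite ga//; apply: cvg_near_cst; near=> t; apply: ga; apply: ltW; apply: lt_le_trans xa.
    by near: t; exact: nbhs_left_lt.
  + rewrite gf ?ax//; have := @cvg_at_left_filter _ _ f x _ (cf x _).
    rewrite ax bx => /(_ isT); apply: cvg_trans; apply: near_eq_cvg; near=> t.
    rewrite gf//; apply/andP; split; first by near: t; exact: nbhs_left_gt.
    by rewrite (lt_trans _ bx)//; near: t; exact: nbhs_left_lt.
  + rewrite gb ?(ltW xb)//; apply: cvg_near_cst; near=> t; apply: gb; apply: ltW.
    by near: t; exact: nbhs_left_gt.
  + rewrite bx gb// -bx; rewrite -bx in fb; apply: cvg_trans fb; apply: near_eq_cvg; near=> t.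
    rewrite gf//; apply/andP; split; first by near: t; apply: nbhs_left_gt; rewrite bx.
    by rewrite -bx; near: t; exact: nbhs_left_lt.
- have [bx|xb] := leP b x; last have [xa|ax|xa] := ltgtP x a.
  + rewrite gb//; apply: cvg_near_cst; near=> t; apply: gb; apply: ltW; apply: le_lt_trans bx _.
    by near: t; exact: nbhs_right_gt.
  + rewrite ga ?(ltW xa)//; apply: cvg_near_cst; near=> t; apply: ga; apply: ltW.
    by near: t; exact: nbhs_right_lt.
  + rewrite gf ?ax//; have := @cvg_at_right_filter _ _ f x _ (cf x _).
    rewrite ax xb => /(_ isT); apply: cvg_trans; apply: near_eq_cvg; near=> t.
    rewrite gf//; apply/andP; split; last by near: t; exact: nbhs_right_lt.
    by rewrite (lt_trans ax)//; near: t; exact: nbhs_right_gt.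
  + rewrite xa ga//; apply: cvg_trans fa; apply: near_eq_cvg; near=> t.
    rewrite gf//; apply/andP; split; last by near: t; exact: nbhs_right_lt.
    by near: t; exact: nbhs_right_gt.
Unshelve. all: by end_near. Qed.

(** [U] integrates the extended derivative from the midpoint, where it is made equal to [u]; on the
    interval [U - u] has derivative 0. *)
Lemma extend_primitive a b u w du : a < b ->
  (forall x, a < x < b -> is_derive x (1 : R) u (w x)) ->
  continuous du -> (forall x, a < x < b -> du x = w x) ->
  exists2 U, has_deriv U du & forall x, a < x < b -> U x = u x.
Proof.
move=> ab uw cdu duw.
pose c := (a + b) / 2.
have cab : a < c < b by rewrite /c; lra.
have [U dU Uc] := antiderivative c (u c) cdu.
exists U => // x xab.
have dUu y : a < y < b -> is_derive y (1 : R) (fun t => U t - u t) 0.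
  move=> yab; have := is_deriveB (dU y) (uw y yab).
  by rewrite duw// subrr.
have cst y z : a < y -> y <= z -> z < b -> U z - u z = U y - u y.
  move=> ay yz zb.
  have h t : t \in `]y, z[%R -> is_derive t (1 : R) (fun t => U t - u t) ((fun=> 0) t).
    by rewrite in_itv/= => /andP[yt tz]; apply: dUu; rewrite (lt_trans ay yt) (lt_trans tz zb).
  have cUu : {within `[y, z], continuous (fun t => U t - u t)}.
    apply: derivable_within_continuous => t; rewrite in_itv/= => /andP[yt tz].
    by have [] := dUu t ltac:(by rewrite (lt_le_trans ay yt) (le_lt_trans tz zb)).
  have [t _] := MVT_segment yz h cUu.
  by rewrite mul0r => /eqP; rewrite subr_eq0 => /eqP.
have : U x - u x = U c - u c.
  case/andP: xab => ax xb; case/andP: cab => ac cb.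
  by have [xc|cx] := leP x c; [exact/esym/cst|apply: cst => //; exact: ltW].
by rewrite Uc subrr => /eqP; rewrite subr_eq0 => /eqP.
Qed.

Lemma limit_at_ends a b u U ua ub : a < b -> continuous U ->
  (forall x, a < x < b -> U x = u x) ->
  u x @[x --> a^'+] --> ua -> u x @[x --> b^'-] --> ub -> U a = ua /\ U b = ub.
Proof.
move=> ab cU Uu ha hb; split.
- have h := cvg_at_right_filter (cU a).
  suff e : U x @[x --> a^'+] --> ua by rewrite -(cvg_lim _ h) -?(cvg_lim _ e).
  apply: cvg_trans ha; apply: near_eq_cvg; near=> t.
  rewrite Uu//; apply/andP; split; last by near: t; exact: nbhs_right_lt.
  by near: t; exact: nbhs_right_gt.
- have h := cvg_at_left_filter (cU b).
  suff e : U x @[x --> b^'-] --> ub by rewrite -(cvg_lim _ h) -?(cvg_lim _ e).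
  apply: cvg_trans hb; apply: near_eq_cvg; near=> t.
  rewrite Uu//; apply/andP; split; first by near: t; exact: nbhs_left_gt.
  by near: t; exact: nbhs_left_lt.
Unshelve. all: by end_near. Qed.

(** Only the second derivative is extended directly, by constants. Integrating the extension twice
    makes the derivative relations hold at the end points too. *)
Lemma extend_C2 a b u du w ua ub da db wa wb : a < b ->
  (forall x, a < x < b -> is_derive x (1 : R) u (du x) /\ is_derive x (1 : R) du (w x)) ->
  (forall x, a < x < b -> {for x, continuous w}) ->
  u x @[x --> a^'+] --> ua -> u x @[x --> b^'-] --> ub ->
  du x @[x --> a^'+] --> da -> du x @[x --> b^'-] --> db ->
  w x @[x --> a^'+] --> wa -> w x @[x --> b^'-] --> wb ->
  exists U dU ddU, [/\ C2 U dU ddU,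
    forall x, a < x < b -> [/\ U x = u x, dU x = du x & ddU x = w x],
    [/\ U a = ua, dU a = da & ddU a = wa] & [/\ U b = ub, dU b = db & ddU b = wb]].
Proof.
move=> ab duw cw ua' ub' da' db' wa' wb'.
have [W [cW Ww Wa Wb]] := extend_continuous ab cw wa' wb'.
have [dU ddU dUdu] := extend_primitive ab (fun x h => (duw x h).2) cW Ww.
have cdU := has_deriv_continuous ddU.
have [U dU' Uu] := extend_primitive ab (fun x h => (duw x h).1) cdU dUdu.
have cU := has_deriv_continuous dU'.
have [Ua Ub] := limit_at_ends ab cU Uu ua' ub'.
have [dUa dUb] := limit_at_ends ab cdU dUdu da' db'.
by exists U, dU, W; split => // x xab; split; [exact: Uu|exact: dUdu|exact: Ww].
Qed.

End Extension.

(** * Complex solutions as pairs of real functions *)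

Section SolutionExtension.
Context {R : realType}.
Local Notation ReC := (@complex.Re R).
Local Notation ImC := (@complex.Im R).
Implicit Types (a b p x : R) (q : R -> R).

(* Real and imaginary parts [A], [B] of a solution for [lr +i* li]. *)
Definition complex_solution a b p q (lr li : R) (A dA ddA B dB ddB : R -> R) :=
  [/\ C2 A dA ddA, C2 B dB ddB &
    forall x, a <= x <= b ->
      - p * ddA x + q x * A x = lr * A x - li * B x /\
      - p * ddB x + q x * B x = lr * B x + li * A x].

(** The second derivative is given point by point, without continuity. The equation, solved for it,
    expresses its two parts [wR] and [wI] through [q] and [u]; hence they are continuous and have
    limits at both ends. *)
Lemma complex_solution_ext a b p q (D : set R) (lam : R[i]) (u du : R -> R[i])
    (ua ub da db : R[i]) : a < b -> 0 < p -> `]a, b[ `<=` D -> continuous q ->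
  (forall x, a < x < b -> deriv_on D u x (du x) /\
    exists2 d2u : R[i], deriv_on D du x d2u &
      - p%:C * d2u + (q x)%:C * u x = lam * u x) ->
  u x @[x --> a^'+] --> (ua : R[i]^o) -> u x @[x --> b^'-] --> (ub : R[i]^o) ->
  du x @[x --> a^'+] --> (da : R[i]^o) -> du x @[x --> b^'-] --> (db : R[i]^o) ->
  exists A dA ddA B dB ddB : R -> R,
    [/\ complex_solution a b p q (ReC lam) (ImC lam) A dA ddA B dB ddB,
      forall x, a < x < b -> u x = A x +i* B x /\ du x = dA x +i* dB x,
      ua = A a +i* B a /\ da = dA a +i* dB a &
      ub = A b +i* B b /\ db = dA b +i* dB b].
Proof.
move=> ab p0 abD cq sol /cvg_complexP[uaR uaI] /cvg_complexP[ubR ubI].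
move=> /cvg_complexP[daR daI] /cvg_complexP[dbR dbI].
set lr := ReC lam; set li := ImC lam.
pose wR x := (q x * ReC (u x) - (lr * ReC (u x) - li * ImC (u x))) / p.
pose wI x := (q x * ImC (u x) - (lr * ImC (u x) + li * ReC (u x))) / p.
have isd (v : R -> R[i]) x l : a < x < b -> deriv_on D v x l ->
    is_derive x (1 : R) (ReC \o v) (ReC l) /\ is_derive x (1 : R) (ImC \o v) (ImC l).
  move=> xab /deriv_on_ReIm[h1 h2]; split; apply: quotient_cvg_is_derive.
    exact: (dnbhs_within abD xab h1).
  exact: (dnbhs_within abD xab h2).
have eqs x : a < x < b -> [/\ is_derive x (1 : R) (ReC \o u) (ReC (du x)),
    is_derive x (1 : R) (ImC \o u) (ImC (du x)),
    is_derive x (1 : R) (ReC \o du) (wR x) & is_derive x (1 : R) (ImC \o du) (wI x)].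
  move=> xab; have [h1 [d2 h2 e]] := sol x xab.
  have [hR hI] := isd _ _ _ xab h1; have [hdR hdI] := isd _ _ _ xab h2.
  have [eR eI] : wR x = ReC d2 /\ wI x = ImC d2.
    move: e; rewrite (_ : lam = lr +i* li); last by rewrite /lr /li; case: (lam).
    rewrite /wR /wI; case: d2 {h2 hdR hdI} => r s; case: (u x) => y z.
    rewrite /= => /eqP; rewrite eq_complex /= !(oppr0, mul0r, mulr0, subr0, addr0, add0r).
    move=> /andP[/eqP e1 /eqP e2].
    by split; apply: (mulIf (lt0r_neq0 p0)); rewrite divfK ?lt0r_neq0//; lra.
  by split => //; [rewrite eR|rewrite eI].
have cR x : a < x < b -> {for x, continuous (ReC \o u)}.
  by case/eqs => h _ _ _; exact: is_derive_continuous h.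
have cI x : a < x < b -> {for x, continuous (ImC \o u)}.
  by case/eqs => _ h _ _; exact: is_derive_continuous h.
have lim (F : set_system R) (FF : Filter F) (y r s : R) : q x @[x --> F] --> y ->
    ReC (u x) @[x --> F] --> r -> ImC (u x) @[x --> F] --> s ->
    (wR x @[x --> F] --> (y * r - (lr * r - li * s)) / p) /\
    (wI x @[x --> F] --> (y * s - (lr * s + li * r)) / p).
  move=> qy ur us; split; apply: cvgM; try exact: cvg_cst.
    by apply: cvgB; [exact: cvgM|apply: cvgB; apply: cvgM => //; exact: cvg_cst].
  by apply: cvgB; [exact: cvgM|apply: cvgD; apply: cvgM => //; exact: cvg_cst].
have limx x (xab : a < x < b) := lim _ _ _ _ _ (cq x) (cR x xab) (cI x xab).
have qa := cvg_at_right_filter (cq a); have qb := cvg_at_left_filter (cq b).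
have [waR waI] := lim _ _ _ _ _ qa uaR uaI.
have [wbR wbI] := lim _ _ _ _ _ qb ubR ubI.
have eqR x : a < x < b -> is_derive x (1 : R) (ReC \o u) ((ReC \o du) x) /\
    is_derive x (1 : R) (ReC \o du) (wR x) by case/eqs.
have eqI x : a < x < b -> is_derive x (1 : R) (ImC \o u) ((ImC \o du) x) /\
    is_derive x (1 : R) (ImC \o du) (wI x) by case/eqs.
have cwR x : a < x < b -> {for x, continuous wR} by case/limx.
have cwI x : a < x < b -> {for x, continuous wI} by case/limx.
have [A [dA [ddA [C2A Aeq [Aa dAa ddAa] [Ab dAb ddAb]]]]] :=
  extend_C2 ab eqR cwR uaR ubR daR dbR waR wbR.
have [B [dB [ddB [C2B Beq [Ba dBa ddBa] [Bb dBb ddBb]]]]] :=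
  extend_C2 ab eqI cwI uaI ubI daI dbI waI wbI.
exists A, dA, ddA, B, dB, ddB; split.
- split => // x /andP[]; rewrite !le_eqVlt => /predU1P[<- _|ax /predU1P[->|xb]].
  + rewrite Aa ddAa Ba ddBa; split; field; exact: lt0r_neq0.
  + rewrite Ab ddAb Bb ddBb; split; field; exact: lt0r_neq0.
  + have xab : a < x < b by rewrite ax.
    have [-> _ ->] := Aeq x xab; have [-> _ ->] := Beq x xab.
    by rewrite /wR /wI /=; split; field; exact: lt0r_neq0.
- move=> x xab; have [-> -> _] := Aeq x xab; have [-> -> _] := Beq x xab.
  by rewrite /=; case: (u x) (du x) => ? ? [? ?].
- by rewrite Aa Ba dAa dBa; case: (ua) (da) => ? ? [? ?].
- by rewrite Ab Bb dAb dBb; case: (ub) (db) => ? ? [? ?].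
Qed.

Lemma deriv_on_cvg (D : set R) (u : R -> R[i]) x (l : R[i]) : deriv_on D u x l ->
  u t @[t --> within D x^'] --> (u x : R[i]^o).
Proof.
move=> /deriv_on_ReIm[h1 h2].
have t0 : (t - x) @[t --> within D x^'] --> (0 : R).
  rewrite -(subrr x); apply: cvgB; last exact: cvg_cst.
  by apply: cvg_within_filter; apply: cvg_within_filter; exact: cvg_id.
have tx : \forall t \near within D x^', t != x.
  by rewrite near_withinE; near=> t => _; near: t; exact: nbhs_dnbhs_neq.
by apply/cvg_complexP; split; [exact: (quotient_cvg_continuous _ t0 tx h1)|
  exact: (quotient_cvg_continuous _ t0 tx h2)].
Unshelve. all: by end_near. Qed.

Lemma has_deriv_vanish a b (u du : R -> R) : a < b -> has_deriv u du -> continuous du ->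
  (forall x, a < x < b -> u x = 0) -> forall x, a <= x <= b -> u x = 0 /\ du x = 0.
Proof.
move=> ab du1 cdu u0.
have du0 x : a < x < b -> du x = 0.
  move=> /andP[ax xb]; have h : is_derive x (1 : R) (cst 0) (du x).
    apply: near_eq_is_derive (du1 x); near=> t; rewrite /= u0//.
    by apply/andP; split; near: t; [exact: lt_nbhsr|exact: lt_nbhsl].
  by have [_ <-] := h; have [_ ->] := is_derive_cst (0 : R) x (1 : R).
pose z (x : R) : R := 0.
have za : z x @[x --> a^'+] --> (0 : R) by exact: cvg_cst.
have zb : z x @[x --> b^'-] --> (0 : R) by exact: cvg_cst.
have [ua ub] := limit_at_ends ab (has_deriv_continuous du1) (u0 : forall x, _ -> u x = z x) za zb.
have [dua dub] := limit_at_ends ab cdu (du0 : forall x, _ -> du x = z x) za zb.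
move=> x /andP[]; rewrite !le_eqVlt => /predU1P[<- _|ax /predU1P[->|xb]] //.
by rewrite u0 ?du0 ?ax.
Unshelve. all: by end_near. Qed.

End SolutionExtension.

(** * The operator of the boundary value problem *)

Section RealProblem.
Context {R : realType} (P : bvtp R) (q1 q2 : R -> R).
Notation mu := (@completed_lebesgue_measure R).
Notation p1 := (bv_p1 P).
Notation p2 := (bv_p2 P).
Notation sa := (sin (bv_alpha P)).
Notation ca := (cos (bv_alpha P)).
Notation sb := (sin (bv_beta P)).
Notation cb := (cos (bv_beta P)).
Notation D := (Delta P).
Hypothesis p1_gt0 : 0 < p1.
Hypothesis p2_gt0 : 0 < p2.
Hypothesis D12_gt0 : 0 < D 1 2.
Hypothesis D34_gt0 : 0 < D 3 4.
Hypothesis cq1 : continuous q1.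
Hypothesis cq2 : continuous q2.
Implicit Types (f g u v F G : R -> R) (x c lam : R).

Lemma DeltaE i j : D i j = Tmx P 0 (inord i.-1) * Tmx P 1 (inord j.-1) -
  Tmx P 0 (inord j.-1) * Tmx P 1 (inord i.-1).
Proof.
rewrite /Delta; move: (Tmx P) => T.
rewrite (expand_det_row _ 0) !big_ord_recl big_ord0 addr0.
rewrite /cofactor !det_mx11 !mxE /= (_ : lift 0 0 = 1 :> 'I_2); last exact/val_inj.
by rewrite /= expr0 expr1; ring.
Qed.

(** Equivalently, the matrix that carries the left limits of [u] and [u'] at 0 to the right limits
    has determinant [D 3 4 / D 1 2]. This is why the weights contain these two minors. *)
Lemma plucker : D 1 2 * D 3 4 = D 1 3 * D 2 4 - D 1 4 * D 2 3.
Proof. by rewrite !DeltaE; ring. Qed.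

Definition w1 := D 3 4 / p1.
Definition w2 := D 1 2 / p2.

Lemma w1_gt0 : 0 < w1. Proof. exact: divr_gt0. Qed.
Lemma w2_gt0 : 0 < w2. Proof. exact: divr_gt0. Qed.

Definition J : set R := Jminus `|` Jplus.

Definition wint f : R := w1 * \int[mu]_(x in Jminus) f x + w2 * \int[mu]_(x in Jplus) f x.

Definition ip f g := wint (fun x => f x * g x).

Definition agree f (f1 f2 : R -> R) :=
  (forall x, Jminus x -> f x = f1 x) /\ (forall x, Jplus x -> f x = f2 x).

(** Continuity of the two pieces on the whole line encodes the finite one-sided limits at 0. *)
Definition pw_continuous f := exists f1 f2 : R -> R,
  [/\ continuous f1, continuous f2 & agree f f1 f2].

(** The value of [wint] in terms of antiderivatives of the two pieces. *)
Definition wdiff F1 F2 := w1 * (F1 0 - F1 (- pi)) + w2 * (F2 pi - F2 0).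

Lemma pi_neg : - pi < 0 :> R. Proof. by rewrite oppr_lt0 pi_gt0. Qed.

Lemma itv_sub_Jminus : `]- pi, 0[ `<=` @Jminus R.
Proof. by move=> x; rewrite /Jminus /= !in_itv/= => /andP[/ltW -> ->]. Qed.

Lemma itv_sub_Jplus : `]0, pi[ `<=` @Jplus R.
Proof. by move=> x; rewrite /Jplus /= !in_itv/= => /andP[-> /ltW ->]. Qed.

Lemma Jminus_Npi : @Jminus R (- pi).
Proof. by rewrite /Jminus /= in_itv/= lexx pi_neg. Qed.

Lemma Jplus_pi : @Jplus R pi.
Proof. by rewrite /Jplus /= in_itv/= lexx pi_gt0. Qed.

Lemma wint_FTC f f1 f2 F1 F2 : agree f f1 f2 -> continuous f1 -> continuous f2 ->
  has_deriv F1 f1 -> has_deriv F2 f2 -> wint f = wdiff F1 F2.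
Proof.
move=> [ff1 ff2] cf1 cf2 dF1 dF2; congr (_ * _ + _ * _).
  rewrite -(completed_FTC (i := `[- pi, 0[%R) pi_neg _ cf1 dF1); last by constructor.
  by apply: eq_Rintegral => x /set_mem; exact: ff1.
rewrite -(completed_FTC (i := `]0, pi]%R) (pi_gt0 R) _ cf2 dF2); last by constructor.
by apply: eq_Rintegral => x /set_mem; exact: ff2.
Qed.

Lemma agreeD f f1 f2 g g1 g2 c : agree f f1 f2 -> agree g g1 g2 ->
  agree (fun x => f x + c * g x) (fun x => f1 x + c * g1 x) (fun x => f2 x + c * g2 x).
Proof. by move=> [a1 a2] [b1 b2]; split=> x Jx; [rewrite a1 ?b1|rewrite a2 ?b2]. Qed.

Lemma agreeM f f1 f2 g g1 g2 : agree f f1 f2 -> agree g g1 g2 ->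
  agree (fun x => f x * g x) (fun x => f1 x * g1 x) (fun x => f2 x * g2 x).
Proof. by move=> [a1 a2] [b1 b2]; split=> x Jx; [rewrite a1 ?b1|rewrite a2 ?b2]. Qed.

Lemma continuous_comb (f g : R -> R) c : continuous f -> continuous g ->
  continuous (fun x => f x + c * g x).
Proof. by move=> cf cg; apply: continuous_funD => //; exact: continuous_funZ. Qed.

Lemma pw_continuousD f g c : pw_continuous f -> pw_continuous g ->
  pw_continuous (fun x => f x + c * g x).
Proof.
move=> [f1 [f2 [cf1 cf2 a]]] [g1 [g2 [cg1 cg2 b]]].
exists (fun x => f1 x + c * g1 x), (fun x => f2 x + c * g2 x).
by split; [exact: continuous_comb|exact: continuous_comb|exact: agreeD].
Qed.

Lemma pw_continuousM f g : pw_continuous f -> pw_continuous g ->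
  pw_continuous (fun x => f x * g x).
Proof.
move=> [f1 [f2 [cf1 cf2 a]]] [g1 [g2 [cg1 cg2 b]]].
exists (fun x => f1 x * g1 x), (fun x => f2 x * g2 x).
by split; [exact: continuous_funM|exact: continuous_funM|exact: agreeM].
Qed.

Lemma pw_continuous_cst c : pw_continuous (fun=> c).
Proof. by exists (fun=> c), (fun=> c); split => // x; exact: cvg_cst. Qed.

Lemma wint_lin f g c : pw_continuous f -> pw_continuous g ->
  wint (fun x => f x + c * g x) = wint f + c * wint g.
Proof.
move=> [f1 [f2 [cf1 cf2 a]]] [g1 [g2 [cg1 cg2 b]]].
have [F1 dF1 _] := antiderivative 0 0 cf1; have [F2 dF2 _] := antiderivative 0 0 cf2.
have [G1 dG1 _] := antiderivative 0 0 cg1; have [G2 dG2 _] := antiderivative 0 0 cg2.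
rewrite (wint_FTC (agreeD c a b) (continuous_comb cf1 cg1) (continuous_comb cf2 cg2)
  (has_derivD dF1 (has_derivZ c dG1)) (has_derivD dF2 (has_derivZ c dG2))).
rewrite (wint_FTC a cf1 cf2 dF1 dF2) (wint_FTC b cg1 cg2 dG1 dG2) /wdiff; ring.
Qed.

Definition total_weight := (w1 + w2) * pi.

Lemma total_weight_gt0 : 0 < total_weight.
Proof. by rewrite mulr_gt0 ?pi_gt0// addr_gt0 ?w1_gt0 ?w2_gt0. Qed.

Lemma wint_le f B : pw_continuous f -> (forall x, J x -> f x <= B) ->
  wint f <= B * total_weight.
Proof.
move=> [f1 [f2 [cf1 cf2 a]]] fB.
have mu_le i b c (k : R -> R) : b < c -> half_open i b c -> continuous k ->
    (forall x, [set` i] x -> k x <= B) -> \int[mu]_(x in [set` i]) k x <= B * (c - b).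
  move=> bc ibc ck kB; have [_ ibc'] := half_open_sub ibc.
  have mi := measurable_itv i.
  have cB : continuous (fun _ : R => B) by move=> x; exact: cvg_cst.
  have dB : has_deriv (fun x => B * x) (fun=> B).
    by apply: (eq_has_deriv (has_derivZ B has_deriv_id)) => x; rewrite mulr1.
  rewrite mulrBr -(completed_FTC (i := i) bc _ cB dB); last by case: ibc => ->; constructor.
  apply: le_Rintegral => //.
  - exact: completed_measurable.
  - exact: continuous_completed_integrable mi ibc' ck.
  - exact: continuous_completed_integrable mi ibc' cB.
have [b1 b2] : (forall x, Jminus x -> f1 x <= B) /\ (forall x, Jplus x -> f2 x <= B).
  by case: a => a1 a2; split => x Jx; [rewrite -a1//|rewrite -a2//]; apply: fB; [left|right].
have i1 := mu_le _ _ _ f1 pi_neg (or_introl erefl) cf1 b1.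
have i2 := mu_le _ _ _ f2 (pi_gt0 R) (or_intror erefl) cf2 b2.
have -> : wint f = w1 * \int[mu]_(x in Jminus) f1 x + w2 * \int[mu]_(x in Jplus) f2 x.
  case: a => a1 a2; congr (_ * _ + _ * _); apply: eq_Rintegral => x /set_mem; [exact: a1|exact: a2].
have {i1} := ler_wpM2l (ltW w1_gt0) i1; have {i2} := ler_wpM2l (ltW w2_gt0) i2.
rewrite /total_weight /Jminus /Jplus subr0 sub0r opprK; lra.
Qed.

(* A function on [J] with its first two derivatives: [s1] and [s2] are its
   restrictions to the two halves, extended to the whole line. *)
Record state := State { s1 : R -> R; ds1 : R -> R; dds1 : R -> R;
                        s2 : R -> R; ds2 : R -> R; dds2 : R -> R }.
Implicit Types (s t : state).

Definition comb s c t := State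
  (fun x => s1 s x + c * s1 t x) (fun x => ds1 s x + c * ds1 t x)
  (fun x => dds1 s x + c * dds1 t x) (fun x => s2 s x + c * s2 t x)
  (fun x => ds2 s x + c * ds2 t x) (fun x => dds2 s x + c * dds2 t x).

Definition transmits s :=
  s2 s 0 = (D 1 2)^-1 * (D 2 3 * s1 s 0 + D 2 4 * ds1 s 0) /\
  ds2 s 0 = - (D 1 2)^-1 * (D 1 3 * s1 s 0 + D 1 4 * ds1 s 0).

(** An initial value problem: the data at [- pi] determine the solution, which [transmits] carries
    across 0. The boundary conditions are kept apart, in [bc1] and [bc2]. *)
Definition forward lam f1 f2 s := [/\ C2 (s1 s) (ds1 s) (dds1 s), C2 (s2 s) (ds2 s) (dds2 s),
  forall x, - pi <= x <= 0 -> - p1 * dds1 s x + q1 x * s1 s x = lam * s1 s x + f1 x,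
  forall x, 0 <= x <= pi -> - p2 * dds2 s x + q2 x * s2 s x = lam * s2 s x + f2 x &
  transmits s].

Definition bc1 s := ca * s1 s (- pi) + sa * ds1 s (- pi).
Definition bc2 s := cb * s2 s pi + sb * ds2 s pi.

Lemma C2_comb c (u du ddu v dv ddv : R -> R) : C2 u du ddu -> C2 v dv ddv ->
  C2 (fun x => u x + c * v x) (fun x => du x + c * dv x) (fun x => ddu x + c * ddv x).
Proof.
move=> [u1 u2 cu] [v1 v2 cv]; split; last exact: continuous_comb.
- exact: has_derivD u1 (has_derivZ c v1).
- exact: has_derivD u2 (has_derivZ c v2).
Qed.

Lemma forward_comb lam f1 f2 s g1 g2 t c : forward lam f1 f2 s -> forward lam g1 g2 t ->
  forward lam (fun x => f1 x + c * g1 x) (fun x => f2 x + c * g2 x) (comb s c t).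
Proof.
move=> [C1 C2' e1 e2 [t1 t2]] [C1' C2'' e1' e2' [t1' t2']]; split => /=.
- exact: C2_comb.
- exact: C2_comb.
- by move=> x xab; have := e1 x xab; have := e1' x xab; nra.
- by move=> x xab; have := e2 x xab; have := e2' x xab; nra.
- by rewrite /transmits /= t1 t2 t1' t2'; split; ring.
Qed.

Lemma forward_shift lam f1 f2 s : forward 0 f1 f2 s ->
  forward lam (fun x => f1 x + - lam * s1 s x) (fun x => f2 x + - lam * s2 s x) s.
Proof.
move=> [C1 C2' e1 e2 t]; split => // x xab; first by rewrite e1//; ring.
by rewrite e2//; ring.
Qed.

Lemma forward_exists lam f1 f2 c d : continuous f1 -> continuous f2 ->
  exists s, [/\ forward lam f1 f2 s, s1 s (- pi) = c & ds1 s (- pi) = d].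
Proof.
move=> cf1 cf2.
have ode (a b p : R) (q f : R -> R) (y z : R) : a <= b -> 0 < p -> continuous q -> continuous f ->
    exists u du ddu : R -> R, [/\ C2 u du ddu, u a = y, du a = z &
      forall x, a <= x <= b -> - p * ddu x + q x * u x = lam * u x + f x].
  move=> ab p0 cq cf.
  have cc : continuous (fun x => p^-1 * (q x + -1 * lam)).
    by apply: continuous_funZ; apply: continuous_comb => // x; exact: cvg_cst.
  have [u [du [ddu [C2u e ua dua]]]] :=
    linear_ode_exists y z ab cc (continuous_funZ (c := - p^-1) cf).
  exists u, du, ddu; split => // x xab; rewrite e//; field; exact: lt0r_neq0.
have [u1 [du1 [ddu1 [C1 u1a du1a e1]]]] := ode _ _ _ _ _ c d (ltW pi_neg) p1_gt0 cq1 cf1.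
have [u2 [du2 [ddu2 [C2' u2a du2a e2]]]] := ode _ _ _ _ _
  ((D 1 2)^-1 * (D 2 3 * u1 0 + D 2 4 * du1 0))
  (- (D 1 2)^-1 * (D 1 3 * u1 0 + D 1 4 * du1 0)) (ltW (pi_gt0 R)) p2_gt0 cq2 cf2.
by exists (State u1 du1 ddu1 u2 du2 ddu2).
Qed.

(** Gronwall's inequality after division by [p], with the integral of the squared source enlarged to
    the whole interval. The point is that [K] depends on neither the solution nor the source. *)
Lemma half_bound (a b p : R) (q : R -> R) lam : a <= b -> 0 < p -> continuous q ->
  exists2 K : R, 0 < K & forall (u du ddu f F : R -> R), C2 u du ddu ->
    (forall x, a <= x <= b -> - p * ddu x + q x * u x = lam * u x + f x) ->
    has_deriv F (fun x => f x * f x) ->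
    forall x, a <= x <= b ->
      u x ^+ 2 + du x ^+ 2 <= K * (u a ^+ 2 + du a ^+ 2 + (F b - F a)).
Proof.
move=> ab p0 cq; pose c x := p^-1 * (q x + -1 * lam).
have cc : continuous c.
  by apply: continuous_funZ; apply: continuous_comb => // x; exact: cvg_cst.
have [A A0 cA] := continuous_itv_bounded a b cc.
pose E := expR ((2 + A) * (b - a)).
have E0 : 0 < E by exact: expR_gt0.
have p2' : 0 < p^-1 ^+ 2 by rewrite exprn_gt0// invr_gt0.
exists (E * (1 + p^-1 ^+ 2)); first by rewrite mulr_gt0// addr_gt0.
move=> u du ddu f F C2u e dF x xab; have /andP[ax xb] := xab.
have e' y : a <= y <= b -> ddu y = c y * u y + - p^-1 * f y.
  move=> yab; rewrite (_ : ddu y = p^-1 * (q y * u y - (- p * ddu y + q y * u y))); last first.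
    by field; exact: lt0r_neq0.
  by rewrite e// /c; ring.
have dH : has_deriv (fun x => p^-1 ^+ 2 * F x) (fun x => (- p^-1 * f x) ^+ 2).
  by apply: (eq_has_deriv (has_derivZ _ dF)) => y; ring.
have := gronwall C2u cA e' dH xab.
move=> /le_trans; apply.
have Fx : 0 <= F x - F a.
  by rewrite subr_ge0; apply: (has_deriv_ge0_le dF ax) => y _; rewrite -expr2 sqr_ge0.
have Fb : F x <= F b.
  by apply: (has_deriv_ge0_le dF xb) => y _; rewrite -expr2 sqr_ge0.
have Ex : expR ((2 + A) * (x - a)) <= E.
  by rewrite ler_expR ler_wpM2l ?lerB//; lra.
rewrite -mulrA; apply: ler_pM; [exact: expR_ge0| |exact: Ex|].
  apply: addr_ge0; first by rewrite addr_ge0 ?sqr_ge0.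
  by rewrite -mulrBr mulr_ge0// ltW.
rewrite -mulrBr; set U := u a ^+ 2 + _.
have U0 : 0 <= U by rewrite addr_ge0 ?sqr_ge0.
have h1 : p^-1 ^+ 2 * (F x - F a) <= p^-1 ^+ 2 * (F b - F a).
  by rewrite ler_pM2l// lerB.
have h2 : 0 <= p^-1 ^+ 2 * U by rewrite mulr_ge0// ltW.
rewrite mulrDl mul1r mulrDr; lra.
Qed.

(** The bound on the left half controls the limits at [0-], the transmission conditions pass it to
    [0+], and these values are the initial data on the right half. The divisions by [w1] and [w2]
    undo the weights in [wdiff]. *)
Lemma zero_data_bound lam : exists2 K : R, 0 < K & forall f1 f2 F1 F2 s,
  forward lam f1 f2 s -> s1 s (- pi) = 0 -> ds1 s (- pi) = 0 ->
  has_deriv F1 (fun x => f1 x * f1 x) -> has_deriv F2 (fun x => f2 x * f2 x) ->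
  (forall x, - pi <= x <= 0 -> s1 s x ^+ 2 + ds1 s x ^+ 2 <= K * wdiff F1 F2) /\
  (forall x, 0 <= x <= pi -> s2 s x ^+ 2 + ds2 s x ^+ 2 <= K * wdiff F1 F2).
Proof.
have [K1 K10 K1P] := half_bound lam (ltW pi_neg) p1_gt0 cq1.
have [K2 K20 K2P] := half_bound lam (ltW (pi_gt0 R)) p2_gt0 cq2.
(* Twice the squared Frobenius norm of the transmission matrix. *)
pose T := 2 * (D 1 2)^-1 ^+ 2 * (D 2 3 ^+ 2 + D 2 4 ^+ 2 + D 1 3 ^+ 2 + D 1 4 ^+ 2).
have T0 : 0 <= T.
  apply: mulr_ge0; first by rewrite mulr_ge0// sqr_ge0.
  by rewrite !addr_ge0// sqr_ge0.
have w10 := w1_gt0; have w20 := w2_gt0.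
have a1 : 0 < K1 / w1 by exact: divr_gt0.
have a2 : 0 <= K2 * T * K1 / w1.
  by apply: divr_ge0; [apply: mulr_ge0; [apply: mulr_ge0|]|] => //; exact: ltW.
have a3 : 0 < K2 / w2 by exact: divr_gt0.
exists (K1 / w1 + K2 * T * K1 / w1 + K2 / w2).
  by lra.
move=> f1 f2 F1 F2 s [C1 C2' e1 e2 [t1 t2]] z1 z2 dF1 dF2.
have d1 : 0 <= F1 0 - F1 (- pi).
  by rewrite subr_ge0; apply: (has_deriv_ge0_le dF1 (ltW pi_neg)) => y _; rewrite -expr2 sqr_ge0.
have d2 : 0 <= F2 pi - F2 0.
  by rewrite subr_ge0; apply: (has_deriv_ge0_le dF2 (ltW (pi_gt0 R))) => y _; rewrite -expr2 sqr_ge0.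
have b1 x : - pi <= x <= 0 -> s1 s x ^+ 2 + ds1 s x ^+ 2 <= K1 * (F1 0 - F1 (- pi)).
  by move=> xI; have := K1P _ _ _ _ _ C1 e1 dF1 x xI; rewrite z1 z2 expr0n/= !add0r.
have at0 : s2 s 0 ^+ 2 + ds2 s 0 ^+ 2 <= T * (s1 s 0 ^+ 2 + ds1 s 0 ^+ 2).
  have cs (a b c d : R) : (a * c + b * d) ^+ 2 <= 2 * (a ^+ 2 + b ^+ 2) * (c ^+ 2 + d ^+ 2).
    have := sqr_ge0 (a * d - b * c); have := sqr_ge0 (a * c + b * d); nra.
  have i2 : 0 <= (D 1 2)^-1 ^+ 2 by exact: sqr_ge0.
  rewrite t1 t2 !exprMn sqrrN /T.
  have := ler_wpM2l i2 (cs (D 2 3) (D 2 4) (s1 s 0) (ds1 s 0)).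
  have := ler_wpM2l i2 (cs (D 1 3) (D 1 4) (s1 s 0) (ds1 s 0)).
  lra.
have b10 := b1 0 ltac:(by rewrite lexx (ltW pi_neg)).
have b2 x : 0 <= x <= pi -> s2 s x ^+ 2 + ds2 s x ^+ 2 <=
    K2 * T * K1 * (F1 0 - F1 (- pi)) + K2 * (F2 pi - F2 0).
  move=> xI; apply: (le_trans (K2P _ _ _ _ _ C2' e2 dF2 x xI)).
  rewrite (_ : _ + K2 * (F2 pi - F2 0) =
    K2 * (T * (K1 * (F1 0 - F1 (- pi))) + (F2 pi - F2 0))); last by ring.
  by rewrite ler_pM2l// lerD2r (le_trans at0)// ler_wpM2l.
set d := F1 0 - _ in d1 b1 b10 b2 *; set d' := F2 pi - _ in d2 b2 *.
have E : (K1 / w1 + K2 * T * K1 / w1 + K2 / w2) * wdiff F1 F2 =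
    K1 * d + K2 * T * K1 * d + K2 * d' + (K1 / w1 + K2 * T * K1 / w1) * (w2 * d') + K2 / w2 * (w1 * d).
  by rewrite /wdiff -/d -/d'; field; rewrite !lt0r_neq0.
have n1 : 0 <= K1 * d by rewrite mulr_ge0// ltW.
have n2 : 0 <= K2 * T * K1 * d.
  by apply: mulr_ge0 => //; apply: mulr_ge0; [apply: mulr_ge0 => //|]; exact: ltW.
have n3 : 0 <= K2 * d' by rewrite mulr_ge0// ltW.
have n4 : 0 <= (K1 / w1 + K2 * T * K1 / w1) * (w2 * d').
  by apply: mulr_ge0; [lra|apply: mulr_ge0 => //; exact: ltW].
have n5 : 0 <= K2 / w2 * (w1 * d).
  by apply: mulr_ge0; [exact: ltW|apply: mulr_ge0 => //; exact: ltW].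
rewrite E; split => x xI; first by apply: (le_trans (b1 x xI)); lra.
by apply: (le_trans (b2 x xI)); lra.
Qed.

Lemma forward_zero lam s : forward lam (fun=> 0) (fun=> 0) s ->
  s1 s (- pi) = 0 -> ds1 s (- pi) = 0 ->
  (forall x, - pi <= x <= 0 -> s1 s x = 0 /\ ds1 s x = 0) /\
  (forall x, 0 <= x <= pi -> s2 s x = 0 /\ ds2 s x = 0).
Proof.
move=> fs z1 z2; have [K K0 KP] := zero_data_bound lam.
have d0 : has_deriv (fun=> 0 : R) (fun x : R => 0 * 0 : R).
  by apply: (eq_has_deriv (has_deriv_cst 0)) => x; rewrite mul0r.
have [b1 b2] := KP _ _ _ _ s fs z1 z2 d0 d0.
have sq0 (a b : R) : a ^+ 2 + b ^+ 2 <= K * wdiff (fun=> 0) (fun=> 0) -> a = 0 /\ b = 0.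
  rewrite /wdiff !subrr !mulr0 addr0 mulr0 => ab.
  have := sqr_ge0 a; have := sqr_ge0 b => a0 b0.
  by split; apply/eqP; rewrite -sqrf_eq0; apply/eqP; lra.
by split => x xI; apply: sq0; [exact: b1|exact: b2].
Qed.

(* The pair [phi_1], [phi_2] of the paper, for a real parameter. *)
Definition regular lam s := [/\ forward lam (fun=> 0) (fun=> 0) s,
  s1 s (- pi) = sa & ds1 s (- pi) = - ca].

(** The kernel of the form [(ca, sa)] is the line spanned by the unit vector [(sa, - ca)], and [k]
    is the coordinate on it. *)
Lemma bc1_regular s : bc1 s = 0 -> exists k, s1 s (- pi) = k * sa /\ ds1 s (- pi) = k * - ca.
Proof.
rewrite /bc1 => h; exists (sa * s1 s (- pi) - ca * ds1 s (- pi)).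
have one := cos2Dsin2 (bv_alpha P).
set y := s1 s (- pi) in h *; set z := ds1 s (- pi) in h *.
have e1 : sa * (ca * y + sa * z) = 0 by rewrite h mulr0.
have e2 : ca * (ca * y + sa * z) = 0 by rewrite h mulr0.
split.
  transitivity (y * (ca ^+ 2 + sa ^+ 2)); first by rewrite one mulr1.
  by lra.
transitivity (z * (ca ^+ 2 + sa ^+ 2)); first by rewrite one mulr1.
by lra.
Qed.

(** Simplicity of the eigenvalues: subtracting the multiple of [phi] with the same data at [- pi]
    leaves a solution with zero data. *)
Lemma regular_multiple lam phi s : regular lam phi -> forward lam (fun=> 0) (fun=> 0) s ->
  bc1 s = 0 -> exists k, (forall x, - pi <= x <= 0 -> s1 s x = k * s1 phi x /\ ds1 s x = k * ds1 phi x) /\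
    (forall x, 0 <= x <= pi -> s2 s x = k * s2 phi x /\ ds2 s x = k * ds2 phi x).
Proof.
move=> [fphi y z] fs /bc1_regular[k [y' z']]; exists k.
have := forward_comb (- k) fs fphi.
rewrite (_ : (fun x => 0 + - k * 0) = (fun=> 0 : R)); last by apply/funext => x; rewrite mulr0 addr0.
move=> /forward_zero; rewrite /= y z y' z' => /(_ _ _)[||h1 h2]; [ring|ring|].
have sub (a b : R) : a + - k * b = 0 -> a = k * b by move=> h; lra.
by split => x xI; [have [/sub -> /sub ->] := h1 x xI|have [/sub -> /sub ->] := h2 x xI].
Qed.

(* Graph of the operator [- p u'' + q u] on the domain given by the boundary and
   transmission conditions. *)
Definition L u f := exists s f1 f2, [/\ continuous f1 /\ continuous f2,
  agree u (s1 s) (s2 s), agree f f1 f2, forward 0 f1 f2 s & bc1 s = 0 /\ bc2 s = 0].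

Lemma L_pw u f : L u f -> pw_continuous u /\ pw_continuous f.
Proof.
move=> [s [f1 [f2 [[cf1 cf2] au af [[u1 _ _] [u2 _ _] _ _ _] _]]]]; split.
  by exists (s1 s), (s2 s); split => //; [exact: has_deriv_continuous u1|exact: has_deriv_continuous u2].
by exists f1, f2.
Qed.

Lemma L_lin u v f g c : L u f -> L v g -> L (fun x => u x + c * v x) (fun x => f x + c * g x).
Proof.
move=> [s [f1 [f2 [[cf1 cf2] au af fs [b1 b2]]]]] [t [g1 [g2 [[cg1 cg2] av ag ft [b1' b2']]]]].
exists (comb s c t), (fun x => f1 x + c * g1 x), (fun x => f2 x + c * g2 x); split.
- by split; exact: continuous_comb.
- exact: agreeD.
- exact: agreeD.
- exact: forward_comb.
- move: b1 b2 b1' b2'; rewrite /bc1 /bc2 /= => b1 b2 b1' b2'; split; last first.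
    rewrite -[RHS](addr0 0) -{1}b2 -(mulr0 c) -b2'; ring.
  rewrite -[RHS](addr0 0) -{1}b1 -(mulr0 c) -b1'; ring.
Qed.

(* Lagrange's identity: the Wronskian vanishes at both ends, and by the Plucker
   relation the weights balance its two one-sided values at [0]. *)
Lemma L_sym u v f g : L u f -> L v g -> ip u g = ip f v.
Proof.
move=> [s [f1 [f2 [[cf1 cf2] au af [[du1 ddu1 _] [du2 ddu2 _] e1 e2 [t1 t2]] [b1 b2]]]]].
move=> [t [g1 [g2 [[cg1 cg2] av ag [[dv1 ddv1 _] [dv2 ddv2 _] e1' e2' [t1' t2']] [b1' b2']]]]].
have cu1 := has_deriv_continuous du1; have cu2 := has_deriv_continuous du2.
have cv1 := has_deriv_continuous dv1; have cv2 := has_deriv_continuous dv2.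
have [A1 dA1 _] := antiderivative 0 0 (continuous_funM cu1 cg1).
have [A2 dA2 _] := antiderivative 0 0 (continuous_funM cu2 cg2).
have [B1 dB1 _] := antiderivative 0 0 (continuous_funM cf1 cv1).
have [B2 dB2 _] := antiderivative 0 0 (continuous_funM cf2 cv2).
rewrite /ip (wint_FTC (agreeM au ag) (continuous_funM cu1 cg1) (continuous_funM cu2 cg2) dA1 dA2).
rewrite (wint_FTC (agreeM af av) (continuous_funM cf1 cv1) (continuous_funM cf2 cv2) dB1 dB2).
have W (y dy ddy z dz ddz : R -> R) : has_deriv y dy -> has_deriv dy ddy ->
    has_deriv z dz -> has_deriv dz ddz ->
    has_deriv (fun x => dy x * z x - y x * dz x) (fun x => ddy x * z x - y x * ddz x).
  move=> h1 h2 h3 h4; apply: (eq_has_deriv (has_derivB (has_derivM h2 h3) (has_derivM h1 h4))).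
  by move=> x; ring.
have W1 := has_derivZ p1 (W _ _ _ _ _ _ du1 ddu1 dv1 ddv1).
have W2 := has_derivZ p2 (W _ _ _ _ _ _ du2 ddu2 dv2 ddv2).
have i1 := has_deriv_eq_eq W1 (has_derivB dA1 dB1) (ltW pi_neg).
have {}i1 := i1 ltac:(move=> x xI; have := e1 x xI; have := e1' x xI; rewrite !mul0r !add0r => <- <-; ring).
have i2 := has_deriv_eq_eq W2 (has_derivB dA2 dB2) (ltW (pi_gt0 R)).
have {}i2 := i2 ltac:(move=> x xI; have := e2 x xI; have := e2' x xI; rewrite !mul0r !add0r => <- <-; ring).
(* Two vectors annihilated by the same unit form are parallel, so their determinant, here the
   Wronskian at an end point, is 0. *)
have wr0 (c d y z y' z' : R) : c ^+ 2 + d ^+ 2 = 1 -> c * y + d * z = 0 -> c * y' + d * z' = 0 ->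
    z * y' - y * z' = 0.
  move=> one h h'.
  have k1 : d * (z * y' - y * z') = 0.
    transitivity ((c * y + d * z) * y' - y * (c * y' + d * z')); first by ring.
    by rewrite h h' mul0r mulr0 subrr.
  have k2 : c * (z * y' - y * z') = 0.
    transitivity (z * (c * y' + d * z') - (c * y + d * z) * z'); first by ring.
    by rewrite h h' mul0r mulr0 subrr.
  transitivity ((c ^+ 2 + d ^+ 2) * (z * y' - y * z')); first by rewrite one mul1r.
  transitivity (c * (c * (z * y' - y * z')) + d * (d * (z * y' - y * z'))); first by ring.
  by rewrite k1 k2 !mulr0 addr0.
have z1 := wr0 _ _ _ _ _ _ (cos2Dsin2 _) b1 b1'.
have z2 := wr0 _ _ _ _ _ _ (cos2Dsin2 _) b2 b2'.
have jump : D 1 2 * (ds2 s 0 * s2 t 0 - s2 s 0 * ds2 t 0) =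
    D 3 4 * (ds1 s 0 * s1 t 0 - s1 s 0 * ds1 t 0).
  rewrite t1 t2 t1' t2'.
  transitivity ((D 1 2)^-1 * (D 1 3 * D 2 4 - D 1 4 * D 2 3) * (ds1 s 0 * s1 t 0 - s1 s 0 * ds1 t 0)).
    by field; exact: lt0r_neq0.
  by rewrite -plucker mulKf// lt0r_neq0.
apply/eqP; rewrite -subr_eq0; apply/eqP.
transitivity (D 3 4 / p1 * ((A1 0 - B1 0) - (A1 (- pi) - B1 (- pi))) +
  D 1 2 / p2 * ((A2 pi - B2 pi) - (A2 0 - B2 0))).
  by rewrite /wdiff /w1 /w2; ring.
rewrite -i1 -i2 z1 z2 !mulr0 subr0 sub0r mulrN !mulrA !divfK ?lt0r_neq0// jump.
by rewrite subrr.
Qed.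

(** * Bounds for the operator and its inverse *)

Definition glue s : R -> R := piecewise (s1 s) (s2 s).

Lemma piecewise_agree (f1 f2 : R -> R) : agree (piecewise f1 f2) f1 f2.
Proof.
split=> x; rewrite /Jminus /Jplus /piecewise /= in_itv/= => /andP[h1 h2]; first by rewrite h2.
by rewrite ltNge (ltW h1).
Qed.

Lemma eq_wint f g : (forall x, J x -> f x = g x) -> wint f = wint g.
Proof.
move=> fg; congr (_ * _ + _ * _); apply: eq_Rintegral => x /set_mem Jx; apply: fg;
  [by left|by right].
Qed.

Lemma wint_ge0 f : (forall x, J x -> 0 <= f x) -> 0 <= wint f.
Proof.
move=> f0; apply: addr_ge0; apply: mulr_ge0; rewrite ?(ltW w1_gt0) ?(ltW w2_gt0)//;
  apply: Rintegral_ge0 => x Jx; apply: f0; [by left|by right].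
Qed.

Lemma pw_semi_inner : semi_inner pw_continuous ip.
Proof.
split.
- exact: pw_continuous_cst.
- by move=> f g c; exact: pw_continuousD.
- by move=> f g; apply: eq_wint => x _; rewrite mulrC.
- move=> f g h c pf pg ph; rewrite /ip -wint_lin; [|exact: pw_continuousM..].
  by apply: eq_wint => x _; ring.
- by move=> f pf; apply: wint_ge0 => x _; rewrite -expr2 sqr_ge0.
Qed.

Lemma ip_le u B : pw_continuous u -> (forall x, J x -> u x ^+ 2 <= B) ->
  ip u u <= B * total_weight.
Proof. by move=> pu uB; apply: wint_le => [|x Jx]; [exact: pw_continuousM|rewrite -expr2 uB]. Qed.

Lemma J_cases x : J x -> (Jminus x /\ - pi <= x <= 0) \/ (Jplus x /\ 0 <= x <= pi).
Proof.
case=> Jx; [left|right]; split => //; move: Jx; rewrite /Jminus /Jplus /= in_itv/=.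
  by move=> /andP[-> /ltW].
by move=> /andP[/ltW -> ->].
Qed.

Lemma forward_continuous lam f1 f2 s : forward lam f1 f2 s ->
  continuous (s1 s) /\ continuous (s2 s).
Proof.
by move=> [[u1 _ _] [u2 _ _] _ _ _]; split; [exact: has_deriv_continuous u1|exact: has_deriv_continuous u2].
Qed.

Lemma glue_pw lam f1 f2 s : forward lam f1 f2 s -> pw_continuous (glue s).
Proof.
move=> fs; have [c1 c2] := forward_continuous fs.
by exists (s1 s), (s2 s); split => //; exact: piecewise_agree.
Qed.

Lemma pw_bounded f : pw_continuous f -> exists2 B : R, 0 < B & forall x, J x -> f x ^+ 2 <= B.
Proof.
move=> [f1 [f2 [cf1 cf2 [a1 a2]]]].
have [B1 B10 B1P] := continuous_itv_bounded (- pi) 0 cf1.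
have [B2 B20 B2P] := continuous_itv_bounded 0 pi cf2.
have e1 := exprn_gt0 2 B10; have e2 := exprn_gt0 2 B20.
exists (B1 ^+ 2 + B2 ^+ 2); first by lra.
move=> x /J_cases[[Jx xI]|[Jx xI]].
  have : f1 x ^+ 2 <= B1 ^+ 2.
    by rewrite -real_normK ?num_real// ler_pXn2r ?nnegrE ?B1P// ltW.
  by rewrite a1//; lra.
have : f2 x ^+ 2 <= B2 ^+ 2.
  by rewrite -real_normK ?num_real// ler_pXn2r ?nnegrE ?B2P// ltW.
by rewrite a2//; lra.
Qed.

(* [v] solves the inhomogeneous equation with zero data at [- pi] and [b] is the
   value of its second boundary form. *)
Lemma regular_decomposition lam phi : regular lam phi -> exists2 K : R, 0 < K &
  forall u f, L u f -> exists k b v, [/\ pw_continuous v,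
    forall x, J x -> u x = v x + k * glue phi x,
    forall x, J x -> v x ^+ 2 <= K * ip (fun x => f x + - lam * u x) (fun x => f x + - lam * u x),
    b ^+ 2 <= K * ip (fun x => f x + - lam * u x) (fun x => f x + - lam * u x) &
    b + k * bc2 phi = 0].
Proof.
move=> [fphi y z]; have [K K0 KP] := zero_data_bound lam; exists K => // u f.
move=> [s [f1 [f2 [[cf1 cf2] au af fs [b1 b2]]]]].
have [k [y' z']] := bc1_regular b1.
set g := fun x => f x + - lam * u x.
pose g1 x := f1 x + - lam * s1 s x; pose g2 x := f2 x + - lam * s2 s x.
have [cs1 cs2] := forward_continuous fs.
have cg1 : continuous g1 by exact: continuous_comb.
have cg2 : continuous g2 by exact: continuous_comb.
have ag : agree g g1 g2 by exact: agreeD.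
have [G1 dG1 _] := antiderivative 0 0 (continuous_funM cg1 cg1).
have [G2 dG2 _] := antiderivative 0 0 (continuous_funM cg2 cg2).
have gg : ip g g = wdiff G1 G2.
  exact: wint_FTC (agreeM ag ag) (continuous_funM cg1 cg1) (continuous_funM cg2 cg2) dG1 dG2.
pose v := comb s (- k) phi.
have fv : forward lam g1 g2 v.
  have := forward_comb (- k) (forward_shift lam fs) fphi; congr forward;
    by apply/funext => x; rewrite mulr0 addr0.
have v1 : s1 v (- pi) = 0 by rewrite /= y y'; ring.
have v2 : ds1 v (- pi) = 0 by rewrite /= z z'; ring.
have [h1 h2] := KP _ _ _ _ _ fv v1 v2 dG1 dG2; rewrite -gg in h1 h2.
have [a1 a2] := piecewise_agree (s1 v) (s2 v).
have [c1 c2] := piecewise_agree (s1 phi) (s2 phi).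
exists k, (bc2 v), (glue v); split.
- exact: glue_pw fv.
- move=> x /J_cases[[Jx _]|[Jx _]].
    by rewrite /glue a1// c1// au.1//= mulNr subrK.
  by rewrite /glue a2// c2// au.2//= mulNr subrK.
- move=> x /J_cases[[Jx xI]|[Jx xI]].
    by rewrite /glue a1//; have := h1 x xI; have := sqr_ge0 (ds1 v x); lra.
  by rewrite /glue a2//; have := h2 x xI; have := sqr_ge0 (ds2 v x); lra.
- have := h2 pi ltac:(by rewrite lexx pi_ge0); apply: le_trans.
  rewrite /bc2; set Y := s2 v pi; set Z := ds2 v pi.
  have := cos2Dsin2 (bv_beta P) => one.
  have <- : (cb * Y + sb * Z) ^+ 2 + (cb * Z - sb * Y) ^+ 2 = Y ^+ 2 + Z ^+ 2.
    transitivity ((cb ^+ 2 + sb ^+ 2) * (Y ^+ 2 + Z ^+ 2)); first by ring.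
    by rewrite one mul1r.
  by rewrite lerDl sqr_ge0.
- by move: b2; rewrite /bc2 /=; lra.
Qed.

(** If [bc2 phi] is not 0, the second boundary condition determines the multiple [k] of [phi] in the
    decomposition and bounds [k^2]. *)
Lemma nonresonant_bound lam phi : regular lam phi -> bc2 phi != 0 ->
  exists2 M : R, 0 < M & forall u f, L u f -> forall x, J x ->
    u x ^+ 2 <= M * ip (fun x => f x + - lam * u x) (fun x => f x + - lam * u x).
Proof.
move=> rphi w0; have [K K0 KP] := regular_decomposition rphi.
have [fphi _ _] := rphi; have [B B0 BP] := pw_bounded (glue_pw fphi).
have w2' : 0 < bc2 phi ^+ 2 by rewrite exprn_even_gt0//= w0.
exists (2 * K + 2 * (K / bc2 phi ^+ 2) * B).
  by rewrite addr_gt0// !mulr_gt0// invr_gt0.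
move=> u f Luf x Jx; have [k [b [v [pv uv vK bK bk]]]] := KP u f Luf.
set I := ip _ _ in vK bK *.
have k2 : k ^+ 2 <= K / bc2 phi ^+ 2 * I.
  rewrite mulrAC ler_pdivlMr// (_ : k ^+ 2 * _ = b ^+ 2)//.
  have -> : b = - (k * bc2 phi) by lra.
  by ring.
have k2B : k ^+ 2 * glue phi x ^+ 2 <= K / bc2 phi ^+ 2 * I * B.
  by rewrite ler_pM ?sqr_ge0 ?BP.
rewrite uv//; have := vK x Jx; have := sqr_ge0 (v x - k * glue phi x).
lra.
Qed.

(** Here [k] is not bounded by the boundary condition. Orthogonality replaces it: [u] is the
    projection of [v] orthogonal to [phi], so its norm is at most that of [v]. *)
Lemma resonant_gap lam phi : regular lam phi -> 0 < ip (glue phi) (glue phi) ->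
  exists2 M : R, 0 < M & forall u f, L u f -> ip u (glue phi) = 0 ->
    ip u u <= M * ip (fun x => f x + - lam * u x) (fun x => f x + - lam * u x).
Proof.
move=> rphi n0; have [K K0 KP] := regular_decomposition rphi.
have [fphi _ _] := rphi; have pphi := glue_pw fphi.
exists (K * total_weight); first by rewrite mulr_gt0 ?total_weight_gt0.
move=> u f Luf uphi; have [k [b [v [pv uv vK _ _]]]] := KP u f Luf.
set I := ip _ _ in vK *.
have e1 : ip u (glue phi) = ip v (glue phi) + k * ip (glue phi) (glue phi).
  rewrite -(siDl pw_semi_inner)//; apply: eq_wint => x Jx; by rewrite uv.
have e2 : ip u u = ip v v + 2 * k * ip v (glue phi) + k ^+ 2 * ip (glue phi) (glue phi).
  rewrite -(ip_sqD pw_semi_inner)//; apply: eq_wint => x Jx; by rewrite uv.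
have h : ip v v <= K * I * total_weight by exact: ip_le.
have k0 : 0 <= k ^+ 2 * ip (glue phi) (glue phi) by rewrite mulr_ge0 ?sqr_ge0// ltW.
have e3 : ip v (glue phi) = - (k * ip (glue phi) (glue phi)) by lra.
by rewrite mulrAC; move: h k0; rewrite e2 e3; lra.
Qed.

(** The antiderivatives of the squared pieces are monotone and do not grow over the intervals, so
    they are constant and their derivatives vanish. *)
Lemma ip_definite f : pw_continuous f -> ip f f <= 0 -> forall x, J x -> f x = 0.
Proof.
move=> [f1 [f2 [c1 c2 a]]].
have [F1 dF1 _] := antiderivative 0 0 (continuous_funM c1 c1).
have [F2 dF2 _] := antiderivative 0 0 (continuous_funM c2 c2).
rewrite /ip (wint_FTC (agreeM a a) (continuous_funM c1 c1) (continuous_funM c2 c2) dF1 dF2).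
have le_diff (F k : R -> R) b c : has_deriv F (fun x => k x * k x) -> b <= c -> F b <= F c.
  by move=> dF bc; apply: (has_deriv_ge0_le dF bc) => x _; rewrite -expr2 sqr_ge0.
have zero (F k : R -> R) b c : b < c -> continuous k -> has_deriv F (fun x => k x * k x) ->
    F c - F b <= 0 -> forall x, b <= x <= c -> k x = 0.
  move=> bc ck dF Fbc.
  have dF' : has_deriv (fun x => F x - F b) (fun x => k x * k x).
    by apply: (eq_has_deriv (has_derivB dF (has_deriv_cst (F b)))) => x; rewrite subr0.
  have F0 x : b < x < c -> F x - F b = 0.
    move=> /andP[/ltW h1 /ltW h2].
    by have := le_diff _ _ _ _ dF h1; have := le_diff _ _ _ _ dF h2; lra.
  move=> x /(has_deriv_vanish bc dF' (continuous_funM ck ck) F0)[_ /eqP].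
  by rewrite mulf_eq0 orbb => /eqP.
rewrite /wdiff => le0.
have l1 : 0 <= w1 * (F1 0 - F1 (- pi)).
  apply: mulr_ge0; first exact: ltW w1_gt0.
  by rewrite subr_ge0; exact: le_diff dF1 (ltW pi_neg).
have l2 : 0 <= w2 * (F2 pi - F2 0).
  apply: mulr_ge0; first exact: ltW w2_gt0.
  by rewrite subr_ge0; exact: le_diff dF2 (pi_ge0 R).
have m1 : F1 0 - F1 (- pi) <= 0.
  by rewrite -(pmulr_rle0 _ w1_gt0); lra.
have m2 : F2 pi - F2 0 <= 0.
  by rewrite -(pmulr_rle0 _ w2_gt0); lra.
move=> x /J_cases[[Jx xI]|[Jx xI]]; first by rewrite a.1// (zero _ _ _ _ pi_neg c1 dF1 m1).
by rewrite a.2// (zero _ _ _ _ (pi_gt0 R) c2 dF2 m2).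
Qed.

(** Otherwise [phi] and its derivative would vanish at [- pi], where they are [sa] and [- ca]. *)
Lemma regular_norm_gt0 lam phi : regular lam phi -> 0 < ip (glue phi) (glue phi).
Proof.
move=> [fphi y z]; rewrite ltNge; apply/negP => /(ip_definite (glue_pw fphi)) phi0.
have [[d1 dd1 cdd1] _ _ _ _] := fphi.
have s0 x : - pi < x < 0 -> s1 phi x = 0.
  move=> /andP[h1 h2]; have Jx : Jminus x by rewrite /Jminus /= in_itv/= (ltW h1).
  by have <- := (piecewise_agree (s1 phi) (s2 phi)).1 x Jx; apply: phi0; left.
have pi_itv : - pi <= (- pi : R) <= 0 by apply/andP; split=> //; exact: ltW pi_neg.
have [] := has_deriv_vanish pi_neg d1 (has_deriv_continuous dd1) s0 pi_itv.
rewrite y z => sa0 ca0.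
have := cos2Dsin2 (bv_alpha P); rewrite sa0; move/eqP: ca0; rewrite oppr_eq0 => /eqP ->.
by rewrite expr0n/= addr0 => /eqP; rewrite eq_sym oner_eq0.
Qed.

(** Shooting: the solution with zero data at [- pi] is corrected by the multiple of [phi] that
    satisfies the condition at [pi]. *)
Lemma L_exists phi f : regular 0 phi -> bc2 phi != 0 -> pw_continuous f -> exists u, L u f.
Proof.
move=> [fphi y z] w0 [f1 [f2 [cf1 cf2 af]]].
have [v [fv v1 v2]] := forward_exists 0 0 0 cf1 cf2.
pose k := - bc2 v / bc2 phi; pose s := comb v k phi.
exists (glue s), s, f1, f2; split => //.
- exact: piecewise_agree.
- by have := forward_comb k fv fphi; congr forward; apply/funext => x; rewrite mulr0 addr0.
- split; first by rewrite /bc1 /= y z v1 v2; ring.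
  by rewrite /bc2 /= -/(bc2 phi) /k /bc2; field.
Qed.

Lemma L_regular lam phi : regular lam phi -> bc2 phi = 0 ->
  L (glue phi) (fun x => lam * glue phi x).
Proof.
move=> [fphi y z] w0; have [c1 c2] := forward_continuous fphi.
have [a1 a2] := piecewise_agree (s1 phi) (s2 phi).
exists phi, (fun x => lam * s1 phi x), (fun x => lam * s2 phi x); split => //.
- by split; exact: continuous_funZ.
- by split => x Jx; rewrite /glue; [rewrite a1|rewrite a2].
- have [C1 C2' e1 e2 t] := fphi; split => // x xI; first by rewrite e1//; ring.
  by rewrite e2//; ring.
- by split => //; rewrite /bc1 y z; ring.
Qed.

Lemma L_vanishing (u1 u2 : R -> R) : C2_vanishing (- pi) 0 u1 -> C2_vanishing 0 pi u2 ->
  exists g, L (piecewise u1 u2) g.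
Proof.
move=> [du1 [ddu1 [C1 a1 b1 c1 d1]]] [du2 [ddu2 [C2' a2 b2 c2 d2]]].
pose f1 x := - p1 * ddu1 x + q1 x * u1 x; pose f2 x := - p2 * ddu2 x + q2 x * u2 x.
have cf (p : R) (q u du ddu : R -> R) : continuous q -> C2 u du ddu ->
    continuous (fun x => - p * ddu x + q x * u x).
  move=> cq [h1 _ cddu]; apply: continuous_funD; first exact: continuous_funZ.
  by apply: continuous_funM => //; exact: has_deriv_continuous h1.
exists (piecewise f1 f2), (State u1 du1 ddu1 u2 du2 ddu2), f1, f2; split.
- by split; [exact: cf C1|exact: cf C2'].
- exact: piecewise_agree.
- exact: piecewise_agree.
- split => //= [x xI|x xI|]; first by rewrite /f1; ring.
    by rewrite /f2; ring.
  by rewrite /transmits /= a2 b2 c1 d1 !(mulr0, addr0).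
- by rewrite /bc1 /bc2 /= a1 b1 c2 d2 !(mulr0, addr0).
Qed.

(** * The square integrable functions and the density of the domain *)

Definition sq_space f := sq_integrable mu Jminus f /\ sq_integrable mu Jplus f.

Let mJminus : measurable (Jminus : set (caratheodory_type (wlength (@idfun R))^*%mu)).
Proof. by apply: completed_measurable; exact: measurable_itv. Qed.

Let mJplus : measurable (Jplus : set (caratheodory_type (wlength (@idfun R))^*%mu)).
Proof. by apply: completed_measurable; exact: measurable_itv. Qed.

Lemma sq_space_semi_inner : semi_inner sq_space ip.
Proof.
have siM := sq_semi_inner mJminus; have siP := sq_semi_inner mJplus; split.
- by split; [exact: si0 siM|exact: si0 siP].
- by move=> f g c [f1 f2] [g1 g2]; split; [exact: siD siM _ _ _ f1 g1|exact: siD siP _ _ _ f2 g2].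
- by move=> f g; apply: eq_wint => x _; rewrite mulrC.
- move=> f g h c [f1 f2] [g1 g2] [h1 h2].
  have := siDl siM c f1 g1 h1; have := siDl siP c f2 g2 h2.
  by rewrite /ip /wint /ip_on => -> ->; ring.
- by move=> f _; apply: wint_ge0 => x _; rewrite -expr2 sqr_ge0.
Qed.

Lemma sq_integrable_eq (i : interval R) f g : sq_integrable mu [set` i] f ->
  (forall x, [set` i] x -> f x = g x) -> sq_integrable mu [set` i] g.
Proof.
move=> [mf f2] fg; split.
  by apply: eq_measurable_fun mf => x /set_mem; exact: fg.
apply: eq_integrable f2; first by apply: completed_measurable; exact: measurable_itv.
by move=> x /set_mem xi; rewrite fg.
Qed.

Lemma pw_sq_space : pw_continuous `<=` sq_space.
Proof.
move=> f [f1 [f2 [cf1 cf2 [a1 a2]]]]; split.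
  apply: (sq_integrable_eq (f := f1)) => [|x Jx]; last by rewrite a1.
  apply: (continuous_sq_integrable _ (half_open_sub _).2 cf1) => //.
  by left.
apply: (sq_integrable_eq (f := f2)) => [|x Jx]; last by rewrite a2.
apply: (continuous_sq_integrable _ (half_open_sub _).2 cf2) => //.
by right.
Qed.

Lemma L_dense f (r : R) : sq_space f -> 0 < r -> exists u g, L u g /\
  ip (fun x => f x + -1 * u x) (fun x => f x + -1 * u x) < r.
Proof.
move=> [f1 f2] r0; have w10 := w1_gt0; have w20 := w2_gt0.
have [u1 V1 r1] := sq_dense (i := `[- pi, 0[%R) pi_neg (or_introl erefl) f1
  (divr_gt0 r0 (mulr_gt0 (ltr0n R 2) w10)).
have [u2 V2 r2] := sq_dense (i := `]0, pi]%R) (pi_gt0 R) (or_intror erefl) f2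
  (divr_gt0 r0 (mulr_gt0 (ltr0n R 2) w20)).
have [g Lg] := L_vanishing V1 V2.
exists (piecewise u1 u2), g; split => //.
have [a1 a2] := piecewise_agree u1 u2.
have -> : ip (fun x => f x + -1 * piecewise u1 u2 x) (fun x => f x + -1 * piecewise u1 u2 x) =
    w1 * ip_on Jminus (fun x => f x + -1 * u1 x) (fun x => f x + -1 * u1 x) +
    w2 * ip_on Jplus (fun x => f x + -1 * u2 x) (fun x => f x + -1 * u2 x).
  by congr (_ * _ + _ * _); apply: eq_Rintegral => x /set_mem Jx; [rewrite a1|rewrite a2].
have w1' : 0 < 2 * w1 by lra.
have w2' : 0 < 2 * w2 by lra.
move: r1 r2; rewrite !ltr_pdivlMr// /Jminus /Jplus; lra.
Qed.

End RealProblem.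

(** * Eigenvalues *)

Section ComplexProblem.
Context {R : realType} (P : bvtp R) (q1 q2 : R -> R).
Notation p1 := (bv_p1 P).
Notation p2 := (bv_p2 P).
Notation D := (Delta P).
Local Notation ReC := (@complex.Re R).
Local Notation ImC := (@complex.Im R).
Hypothesis p1_gt0 : 0 < p1.
Hypothesis p2_gt0 : 0 < p2.
Hypothesis D12_gt0 : 0 < D 1 2.
Hypothesis D34_gt0 : 0 < D 3 4.
Hypothesis cq1 : continuous q1.
Hypothesis cq2 : continuous q2.
Hypothesis q1E : forall x, Jminus x -> bv_q P x = q1 x.
Hypothesis q2E : forall x, Jplus x -> bv_q P x = q2 x.
Implicit Types (x c lam : R) (s : @state R).

Lemma ReImZ c (z : R[i]) : c%:C * z = (c * ReC z) +i* (c * ImC z).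
Proof. by case: z => a b; apply/eqP; rewrite eq_complex /= !mul0r subr0 addr0 !eqxx. Qed.

Lemma ReImD (z w : R[i]) : z + w = (ReC z + ReC w) +i* (ImC z + ImC w).
Proof. by case: z w => [a b] [c d]. Qed.

Lemma Tmx_entries (i : 'I_2) : [/\ Tmx P i (inord 0) = bv_bplus P i 0,
  Tmx P i (inord 1) = bv_bplus P i 1, Tmx P i (inord 2) = bv_bminus P i 0 &
  Tmx P i (inord 3) = bv_bminus P i 1].
Proof.
rewrite /Tmx; split.
- rewrite -[RHS](row_mxEl _ (bv_bminus P)); congr fun_of_matrix.
  by apply/val_inj; rewrite /= inordK.
- rewrite -[RHS](row_mxEl _ (bv_bminus P)); congr fun_of_matrix.
  by apply/val_inj; rewrite /= inordK.
- rewrite -[RHS](row_mxEr (bv_bplus P)); congr fun_of_matrix.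
  by apply/val_inj; rewrite /= inordK.
- rewrite -[RHS](row_mxEr (bv_bplus P)); congr fun_of_matrix.
  by apply/val_inj; rewrite /= inordK.
Qed.

(* The real transmission conditions, solved for the right limits by Cramer's
   rule. *)
Definition rtransmits (um dum up dup : R) := up = (D 1 2)^-1 * (D 2 3 * um + D 2 4 * dum) /\
  dup = - (D 1 2)^-1 * (D 1 3 * um + D 1 4 * dum).

Lemma rtransmitsP (um dum up dup : R) :
  (forall i : 'I_2, bv_bminus P i 1 * dum + bv_bminus P i 0 * um +
    bv_bplus P i 1 * dup + bv_bplus P i 0 * up = 0) <-> rtransmits um dum up dup.
Proof.
have [a0 a1 a2 a3] := Tmx_entries 0; have [b0 b1 b2 b3] := Tmx_entries 1.
have D12n0 : D 1 2 != 0 by exact: lt0r_neq0.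
rewrite /rtransmits; move: D12n0; rewrite !DeltaE /= a0 a1 a2 a3 b0 b1 b2 b3 => D12n0.
split => [h|[-> ->] i].
  have h0 := h 0; have h1 := h 1.
  split; apply: (mulfI D12n0); [rewrite mulVKf//|rewrite mulNr mulrN mulVKf//].
    apply/eqP; rewrite -subr_eq0; apply/eqP; rewrite -[RHS](subr0 0).
    rewrite -{1}(mulr0 (bv_bplus P 1 1)) -{1}h0 -(mulr0 (bv_bplus P 0 1)) -h1; ring.
  apply/eqP; rewrite -subr_eq0; apply/eqP; rewrite -[RHS](subr0 0).
  rewrite -{1}(mulr0 (bv_bplus P 0 0)) -{1}h1 -(mulr0 (bv_bplus P 1 0)) -h0; ring.
have [->|->] : i = 0 \/ i = 1; last 2 first.
- by field.
- by field.
by case: i => -[|[|//]] ?; [left|right]; exact/val_inj.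
Qed.

(** The real and imaginary parts are coupled through the imaginary part of [lam], and the coupling
    is treated as a source term. The two halves are separate functions so that the lemma serves
    [phi1], [phi2] as well as an eigenfunction. *)
Lemma solution_state (lam : R[i]) (u1 du1 u2 du2 : R -> R[i]) (um dum up dup : R[i]) :
  solution_on P Jminus lam u1 du1 -> solution_on P Jplus lam u2 du2 ->
  left_lim0 u1 um -> left_lim0 du1 dum -> right_lim0 u2 up -> right_lim0 du2 dup ->
  rtransmits (ReC um) (ReC dum) (ReC up) (ReC dup) ->
  rtransmits (ImC um) (ImC dum) (ImC up) (ImC dup) ->
  exists A B : state, [/\
    forward P q1 q2 (ReC lam) (fun x => - ImC lam * s1 B x) (fun x => - ImC lam * s2 B x) A,
    forward P q1 q2 (ReC lam) (fun x => ImC lam * s1 A x) (fun x => ImC lam * s2 A x) B,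
    forall x, Jminus x -> u1 x = s1 A x +i* s1 B x /\ du1 x = ds1 A x +i* ds1 B x &
    forall x, Jplus x -> u2 x = s2 A x +i* s2 B x /\ du2 x = ds2 A x +i* ds2 B x].
Proof.
move=> sol1 sol2 um' dum' up' dup' tR tI.
have eq1 x : - pi < x < 0 -> deriv_on Jminus u1 x (du1 x) /\ exists2 d2u : R[i],
    deriv_on Jminus du1 x d2u & - p1%:C * d2u + (q1 x)%:C * u1 x = lam * u1 x.
  move=> xI; have Jx : Jminus x by apply: itv_sub_Jminus; rewrite /= in_itv.
  have [h [d2 h2 e]] := sol1 x Jx; split => //; exists d2 => //.
  by move: e; rewrite /pcoef /piecewise (_ : x < 0 = true) ?q1E//; case/andP: xI.
have eq2 x : 0 < x < pi -> deriv_on Jplus u2 x (du2 x) /\ exists2 d2u : R[i],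
    deriv_on Jplus du2 x d2u & - p2%:C * d2u + (q2 x)%:C * u2 x = lam * u2 x.
  move=> xI; have Jx : Jplus x by apply: itv_sub_Jplus; rewrite /= in_itv.
  have [h [d2 h2 e]] := sol2 x Jx; split => //; exists d2 => //.
  move: e; rewrite /pcoef /piecewise (_ : x < 0 = false) ?q2E//.
  by apply/negbTE; rewrite -leNgt ltW//; case/andP: xI.
have [h1 [d1 h1' _]] := sol1 _ Jminus_Npi; have [h2 [d2 h2' _]] := sol2 _ Jplus_pi.
have [A1 [dA1 [ddA1 [B1 [dB1 [ddB1 [[CA1 CB1 E1] V1 [va dva] [vb dvb]]]]]]]] :=
  complex_solution_ext pi_neg p1_gt0 itv_sub_Jminus cq1 eq1
    (at_right_within itv_sub_Jminus pi_neg (T := R[i]^o) (f := u1) (deriv_on_cvg h1)) um'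
    (at_right_within itv_sub_Jminus pi_neg (T := R[i]^o) (f := du1) (deriv_on_cvg h1')) dum'.
have [A2 [dA2 [ddA2 [B2 [dB2 [ddB2 [[CA2 CB2 E2] V2 [wa dwa] [wb dwb]]]]]]]] :=
  complex_solution_ext (pi_gt0 R) p2_gt0 itv_sub_Jplus cq2 eq2 up'
    (at_left_within itv_sub_Jplus (pi_gt0 R) (T := R[i]^o) (f := u2) (deriv_on_cvg h2)) dup'
    (at_left_within itv_sub_Jplus (pi_gt0 R) (T := R[i]^o) (f := du2) (deriv_on_cvg h2')).
exists (State A1 dA1 ddA1 A2 dA2 ddA2), (State B1 dB1 ddB1 B2 dB2 ddB2); split.
- split => //= [x xI|x xI|]; first by rewrite (E1 x xI).1; ring.
    by rewrite (E2 x xI).1; ring.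
  by move: tR; rewrite vb dvb wa dwa /transmits /=.
- split => //= [x xI|x xI|]; first by rewrite (E1 x xI).2; ring.
    by rewrite (E2 x xI).2; ring.
  by move: tI; rewrite vb dvb wa dwa /transmits /=.
- move=> x; rewrite /Jminus /= in_itv/= => /andP[]; rewrite le_eqVlt => /predU1P[<- //|h3 h4].
  by apply: V1; rewrite h3.
- move=> x; rewrite /Jplus /= in_itv/= => /andP[h3]; rewrite le_eqVlt => /predU1P[-> //|h4].
  by apply: V2; rewrite h3.
Qed.

(** For a real parameter the parts decouple, and the imaginary part has zero data at [- pi]. *)
Lemma phi_real lam (u1 du1 u2 du2 : R -> R[i]) : is_phi1 P lam%:C u1 du1 ->
  is_phi2 P lam%:C u1 du1 u2 du2 -> exists phi : state, [/\ regular P q1 q2 lam phi,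
    forall x, Jminus x -> u1 x = (s1 phi x)%:C /\ du1 x = (ds1 phi x)%:C &
    forall x, Jplus x -> u2 x = (s2 phi x)%:C /\ du2 x = (ds2 phi x)%:C].
Proof.
move=> [sol1 ua dua] [sol2 [a [b [la lb ra rb]]]].
set up := (_ * _) in ra; set dup := (_ * _) in rb.
have [tR tI] : rtransmits (ReC a) (ReC b) (ReC up) (ReC dup) /\
    rtransmits (ImC a) (ImC b) (ImC up) (ImC dup).
  by rewrite /up /dup -rmorphN /rtransmits !ReImZ !ReImD /=; split.
have [A [B [fA fB V1 V2]]] := solution_state sol1 sol2 la lb ra rb tR tI.
have [e1 e2] := V1 _ Jminus_Npi.
have {fA}fA : forward P q1 q2 lam (fun=> 0) (fun=> 0) A.
  by move: fA; congr forward; apply/funext => x; rewrite /= oppr0 mul0r.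
have {fB}fB : forward P q1 q2 lam (fun=> 0) (fun=> 0) B.
  by move: fB; congr forward; apply/funext => x; rewrite /= mul0r.
move: e1 e2; rewrite ua dua => -[y yB] [z zB]; rewrite oppr0 in zB.
have [B1 B2] := forward_zero p1_gt0 p2_gt0 D12_gt0 D34_gt0 cq1 cq2 fB (esym yB) (esym zB).
exists A; split; first by split.
  move=> x Jx; have [-> ->] := V1 x Jx.
  have [[_ xI]|[Jx' _]] := J_cases (or_introl Jx); first by have [-> ->] := B1 x xI.
  by move: Jx Jx'; rewrite /Jminus /Jplus /= !in_itv/= => /andP[_ x0] /andP[/(lt_trans x0)]; rewrite ltxx.
move=> x Jx; have [-> ->] := V2 x Jx.
have [[Jx' _]|[_ xI]] := J_cases (or_intror Jx); last by have [-> ->] := B2 x xI.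
by move: Jx Jx'; rewrite /Jminus /Jplus /= !in_itv/= => /andP[x0 _] /andP[_ /(lt_trans x0)]; rewrite ltxx.
Qed.

Lemma transmission_rtransmits (um dum up dup : R[i]) : transmission P um dum up dup <->
  rtransmits (ReC um) (ReC dum) (ReC up) (ReC dup) /\
  rtransmits (ImC um) (ImC dum) (ImC up) (ImC dup).
Proof.
split=> [h|[/rtransmitsP h1 /rtransmitsP h2] i].
  by split; apply/rtransmitsP => i; have := h i; rewrite !ReImZ !ReImD /= => -[].
by rewrite !ReImZ !ReImD /=; apply/eqP; rewrite eq_complex /= h1 h2 !eqxx.
Qed.

Lemma phi2_transmission (lam : R[i]) (u1 du1 u2 du2 : R -> R[i]) :
  is_phi2 P lam u1 du1 u2 du2 -> exists um dum up dup : R[i],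
    [/\ left_lim0 u1 um, left_lim0 du1 dum, right_lim0 u2 up, right_lim0 du2 dup &
        transmission P um dum up dup].
Proof.
move=> [_ [a [b [la lb ra rb]]]].
exists a, b, ((D 1 2)^-1%:C * ((D 2 3)%:C * a + (D 2 4)%:C * b)),
  (- (D 1 2)^-1%:C * ((D 1 3)%:C * a + (D 1 4)%:C * b)); split => //.
apply/transmission_rtransmits.
by rewrite -rmorphN /rtransmits !ReImZ !ReImD /=; split.
Qed.

Lemma near_piecewise_left (f g : R -> R[i]) (l : R[i]) :
  left_lim0 (piecewise f g) l <-> left_lim0 f l.
Proof.
suff E : \forall t \near (0 : R)^'-, piecewise f g t = f t.
  by split; apply: cvg_trans; apply: near_eq_cvg; apply: filterS E => t ->.
by near=> t; rewrite /piecewise ifT//; near: t; exact: nbhs_left_lt.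
Unshelve. all: by end_near. Qed.

Lemma near_piecewise_right (f g : R -> R[i]) (l : R[i]) :
  right_lim0 (piecewise f g) l <-> right_lim0 g l.
Proof.
suff E : \forall t \near (0 : R)^'+, piecewise f g t = g t.
  by split; apply: cvg_trans; apply: near_eq_cvg; apply: filterS E => t ->.
near=> t; rewrite /piecewise ifF//; apply/negbTE; rewrite -leNgt; apply: ltW; near: t.
exact: nbhs_right_gt.
Unshelve. all: by end_near. Qed.

Lemma solution_on_eq (I : set R) (lam : R[i]) (u du v dv : R -> R[i]) :
  (forall x, I x -> u x = v x /\ du x = dv x) ->
  solution_on P I lam u du -> solution_on P I lam v dv.
Proof.
move=> E sol x Ix; have [ux dux] := E x Ix; have [h [d2 h2 e]] := sol x Ix.
have tr (f g : R -> R[i]) (l : R[i]) : (forall y, I y -> f y = g y) ->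
    deriv_on I f x l -> deriv_on I g x l.
  move=> fg; apply: cvg_trans; apply: near_eq_cvg; rewrite near_withinE; near=> t => It.
  by rewrite !fg.
split; first by rewrite -dux; apply: tr h => y /E[].
by exists d2; [apply: tr h2 => y /E[]|rewrite -ux].
Unshelve. all: by end_near. Qed.

Lemma eigenvalue_of_bc2 lam (u1 du1 u2 du2 : R -> R[i]) phi : is_phi1 P lam%:C u1 du1 ->
  is_phi2 P lam%:C u1 du1 u2 du2 -> regular P q1 q2 lam phi ->
  (forall x, Jminus x -> u1 x = (s1 phi x)%:C /\ du1 x = (ds1 phi x)%:C) ->
  (forall x, Jplus x -> u2 x = (s2 phi x)%:C /\ du2 x = (ds2 phi x)%:C) ->
  bc2 P phi = 0 -> bv_eigenvalue P lam%:C.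
Proof.
move=> [sol1 ua dua] phi2P [fphi y z] V1 V2 w0; have [sol2 _] := phi2P.
have [um [dum [up [dup [la lb ra rb tr]]]]] := phi2_transmission phi2P.
have m (T : Type) (f g : R -> T) x : Jminus x -> piecewise f g x = f x.
  by rewrite /Jminus /piecewise /= in_itv/= => /andP[_ ->].
have p (T : Type) (f g : R -> T) x : Jplus x -> piecewise f g x = g x.
  by rewrite /Jplus /piecewise /= in_itv/= => /andP[/ltW x0 _]; rewrite ltNge x0.
exists (piecewise u1 u2), (piecewise du1 du2); split.
- split; first by apply: solution_on_eq sol1 => x Jx; rewrite !m.
  by apply: solution_on_eq sol2 => x Jx; rewrite !p.
- by rewrite !(m _ _ _ _ Jminus_Npi) ua dua; ring.
- rewrite !(p _ _ _ _ Jplus_pi); have [-> ->] := V2 _ Jplus_pi; move: w0; rewrite /bc2 => w0.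
  by rewrite -!rmorphM -rmorphD w0.
- exists um, dum, up, dup; split; [exact/near_piecewise_left|exact/near_piecewise_left|
    exact/near_piecewise_right|exact/near_piecewise_right|exact: tr].
(* If the glued function vanished on [J], the norm of [phi] would be 0. *)
- have [//|nex] := pselect (exists2 x, (Jminus `|` Jplus) x & piecewise u1 u2 x != 0).
  have : 0 < ip P (glue phi) (glue phi).
    exact: (regular_norm_gt0 p1_gt0 p2_gt0 D12_gt0 D34_gt0 (And3 fphi y z)).
  rewrite /ip (@eq_wint _ _ _ (fun=> 0)) => [|x Jx].
    by rewrite /wint /Rintegral !integral0 /= !mulr0 addr0 ltxx.
  have gl : piecewise u1 u2 x = (glue phi x)%:C.
    by case: Jx => Jx; rewrite /glue; [rewrite !m// (V1 x Jx).1|rewrite !p// (V2 x Jx).1].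
  have [gx0|gxn0] := eqVneq (piecewise u1 u2 x) 0.
    by move: gx0; rewrite gl => -[->]; rewrite mulr0.
  by case: nex; exists x.
Qed.

(** The parts satisfy [L A = lr A - li B] and [L B = lr B + li A], so symmetry of [L] gives
    [li (|A|^2 + |B|^2) = 0] and [li] is 0. Both parts are then multiples of [phi], and if [bc2 phi]
    were not 0, the condition at [pi] would make both multiples zero. *)
Lemma eigenvalue_real (lam : R[i]) : bv_eigenvalue P lam -> ImC lam = 0 /\
  forall phi, regular P q1 q2 (ReC lam) phi -> bc2 P phi = 0.
Proof.
move=> [u [du [[sol1 sol2] b1 b2 [um [dum [up [dup [la lb ra rb tr]]]]] [x0 Jx0 ux0]]]].
have [tR tI] := (transmission_rtransmits _ _ _ _).1 tr.
have [A [B [fA fB V1 V2]]] := solution_state sol1 sol2 la lb ra rb tR tI.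
set lr := ReC lam in fA fB *; set li := ImC lam in fA fB *.
have [bA1 bB1] : bc1 P A = 0 /\ bc1 P B = 0.
  by move: b1; have [-> ->] := V1 _ Jminus_Npi; rewrite !ReImZ !ReImD /= => -[].
have [bA2 bB2] : bc2 P A = 0 /\ bc2 P B = 0.
  by move: b2; have [-> ->] := V2 _ Jplus_pi; rewrite !ReImZ !ReImD /= => -[].
have [aA1 aA2] := piecewise_agree (s1 A) (s2 A).
have [aB1 aB2] := piecewise_agree (s1 B) (s2 B).
have uE x : J x -> u x = glue A x +i* glue B x.
  by case=> Jx; rewrite /glue; [rewrite aA1// aB1// (V1 x Jx).1|rewrite aA2// aB2// (V2 x Jx).1].
have [cA1 cA2] := forward_continuous fA; have [cB1 cB2] := forward_continuous fB.
have pA := glue_pw fA; have pB := glue_pw fB.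
have nz : ~ (forall x, J x -> glue A x = 0 /\ glue B x = 0).
  by move=> AB0; move/eqP: ux0; rewrite uE//; have [-> ->] := AB0 _ Jx0.
have LL (s t : state) (k : R) : forward P q1 q2 lr (fun x => k * s1 t x) (fun x => k * s2 t x) s ->
    continuous (s1 s) -> continuous (s2 s) -> continuous (s1 t) -> continuous (s2 t) ->
    bc1 P s = 0 -> bc2 P s = 0 ->
    L P q1 q2 (glue s) (fun x => lr * glue s x + k * glue t x).
  move=> [C1 C2' e1 e2 tt] cs1 cs2 ct1 ct2 z1 z2.
  have [as1 as2] := piecewise_agree (s1 s) (s2 s).
  have [at1 at2] := piecewise_agree (s1 t) (s2 t).
  exists s, (fun x => lr * s1 s x + k * s1 t x), (fun x => lr * s2 s x + k * s2 t x); split => //.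
  - by split; apply: continuous_comb => //; exact: continuous_funZ.
  - by split=> x Jx; rewrite /glue; [rewrite as1// at1|rewrite as2// at2].
  - by split => // x xI; [rewrite e1//; ring|rewrite e2//; ring].
have LA := LL A B _ fA cA1 cA2 cB1 cB2 bA1 bA2.
have LB := LL B A _ fB cB1 cB2 cA1 cA2 bB1 bB2.
have pAA := pw_continuousM pA pA; have pBB := pw_continuousM pB pB.
have pAB := pw_continuousM pA pB; have p0 := pw_continuous_cst (0 : R).
have wlin := wint_lin P.
have := L_sym p1_gt0 p2_gt0 D12_gt0 LA LB.
rewrite /ip (@eq_wint _ _ _ (fun x => (0 + lr * (glue A x * glue B x)) + li * (glue A x * glue A x))); last first.
  by move=> x _; ring.
rewrite [in RHS](@eq_wint _ _ _ (fun x => (0 + lr * (glue A x * glue B x)) + - li * (glue B x * glue B x))); last first.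
  by move=> x _; ring.
rewrite !wlin//; try exact: pw_continuousD.
rewrite -/(ip P (glue A) (glue A)) -/(ip P (glue B) (glue B)) => h.
have hA := si_ge0 (pw_semi_inner p1_gt0 p2_gt0 D12_gt0 D34_gt0) pA.
have hB := si_ge0 (pw_semi_inner p1_gt0 p2_gt0 D12_gt0 D34_gt0) pB.
have li0 : li = 0.
  apply/eqP/negPn/negP => lin0.
  have hAB : ip P (glue A) (glue A) + ip P (glue B) (glue B) = 0.
    by apply: (mulfI lin0); rewrite mulr0; lra.
  apply: nz => x Jx; split.
    by apply: (ip_definite p1_gt0 p2_gt0 D12_gt0 D34_gt0 pA) => //; lra.
  by apply: (ip_definite p1_gt0 p2_gt0 D12_gt0 D34_gt0 pB) => //; lra.
split=> // phi rphi.
have fA' : forward P q1 q2 lr (fun=> 0) (fun=> 0) A.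
  by move: fA; rewrite li0; congr forward; apply/funext => x; rewrite oppr0 mul0r.
have fB' : forward P q1 q2 lr (fun=> 0) (fun=> 0) B.
  by move: fB; rewrite li0; congr forward; apply/funext => x; rewrite mul0r.
have mult := regular_multiple p1_gt0 p2_gt0 D12_gt0 D34_gt0 cq1 cq2 rphi.
have [kA [mA1 mA2]] := mult _ fA' bA1; have [kB [mB1 mB2]] := mult _ fB' bB1.
apply/eqP/negPn/negP => w0.
have pi_itv : 0 <= (pi : R) <= pi by rewrite pi_ge0 lexx.
have kill (s : state) k : bc2 P s = 0 -> s2 s pi = k * s2 phi pi -> ds2 s pi = k * ds2 phi pi -> k = 0.
  rewrite /bc2 => h0 h1 h2; apply/eqP; move: h0; rewrite h1 h2.
  rewrite (_ : _ + _ = k * bc2 P phi); last by rewrite /bc2; ring.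
  by move/eqP; rewrite mulf_eq0 (negbTE w0) orbF.
have kA0 := kill A kA bA2 (mA2 _ pi_itv).1 (mA2 _ pi_itv).2.
have kB0 := kill B kB bB2 (mB2 _ pi_itv).1 (mB2 _ pi_itv).2.
apply: nz => x /J_cases[[Jx xI]|[Jx xI]]; rewrite /glue.
  by rewrite aA1// aB1// (mA1 x xI).1 (mB1 x xI).1 kA0 kB0 !mul0r.
by rewrite aA2// aB2// (mA2 x xI).1 (mB2 x xI).1 kA0 kB0 !mul0r.
Qed.

Lemma wintegral_real (F : R -> R[i]) (f : R -> R) : (forall x, J x -> F x = (f x)%:C) ->
  wintegral P F = (wint P f)%:C.
Proof.
move=> Ff.
have CE (I : set R) : I `<=` J -> Cintegral I F = (\int[completed_lebesgue_measure]_(x in I) f x)%:C.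
  move=> IJ; rewrite /Cintegral; apply/eqP; rewrite eq_complex /=; apply/andP; split; apply/eqP.
    by apply: eq_Rintegral => x /set_mem /IJ /Ff ->.
  rewrite (_ : Rintegral _ _ _ = \int[completed_lebesgue_measure]_(x in I) (fun=> 0 : R) x).
    by rewrite /Rintegral integral0.
  by apply: eq_Rintegral => x /set_mem /IJ /Ff ->.
rewrite /wintegral !CE; [|by move=> x; right|by move=> x; left].
by rewrite -!rmorphM -rmorphD.
Qed.

End ComplexProblem.

(** * Extension of the coefficient [q], and the expansion for the boundary value problem *)

Section WithinExtension.
Context {R : realType}.

Lemma within_cvg (A : set R) (f : R -> R) x : {within A, continuous f} -> A x ->
  f t @[t --> within A x^'] --> f x.
Proof.
move=> cf Ax; have := (subspace_continuousP A f).1 cf x Ax.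
apply: cvg_trans; apply: cvg_app => B BAx.
by apply: filterS (BAx : \forall t \near x, A t -> B t) => t ABt _.
Qed.

Lemma extend_within a b (A : set R) (f : R -> R) la lb : a < b -> `]a, b[ `<=` A ->
  {within A, continuous f} -> f t @[t --> a^'+] --> la -> f t @[t --> b^'-] --> lb ->
  exists g : R -> R, [/\ continuous g, forall x, a < x < b -> g x = f x, g a = la & g b = lb].
Proof.
move=> ab abA cf; apply: extend_continuous => // x xab.
apply/continuous_withinNx; apply: (dnbhs_within abA xab).
by apply: within_cvg cf _; apply: abA; rewrite /= in_itv.
Qed.

End WithinExtension.

Theorem theorem5p1 (R : realType) (P : bvtp R)
    (p1_gt0 : 0 < bv_p1 P) (p2_gt0 : 0 < bv_p2 P)
    (q_contm : {within Jminus, continuous (bv_q P)})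
    (q_contp : {within Jplus, continuous (bv_q P)})
    (q_limm : exists l : R, bv_q P x @[x --> (0 : R)^'-] --> l)
    (q_limp : exists l : R, bv_q P x @[x --> (0 : R)^'+] --> l)
    (Delta12_gt0 : 0 < Delta P 1 2) (Delta34_gt0 : 0 < Delta P 3 4)
    (eigen0 : ~ bv_eigenvalue P 0)
    (phi1 dphi1 phi2 dphi2 : R[i] -> R -> R[i])
    (phi1P : forall lam : R[i], is_phi1 P lam (phi1 lam) (dphi1 lam))
    (phi2P : forall lam : R[i],
       is_phi2 P lam (phi1 lam) (dphi1 lam) (phi2 lam) (dphi2 lam))
    (lambda : nat -> R[i])
    (lambdaP : set_bij [set: nat] (bv_eigenvalue P) lambda)
    (f : R -> R)
    (f_sqm : square_integrable_on Jminus f)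
    (f_sqp : square_integrable_on Jplus f) :
  let phi n := piecewise (phi1 (lambda n)) (phi2 (lambda n)) in
  let varphi n := wnormalize P (phi n) in
  let c k := fourier_coef P f (varphi k) in
  wintegral P
    (fun x => ((f x)%:C - \sum_(0 <= k < n.+1) c k * varphi k x) ^+ 2)
    @[n --> \oo] --> (0 : R[i]^o).
Proof.
move=> phi varphi c.
have [q1 [cq1 q1E]] : exists q1 : R -> R, continuous q1 /\ forall x, Jminus x -> bv_q P x = q1 x.
  have [l ql] := q_limm.
  have [q1 [cq1 q1i q1a _]] := extend_within pi_neg itv_sub_Jminus q_contm
    (at_right_within itv_sub_Jminus pi_neg (within_cvg q_contm Jminus_Npi)) ql.
  exists q1; split=> // x; rewrite /Jminus /= in_itv/= => /andP[].
  by rewrite le_eqVlt => /predU1P[<- //|h1 h2]; rewrite q1i// h1.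
have [q2 [cq2 q2E]] : exists q2 : R -> R, continuous q2 /\ forall x, Jplus x -> bv_q P x = q2 x.
  have [l ql] := q_limp.
  have [q2 [cq2 q2i _ q2b]] := extend_within (pi_gt0 R) itv_sub_Jplus q_contp ql
    (at_left_within itv_sub_Jplus (pi_gt0 R) (within_cvg q_contp Jplus_pi)).
  exists q2; split=> // x; rewrite /Jplus /= in_itv/= => /andP[h1].
  by rewrite le_eqVlt => /predU1P[-> //|h2]; rewrite q2i// h1.
(* The given solutions become real states at every real parameter, not only at eigenvalues: [Phi 0]
   yields the inverse of [L], and [Phi m] decides which bound holds at [m]. *)
have /choice[Phi PhiP] : forall mu : R, exists s : state, [/\ regular P q1 q2 mu s,
    forall x, Jminus x -> phi1 mu%:C x = (s1 s x)%:C /\ dphi1 mu%:C x = (ds1 s x)%:C &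
    forall x, Jplus x -> phi2 mu%:C x = (s2 s x)%:C /\ dphi2 mu%:C x = (ds2 s x)%:C].
  by move=> mu; exact: (phi_real p1_gt0 p2_gt0 Delta12_gt0 Delta34_gt0 cq1 cq2 q1E q2E
    (phi1P mu%:C) (phi2P mu%:C)).
have bc2_eigen mu : bc2 P (Phi mu) = 0 -> bv_eigenvalue P mu%:C.
  have [r V1 V2] := PhiP mu.
  exact: (eigenvalue_of_bc2 p1_gt0 p2_gt0 Delta12_gt0 Delta34_gt0 (phi1P _) (phi2P _) r V1 V2).
have [lam_in lam_inj lam_surj] := lambdaP.
pose lam n := complex.Re (lambda n).
have lamE n : lambda n = (lam n)%:C.
  have [+ _] := eigenvalue_real p1_gt0 p2_gt0 Delta12_gt0 Delta34_gt0 cq1 cq2 q1E q2E (lam_in n Logic.I).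
  by rewrite /lam; case: (lambda n) => a b /= ->.
pose phin n := Phi (lam n).
have reg n : regular P q1 q2 (lam n) (phin n) by case: (PhiP (lam n)).
have bc2n n : bc2 P (phin n) = 0.
  have [_] := eigenvalue_real p1_gt0 p2_gt0 Delta12_gt0 Delta34_gt0 cq1 cq2 q1E q2E (lam_in n Logic.I).
  by apply; exact: reg.
have lam0 n : lam n != 0.
  by apply/eqP => l0; apply: eigen0; have := lam_in n Logic.I; rewrite lamE l0.
have bc20 : bc2 P (Phi 0) != 0 by apply/eqP => /bc2_eigen.
have reg0 : regular P q1 q2 0 (Phi 0) by case: (PhiP 0).
pose N n := ip P (glue (phin n)) (glue (phin n)).
have N_gt0 n : 0 < N n := regular_norm_gt0 p1_gt0 p2_gt0 Delta12_gt0 Delta34_gt0 (reg n).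
have sN_gt0 n : 0 < Num.sqrt (N n) by rewrite sqrtr_gt0.
pose e n x := (Num.sqrt (N n))^-1 * glue (phin n) x.
have phiE n x : J x -> phi n x = (glue (phin n) x)%:C.
  have [_ V1 V2] := PhiP (lam n); rewrite /phi lamE /glue /piecewise -/(phin n).
  case=> Jx.
    by move: (Jx); rewrite /Jminus /= in_itv/= => /andP[_ ->]; exact: (V1 x Jx).1.
  move: (Jx); rewrite /Jplus /= in_itv/= => /andP[/ltW x0 _]; rewrite ltNge x0 /=.
  exact: (V2 x Jx).1.
have varphiE n x : J x -> varphi n x = (e n x)%:C.
  move=> Jx; rewrite /varphi /wnormalize phiE//.
  rewrite (@wintegral_real _ P _ (fun t => glue (phin n) t * glue (phin n) t)); last first.
    by move=> t Jt; rewrite phiE// -rmorphXn expr2.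
  rewrite -/(ip P (glue (phin n)) (glue (phin n))) -/(N n).
  (* The norm is positive, so the complex square root is the real one and the normalized
     eigenfunctions are real. *)
  have -> : sqrtC (N n)%:C = (Num.sqrt (N n))%:C.
    have s0 : 0 <= (Num.sqrt (N n))%:C by rewrite ler0c ltW.
    by rewrite -[RHS]sqrCK// -rmorphXn sqr_sqrtr// ltW.
  by rewrite -fmorphV -rmorphM.
have siS := sq_space_semi_inner p1_gt0 p2_gt0 Delta12_gt0 Delta34_gt0.
have siP := pw_semi_inner p1_gt0 p2_gt0 Delta12_gt0 Delta34_gt0.
have Sf : sq_space f by split.
have pg n : pw_continuous (glue (phin n)) by have [fs _ _] := reg n; exact: glue_pw fs.
(* A multiple is reached through the zero pair [u - u], as [L_lin] only provides [u + c * v]. *)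
have scale (u g : R -> R) k : L P q1 q2 u g -> L P q1 q2 (fun x => k * u x) (fun x => k * g x).
  move=> Lug; have := L_lin (-1) Lug Lug => L0; have := L_lin k L0 Lug.
  by congr L; apply/funext => x; ring.
have L_e n : L P q1 q2 (e n) (fun x => lam n * e n x).
  have := scale _ _ (Num.sqrt (N n))^-1 (L_regular (reg n) (bc2n n)).
  by congr L; apply/funext => x; rewrite /e; ring.
have pe n : pw_continuous (e n) by exact: (L_pw (L_e n)).1.
have ip_e (u : R -> R) n : pw_continuous u ->
    ip P u (e n) = (Num.sqrt (N n))^-1 * ip P u (glue (phin n)).
  by move=> pu; rewrite /e (ipZr siP).
have lam_injective j k : lam j = lam k -> j = k.
  by move=> jk; apply: lam_inj; rewrite ?inE// !lamE jk.
have e_orth j k : ip P (e j) (e k) = (j == k)%:R.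
  have [<-|jk] := eqVneq j k.
    have sNE : N j = Num.sqrt (N j) * Num.sqrt (N j) by rewrite -expr2 sqr_sqrtr// ltW.
    rewrite ip_e// (siC siP) ip_e// -/(N j) {3}sNE mulKf ?mulVf//;
      exact: lt0r_neq0.
  have := L_sym p1_gt0 p2_gt0 Delta12_gt0 (L_e j) (L_e k).
  rewrite (ipZr siP)// [in RHS](siC siP) (ipZr siP)// [in RHS](siC siP) => h.
  have : (lam k - lam j) * ip P (e j) (e k) = 0 by rewrite mulrBl h subrr.
  move/eqP; rewrite mulf_eq0 subr_eq0 => /orP[/eqP/lam_injective kj|/eqP //].
  by move: jk; rewrite kj eqxx.
have [M0 M00 M0P] := nonresonant_bound p1_gt0 p2_gt0 Delta12_gt0 Delta34_gt0 cq1 cq2 reg0 bc20.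
have L_bound (u g : R -> R) : L P q1 q2 u g -> forall x, J x -> u x ^+ 2 <= M0 * ip P g g.
  move=> Lug x Jx; have := M0P u g Lug x Jx.
  rewrite (_ : (fun y => g y + - 0 * u y) = g)//.
  by apply/funext => y; rewrite oppr0 mul0r addr0.
have W_gt0 := total_weight_gt0 p1_gt0 p2_gt0 Delta12_gt0 Delta34_gt0.
have ip_sup := @ip_le R P p1_gt0 p2_gt0 Delta12_gt0 Delta34_gt0.
have mass n (b : nat -> R) (B : R) :
    (forall x, J x -> \sum_(0 <= k < n) b k * e k x ^+ 2 <= B) ->
    \sum_(0 <= k < n) b k <= B * total_weight P.
  move=> bB.
  have [psum sumE] : pw_continuous (fun x => \sum_(0 <= k < n) b k * e k x ^+ 2) /\
      wint P (fun x => \sum_(0 <= k < n) b k * e k x ^+ 2) = \sum_(0 <= k < n) b k.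
    elim: n {bB} => [|n [IHp IHw]].
      rewrite (_ : (fun x => _) = (fun=> 0)); last by apply/funext => x; rewrite big_geq.
      split; first exact: pw_continuous_cst.
      by rewrite big_geq// /wint /Rintegral !integral0 /= !mulr0 addr0.
    have pee := pw_continuousM (pe n) (pe n).
    rewrite (_ : (fun x => _) = fun x => (\sum_(0 <= k < n) b k * e k x ^+ 2) + b n * (e n x * e n x)).
      split; first exact: pw_continuousD.
      rewrite wint_lin// IHw big_nat_recr//=; congr (_ + _).
      by rewrite -/(ip P (e n) (e n)) e_orth eqxx mulr1.
    by apply/funext => x; rewrite big_nat_recr//= expr2.
  by rewrite -sumE; exact: (wint_le p1_gt0 p2_gt0 Delta12_gt0 Delta34_gt0).
have gap (m : R) : exists2 K : R, 0 <= K & forall u g : R -> R, L P q1 q2 u g ->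
    (forall k, lam k = m -> ip P u (e k) = 0) ->
    ip P u u <= K * ip P (fun x => g x + - m * u x) (fun x => g x + - m * u x).
  have regm : regular P q1 q2 m (Phi m) by case: (PhiP m).
  have [w0|wn0] := eqVneq (bc2 P (Phi m)) 0.
    (* Completeness rests on this: the enumeration exhausts the eigenvalues, so every resonant [m]
       is some [lam k]. *)
    have [k _ lk] := lam_surj _ (bc2_eigen _ w0).
    have lamk : lam k = m by rewrite /lam lk.
    have [K K0 KP] := resonant_gap p1_gt0 p2_gt0 Delta12_gt0 Delta34_gt0 cq1 cq2 (reg k) (N_gt0 k).
    exists K; first exact: ltW.
    move=> u g Lug ue; rewrite -lamk; apply: KP => //.
    have := ue k lamk; rewrite ip_e; last exact: (L_pw Lug).1.
    by move/eqP; rewrite mulf_eq0 invr_eq0 (negbTE (lt0r_neq0 (sN_gt0 k))) => /eqP.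
  have [K K0 KP] := nonresonant_bound p1_gt0 p2_gt0 Delta12_gt0 Delta34_gt0 cq1 cq2 regm wn0.
  exists (K * total_weight P); first by rewrite mulr_ge0// ltW.
  move=> u g Lug _; rewrite mulrAC; apply: ip_sup; first exact: (L_pw Lug).1.
  exact: KP.
have expansion : ip P (fun x => f x - \sum_(0 <= k < n) ip P f (e k) * e k x)
    (fun x => f x - \sum_(0 <= k < n) ip P f (e k) * e k x) @[n --> \oo] --> (0 : R).
  apply: (@eigenfunction_expansion R sq_space pw_continuous (ip P) (L P q1 q2) J (total_weight P)
    M0 e lam siS siP) => //.
  - exact: pw_sq_space.
  - by move=> u g /L_pw.
  - by move=> g; exact: (L_exists p1_gt0 p2_gt0 cq1 cq2 reg0 bc20).
  - by move=> u v g h k; exact: L_lin.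
  - by move=> u v g h; exact: (L_sym p1_gt0 p2_gt0 Delta12_gt0).
  - exact: ltW.
  - by move=> g r; exact: (L_dense p1_gt0 p2_gt0 Delta12_gt0 Delta34_gt0 cq1 cq2).
have cE k : c k = (ip P f (e k))%:C.
  by rewrite /c /fourier_coef; apply: wintegral_real => x Jx; rewrite varphiE// -rmorphM.
have sumC n x : J x -> (f x)%:C - \sum_(0 <= k < n) c k * varphi k x =
    (f x - \sum_(0 <= k < n) ip P f (e k) * e k x)%:C.
  move=> Jx; rewrite rmorphB rmorph_sum /=; congr (_ - _).
  by apply: eq_bigr => k _; rewrite cE varphiE// -rmorphM.
pose r n := ip P (fun x => f x - \sum_(0 <= k < n) ip P f (e k) * e k x)
    (fun x => f x - \sum_(0 <= k < n) ip P f (e k) * e k x).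
(* The sum up to index [n] has [n.+1] terms, so the sequence is a shift of [r]. *)
rewrite (_ : (fun n => _) = (fun n => (r n.+1)%:C)); last first.
  apply/funext => n; apply: wintegral_real => x Jx.
  by rewrite sumC// -rmorphXn expr2.
apply/cvg_complexP; split => /=; last exact: cvg_cst.
by rewrite (cvg_shiftS r).
Qed.
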